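(* Let $p>1$ and $\lambda\in\mathbb{R}$. For some $\alpha>0$, there exists a global positive solution $$u\in\mathcal{C}([-\alpha,\alpha]\times[0,\infty))\cap\mathcal{C}^{2,1}([-\alpha,\alpha]\times(0,\infty))$$ of the problem $$\begin{cases}\partial_t u=\partial_x^2u-u\,\partial_xu+u^p-\lambda u & \text{in }[-\alpha,\alpha]\times(0,\infty),\\ u=0 & \text{on }\{\pm\alpha\}\times(0,\infty),\\ u(\cdot,0)=\varphi & \text{in }[-\alpha,\alpha]\end{cases}$$ if the non-negative initial data $\varphi\in\mathcal{C}_0([-\alpha,\alpha])$ is sufficiently small.
   Context: $\mathcal{C}_0([-\alpha,\alpha])$ denotes the continuous functions on $[-\alpha,\alpha]$ vanishing at $\pm\alpha$. Solutions satisfy the equations in the classical sense; global means defined for all $t\in[0,\infty)$. *)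

(* Defs.v *)
From HB Require Import structures.
From mathcomp Require Import all_boot all_order all_algebra.
From mathcomp Require Import all_classical all_reals all_analysis.

Set Implicit Arguments.
Unset Strict Implicit.
Unset Printing Implicit Defensive.

Import Order.TTheory GRing.Theory Num.Theory.
Import numFieldNormedType.Exports.

Local Open Scope classical_set_scope.
Local Open Scope ring_scope.

(* The limit of the difference quotient along y in D, y != x: at an endpoint of
   a closed interval D this is the one-sided derivative. *)
Definition has_derive_within (R : realType) (D : set R) (f : R -> R) (x l : R)
    : Prop :=
  (f y - f x) / (y - x) @[y --> within D x^'] --> l.

Definition continuous_on_prod (R : realType) (A B : set R) (v : R -> R -> R)
    : Prop :=
  {within A `*` B, continuous (fun z : R * R => v z.1 z.2)}.

Definition C0 (R : realType) (alpha : R) (phi : R -> R) : Prop :=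
  [/\ {within `[- alpha, alpha], continuous phi},
      phi (- alpha) = 0 & phi alpha = 0].

(* u is of class C^{2,1} on [-alpha, alpha] x (0, +oo), up to the lateral
   boundary, with time derivative ut and space derivatives ux, uxx. Functions
   take the space variable first; values outside the domain are irrelevant. *)
Definition C21_with (R : realType) (alpha : R) (u ut ux uxx : R -> R -> R)
    : Prop :=
  [/\ forall x t : R, x \in `[- alpha, alpha] -> 0 < t ->
        [/\ is_derive t 1 (u x) (ut x t),
            has_derive_within `[- alpha, alpha] (u ^~ t) x (ux x t)
          & has_derive_within `[- alpha, alpha] (ux ^~ t) x (uxx x t)],
      continuous_on_prod `[- alpha, alpha] `]0, +oo[ u,
      continuous_on_prod `[- alpha, alpha] `]0, +oo[ ut,
      continuous_on_prod `[- alpha, alpha] `]0, +oo[ ux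
    & continuous_on_prod `[- alpha, alpha] `]0, +oo[ uxx].

Definition global_classical_solution (R : realType) (p lambda alpha : R)
    (phi : R -> R) (u : R -> R -> R) : Prop :=
  continuous_on_prod `[- alpha, alpha] `[0, +oo[ u /\
  exists ut ux uxx : R -> R -> R,
    [/\ C21_with alpha u ut ux uxx,
        forall x t : R, x \in `[- alpha, alpha] -> 0 < t ->
          ut x t = uxx x t - u x t * ux x t + u x t `^ p - lambda * u x t,
        forall t : R, 0 < t -> u (- alpha) t = 0 /\ u alpha t = 0
      & forall x : R, x \in `[- alpha, alpha] -> u x 0 = phi x].

(* Positivity of a solution with non-negative initial datum phi. For phi = 0
   the solution is 0, so strict positivity is only required when phi does not
   vanish identically; it is impossible at x = -alpha, alpha. *)
Definition positive_solution (R : realType) (alpha : R) (phi : R -> R)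
    (u : R -> R -> R) : Prop :=
  (forall x t : R, x \in `[- alpha, alpha] -> 0 <= t -> 0 <= u x t) /\
  ((exists2 x, x \in `[- alpha, alpha] & phi x != 0) ->
   forall x t : R, x \in `]- alpha, alpha[ -> 0 < t -> 0 < u x t).

(* Main.v *)
Require Import Defs.
From HB Require Import structures.
From mathcomp Require Import all_boot all_order all_algebra.
From mathcomp Require Import all_classical all_reals all_analysis.
From mathcomp Require Import measurable_realfun ring lra.

Set Implicit Arguments.
Unset Strict Implicit.
Unset Printing Implicit Defensive.

Import Order.TTheory GRing.Theory Num.Theory.
Import numFieldNormedType.Exports.

Local Open Scope classical_set_scope.
Local Open Scope ring_scope.

(* Extend phi to an odd function about both endpoints -alpha and alpha, bounded
   on the whole line, and truncate the equation: u u_x becomes b(u) u_x with b the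
   identity clamped to [-1, 1], and u^p - lambda u becomes an odd, bounded,
   Lipschitz function f. The Picard iteration for Duhamel's formula
     u(t) = e^(t d_x^2) phi + \int_0^t e^((t - s) d_x^2) (f(u) - b(u) u_x)(s) ds
   converges for all times in norms weighted by e^(-K t), with sqrt t in front
   of u_x. Since u_x is 1/2-Holder in x, the mild solution is classical, and
   since the iteration preserves oddness, u vanishes at -alpha and alpha.
   Comparison with 0 and, when alpha is small with respect to the bound of f, with
   the barrier 1 - x^2 / (2 alpha^2) gives 0 <= u <= 1, where the truncation is
   inactive. Strict positivity follows by comparison with a small bump
   travelling from a point where phi is positive to the given point. *)

(** * Dominated convergence with parameters *)

(** Reflection lets the Gaussian on the line play the role of the Dirichlet heat kernel: as b and f
    are odd, and u_x is even about a point where u is odd, the source f(u) - b(u) u_x is odd again.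
    The obstacle is u_xx. The second derivative of the heat kernel at time t - s has L^1 norm of
    order 1 / (t - s), which is not integrable in s. Against a 1/2-Hölder source, the vanishing mean
    of this kernel improves the bound to (t - s)^(-3/4). The datum being only continuous, u_x may
    blow up like s^(-1/2) and the Hölder constant of the source like s^(-3/4). Both singularities
    together form s^(-3/4) (t - s)^(-3/4), a Beta(1/4, 1/4) density, and this single integrable
    function serves as majorant for orders 0, 1 and 2. The remaining obstacle is the time derivative
    of Duhamel's integral, whose kernel is singular exactly at the moving endpoint: increments in
    time are split into a delayed old part, treated by the mean value theorem in the delay, and an
    average over the new times. *)

Section dominated.
Context (R : realType).
Notation mu := (@lebesgue_measure R).
Let RR : measurableType _ := measurableTypeR R.
Variables (D : set RR) (w : RR -> R).
Hypotheses (mD : measurable D) (iw : mu.-integrable D (EFin \o w)).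

Let iCw (C : R) : mu.-integrable D (EFin \o (fun z : RR => C * w z)).
Proof.
by rewrite /comp; under [X in integrable _ _ X]eq_fun do rewrite EFinM; exact: integrableZl.
Qed.

Lemma dominated_integrable (g : RR -> R) (C : R) : measurable_fun D g ->
  (forall z, D z -> `|g z| <= C * w z) -> mu.-integrable D (EFin \o g).
Proof.
move=> mg gC; apply: (@le_integrable _ _ _ mu D mD _ _ _ _ (iCw C)).
- exact/measurable_EFinP.
- by move=> x Dx /=; rewrite lee_fin (le_trans (gC _ Dx))// ler_norm.
Qed.

Lemma dominated_Rintegral_le (g : RR -> R) (C : R) : measurable_fun D g ->
  (forall z, D z -> `|g z| <= C * w z) ->
  `|\int[mu]_(z in D) g z| <= C * \int[mu]_(z in D) w z.
Proof.
move=> mg gC; have ig := dominated_integrable mg gC.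
apply: (le_trans (le_normr_Rintegral mD ig)).
rewrite -RintegralZl//; apply: le_Rintegral => //.
exact: integrable_norm ig.
Qed.

(* A sequential filter argument: for a pseudometric parameter space, dominated
   convergence of sequences gives convergence of the integral along [within]. *)
Lemma dominated_cvg_param (T : pseudoMetricType R) (A : set T) (p : T)
    (F : T -> RR -> R) (f : RR -> R) (C : R) :
  (\forall q \near nbhs p, A q -> measurable_fun D (F q) /\
     forall z, D z -> `|F q z| <= C * w z) ->
  (forall z, D z -> F q z @[q --> within A (nbhs p)] --> f z) ->
  \int[mu]_(z in D) F q z @[q --> within A (nbhs p)] -->
  \int[mu]_(z in D) f z.
Proof.
move=> Fnear Ff; apply/cvgrPdist_lt => e e0; apply: contrapT => He.
have bad n : exists q : T, [/\ ball p (n.+1%:R^-1 : R) q, A q,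
    measurable_fun D (F q) /\ (forall z, D z -> `|F q z| <= C * w z) &
    e <= `|\int[mu]_(z in D) f z - \int[mu]_(z in D) F q z|].
  apply: contrapT => nex; apply: He.
  rewrite near_withinE; near=> q => Aq /=.
  rewrite ltNge; apply/negP => eq; apply: nex; exists q; split => //.
  - by near: q; apply: nbhsx_ballx; rewrite invr_gt0.
  - by move: Aq; near: q.
have {bad} [q_ hq] := choice bad.
have qp (P : set T) : (\forall q \near within A (nbhs p), P q) ->
    \forall n \near \oo, P (q_ n).
  rewrite near_withinE => /nbhs_ballP[d /= d0 dP].
  near=> n; have [bq Aq _ _] := hq n.
  apply: dP => //; apply: le_ball bq; apply: ltW.
  near: n; exact: (near_infty_natSinv_lt (PosNum d0)).
have mq n : measurable_fun D (fun z => (F (q_ n) z)%:E).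
  by apply/measurable_EFinP; have [_ _ []] := hq n.
have cv z : D z -> (F (q_ n) z)%:E @[n --> \oo] --> (f z)%:E.
  move=> Dz; apply: cvg_EFin; first exact: nearW.
  by move=> P /(Ff z Dz) HP; exact: qp HP.
have bq n z : D z -> (`|(F (q_ n) z)%:E| <= (C * w z)%:E)%E.
  by move=> Dz; rewrite lee_fin; have [_ _ [_ h] _] := hq n; exact: h.
have If : mu.-integrable D (EFin \o f).
  have mf : measurable_fun D (EFin \o f) by apply: emeasurable_fun_cvg cv => n; exact: mq.
  apply: (@le_integrable _ _ _ mu D mD _ _ mf _ (iCw C)) => z Dz /=.
  rewrite lee_fin (le_trans _ (ler_norm _))//.
  have cz : F (q_ n) z @[n --> \oo] --> f z by move=> P /(Ff z Dz) HP; exact: qp HP.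
  apply: (ler_cvg_to (cvg_norm cz) (cvg_cst (C * w z))).
  by apply: nearW => n; rewrite -lee_fin; exact: bq.
have fCw z : D z -> (EFin \o (fun z : RR => C * w z)) z \is a fin_num by [].
have dc := dominated_cvg mD mq cv fCw (iCw C) bq.
have dc' : \int[mu]_(z in D) F (q_ n) z @[n --> \oo] --> \int[mu]_(z in D) f z.
  apply: fine_cvg; rewrite /Rintegral fineK//; exact: integrable_fin_num.
have : \forall n \near \oo, `|\int[mu]_(z in D) f z - \int[mu]_(z in D) F (q_ n) z| < e.
  by move/cvgrPdist_lt : dc' => /(_ _ e0).
move=> [N _ /(_ N (leqnn N)) /=]; rewrite ltNge; have [_ _ _ ->] := hq N.
by [].
Unshelve. all: by end_near.
Qed.

End dominated.

(** * Affine change of variables in Lebesgue integrals *)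

Section affine.
Context (R : realType).
Notation mu := (@lebesgue_measure R).
Let RR : measurableType _ := measurableTypeR R.
Variables (a b : R) (a0 : a != 0).
Let aff (z : RR) : RR := a * z + b.

Let maff : measurable_fun setT aff.
Proof.
have : measurable_fun setT (fun z : R => a * z + b).
  apply: continuous_measurable_fun => x.
  by apply: cvgD; [apply: cvgM; [exact: cvg_cst|exact: cvg_id]|exact: cvg_cst].
by [].
Qed.

Let preimage_affine_itvoc (u v : R) : aff @^-1` `]u, v] =
  (if 0 < a then `](u - b) / a, (v - b) / a] else `[(v - b) / a, (u - b) / a[)%classic.
Proof.
case: ifPn => [ap|an]; apply/seteqP; split=> z /=; rewrite !in_itv/= /aff.
- by rewrite ltr_pdivrMr// ler_pdivlMr// ltrBlDr lerBrDr mulrC.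
- by rewrite ltr_pdivrMr// ler_pdivlMr// ltrBlDr lerBrDr mulrC.
- have {}an : a < 0 by rewrite lt_neqAle a0 leNgt.
  by rewrite ler_ndivrMr// ltr_ndivlMr// ltrBlDr lerBrDr (mulrC z) andbC.
- have {}an : a < 0 by rewrite lt_neqAle a0 leNgt.
  by rewrite ler_ndivrMr// ltr_ndivlMr// ltrBlDr lerBrDr (mulrC z) andbC.
Qed.

Let k : {nonneg R} := NngNum (normr_ge0 a).
Let pf : {measure set RR -> \bar R} :=
  measure_function_pushforward__canonical__measure_function_Measure mu maff.

(** By uniqueness of Lebesgue measure it is enough to compare lengths on intervals ]u, v], whose
    preimages are intervals scaled by 1 / a, with the open and closed ends exchanged when a < 0. *)
Let lebesgue_measure_affine (A : set RR) : measurable A ->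
  mu A = mscale k pf A.
Proof.
move: A; apply: lebesgue_measure_unique => X [[u v] _ <-] /=.
rewrite /mscale/= /pushforward.
have [uv|vu] := ltP u v; last first.
  rewrite set_itv_ge ?preimage_set0 ?measure0 ?mule0//.
  by rewrite bnd_simp -leNgt.
rewrite preimage_affine_itvoc lebesgue_measure_itv/= lte_fin uv.
case: ifPn => [ap|an]; rewrite lebesgue_measure_itv/= lte_fin.
  rewrite ltr_pM2r ?invr_gt0// ltrD2r uv -!EFinB -EFinM gtr0_norm//.
  by congr EFin; field.
have {}an : a < 0 by rewrite lt_neqAle a0 leNgt.
rewrite ltr_nM2r ?invr_lt0// ltrD2r uv -!EFinB -EFinM ltr0_norm//.
by congr EFin; field.
Qed.

Lemma ge0_integral_affine (D : set RR) (f : RR -> \bar R) : measurable D ->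
  measurable_fun D f -> (forall x, D x -> 0 <= f x)%E ->
  (\int[mu]_(y in D) f y = `|a|%:E * \int[mu]_(z in aff @^-1` D) f (aff z))%E.
Proof.
move=> mD mf f0.
rewrite (@eq_measure_integral _ _ _ D (mscale k pf) mu).
  rewrite ge0_integral_mscale//= (ge0_integral_pushforward maff)//.
  by move=> y; rewrite inE; exact: f0.
by move=> A mA _; exact: lebesgue_measure_affine.
Qed.

Lemma measurable_preimage_affine (D : set RR) : measurable D -> measurable (aff @^-1` D).
Proof. by move=> mD; rewrite -[X in measurable X]setTI; exact: maff. Qed.

Lemma integrable_affine (D : set RR) (f : RR -> R) : measurable D ->
  measurable_fun D f ->
  mu.-integrable (aff @^-1` D) (EFin \o (f \o aff)) <-> mu.-integrable D (EFin \o f).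
Proof.
move=> mD mf.
have mfa : measurable_fun (aff @^-1` D) (f \o aff).
  apply: (measurable_comp mD) => //; first by move=> _ [z /= ? <-].
  exact: measurable_funTS.
have mf' : measurable_fun D (fun x => `|(f x)%:E|)%E.
  by apply: measurableT_comp => //; exact/measurable_EFinP.
have k0 : (0 < `|a|)%R by rewrite normr_gt0.
have key := ge0_integral_affine mD mf' (fun x _ => abse_ge0 _).
split=> /integrableP[_ fi]; apply/integrableP; split; [exact/measurable_EFinP|..].
- by rewrite key lte_mul_pinfty.
- exact/measurable_EFinP.
(* An infinite integral over the preimage would stay infinite after multiplication by |a| > 0. *)
- move: fi; rewrite key => fi.
  have := leey (\int[mu]_(x in aff @^-1` D) `|(EFin \o (f \o aff)) x|)%E.
  rewrite le_eqVlt => /orP[/eqP h|//].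
  by move: fi; rewrite [X in (_ * X)%E]h gt0_muley ?ltxx// lte_fin.
Qed.

Lemma Rintegral_affine (D : set RR) (f : RR -> R) : measurable D ->
  measurable_fun D f -> mu.-integrable D (EFin \o f) ->
  \int[mu]_(y in D) f y = `|a| * \int[mu]_(z in aff @^-1` D) f (aff z).
Proof.
move=> mD mf fi.
have fai := (integrable_affine mD mf).2 fi.
have mpre := measurable_preimage_affine mD.
have mEf : measurable_fun D (EFin \o f) by exact/measurable_EFinP.
rewrite /Rintegral integralE [in RHS]integralE.
have kp := ge0_integral_affine mD (measurable_funepos mEf) (fun x _ => funepos_ge0 _ x).
have kn := ge0_integral_affine mD (measurable_funeneg mEf) (fun x _ => funeneg_ge0 _ x).
rewrite kp kn.
have fp := integrable_pos_fin_num mpre fai.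
have fn := integrable_neg_fin_num mpre fai.
have ep : (\int[mu]_(z in aff @^-1` D) (EFin \o f)^\+ (aff z) =
  \int[mu]_(z in aff @^-1` D) (EFin \o (f \o aff))^\+ z)%E.
  by apply: eq_integral => z _; rewrite !funeposE.
have en : (\int[mu]_(z in aff @^-1` D) (EFin \o f)^\- (aff z) =
  \int[mu]_(z in aff @^-1` D) (EFin \o (f \o aff))^\- z)%E.
  by apply: eq_integral => z _; rewrite !funenegE.
rewrite ep en.
rewrite -muleBr//; last by apply: fin_num_adde_defl; rewrite fin_numN.
by rewrite fineM// fin_numB fp fn.
Qed.

End affine.

(** * Derivatives and heat kernels *)

Section calculus.
Context (R : realType).
Implicit Types (f g : R -> R) (x a b : R).

Lemma is_derive_congr f g x a b : is_derive x 1 f a ->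
  (forall y, f y = g y) -> a = b -> is_derive x 1 g b.
Proof. by move=> fa /funext <- <-. Qed.

Lemma is_derive_add f g x a b : is_derive x 1 f a -> is_derive x 1 g b ->
  is_derive x 1 (fun y => f y + g y) (a + b).
Proof. exact: is_deriveD. Qed.

Lemma is_derive_sub f g x a b : is_derive x 1 f a -> is_derive x 1 g b ->
  is_derive x 1 (fun y => f y - g y) (a - b).
Proof. exact: is_deriveB. Qed.

Lemma is_derive_mul f g x a b : is_derive x 1 f a -> is_derive x 1 g b ->
  is_derive x 1 (fun y => f y * g y) (a * g x + f x * b).
Proof.
move=> fa gb; apply: (is_derive_eq (is_deriveM fa gb)).
by rewrite /GRing.scale/=; ring.
Qed.

Lemma is_derive_inv f x a : f x != 0 -> is_derive x 1 f a ->
  is_derive x 1 (fun y => (f y)^-1) (- a / f x ^+ 2).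
Proof.
move=> fx0 fa; apply: (is_derive_eq (is_deriveV fx0 fa)).
by rewrite /GRing.scale/=; field.
Qed.

Lemma is_derive_chain f g x a b : is_derive (g x) 1 f a -> is_derive x 1 g b ->
  is_derive x 1 (fun y => f (g y)) (a * b).
Proof. exact: is_derive1_comp. Qed.

Lemma is_derive_continuous f x a : is_derive x 1 f a -> {for x, continuous f}.
Proof. by move=> [fa _]; apply: differentiable_continuous; exact/derivable1_diffP. Qed.

(** Substituting y = x + h gives the quotient form, which is the one in [has_derive_within] and the
    one suited to one-sided sign arguments. *)
Lemma is_derive_quot f x a : is_derive x 1 f a <->
  (f y - f x) / (y - x) @[y --> x^'] --> a.
Proof.
have E : ((fun h => h^-1 *: (f (h *: 1 + x) - f x)) @ 0^' --> a) <->
  ((f y - f x) / (y - x) @[y --> x^'] --> a).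
  rewrite !cvgrPdist_lt; split=> H e /H /nbhs_ballP[d /= d0 dH]; apply/nbhs_ballP.
    exists d => //= y yd yx.
    have := dH (y - x); rewrite /ball/= sub0r opprB => /(_ yd).
    rewrite subr_eq0 => /(_ yx).
    by rewrite /GRing.scale/= mulr1 subrK mulrC.
  exists d => //= h hd h0.
  have := dH (h + x); rewrite /ball/= opprD addrCA subrr addr0.
  move: hd; rewrite /ball/= sub0r => hd /(_ hd).
  rewrite -subr_eq0 addrK => /(_ h0).
  by rewrite /GRing.scale/= mulr1 mulrC.
rewrite -E; split=> [[d <-]|H]; last first.
  by apply: DeriveDef; [apply/cvg_ex; exists a|apply/cvg_lim].
by [].
Qed.

End calculus.

(** * Differentiation under the integral sign *)

Section derive_under.
Context (R : realType).
Notation mu := (@lebesgue_measure R).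
Let RR : measurableType _ := measurableTypeR R.
Variables (D : set RR) (w : RR -> R).
Hypotheses (mD : measurable D) (iw : mu.-integrable D (EFin \o w))
  (w0 : forall z, 0 <= w z).

Lemma is_derive_Rintegral (f f' : R -> RR -> R) (a e C : R) : 0 < e ->
  (forall x, `|x - a| < e -> mu.-integrable D (EFin \o f x)) ->
  (forall x z, `|x - a| < e -> D z -> is_derive x 1 (f ^~ z) (f' x z)) ->
  (forall x z, `|x - a| < e -> D z -> `|f' x z| <= C * w z) ->
  is_derive a 1 (fun x => \int[mu]_(z in D) f x z) (\int[mu]_(z in D) f' a z).
Proof.
move=> e0 fi fd fC.
have I x : `]a - e, a + e[%classic x -> `|x - a| < e.
  by rewrite /= in_itv/= ltr_distlC => /andP[? ?]; apply/andP; split; lra.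
have aI : `]a - e, a + e[%classic a by rewrite /= in_itv/=; apply/andP; split; lra.
have ae : `|a - a| < e by rewrite subrr normr0.
have dE x z : `]a - e, a + e[%classic x -> D z -> partial1of2 f x z = f' x z.
  by move=> /I xa Dz; rewrite partial1of2E; have [_ ->] := fd _ _ xa Dz.
have h1 x : `]a - e, a + e[%classic x -> mu.-integrable D (EFin \o f x) by move=> /I/fi.
have h2 x z : `]a - e, a + e[%classic x -> D z -> derivable (f ^~ z) x 1.
  by move=> /I xa Dz; have [] := fd _ _ xa Dz.
(* The majorant has to be non-negative and C carries no sign, hence [|C|]. *)
have G0 (z : RR) : 0 <= `|C| * w z by rewrite mulr_ge0.
have iG : mu.-integrable D (EFin \o (fun z => `|C| * w z)).
  by rewrite /comp; under [X in integrable _ _ X]eq_fun do rewrite EFinM; exact: integrableZl.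
have h3 x z : `]a - e, a + e[%classic x -> D z -> `|partial1of2 f x z| <= `|C| * w z.
  move=> xI Dz; rewrite dE// (le_trans (fC _ _ (I _ xI) Dz))//.
  by rewrite ler_wpM2r// ler_norm.
have dv := derivable_under_integral mD aI h1 h2 G0 iG h3.
apply: DeriveDef => //.
rewrite -derive1E (differentiation_under_integral mD aI h1 h2 G0 iG h3).
by apply: eq_Rintegral => z; rewrite inE => Dz; rewrite dE.
Qed.
End derive_under.

(** * The Gaussian kernels and a common majorant *)

Section kernels.
Context (R : realType).
Notation mu := (@lebesgue_measure R).
Let RR : measurableType _ := measurableTypeR R.

(** The heat kernel at time 1 is the normal density of variance 2, so this is 1 / sqrt (4 pi). *)
Definition heat_peak : R := normal_peak (Num.sqrt 2).

(* The heat kernel at time 1 and its first two derivatives. *)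
Definition heat_ker (j : nat) (z : R) : R :=
  (match j with 0 => 1 | 1 => - (z / 2) | _ => z ^+ 2 / 4 - 2^-1 end) *
  (heat_peak * expR (- (z ^+ 2 / 4))).

(** Up to a factor, the normal density of standard deviation 4. It is wide enough to dominate the
    kernels together with polynomial factors, shifts by at most 1 and changes of time between 1/2
    and 3/2. *)
Definition gmaj (z : R) : R := expR (- (z ^+ 2 / 32)).

Lemma heat_peak_gt0 : 0 < heat_peak.
Proof. by rewrite normal_peak_gt0// gt_eqF// sqrtr_gt0. Qed.

Lemma gmaj_ge0 (z : RR) : 0 <= gmaj z. Proof. exact: expR_ge0. Qed.

Lemma continuous_gauss (c : R) : continuous (fun z : R => expR (- (z ^+ 2 / c))).
Proof.
move=> z; apply: (@continuous_comp _ _ _ (fun z : R => - (z ^+ 2 / c)) expR); last exact: continuous_expR.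
apply: continuousN; apply: continuousM; last exact: cst_continuous.
exact: exprn_continuous.
Qed.

Lemma integrable_gmaj : mu.-integrable [set: RR] (EFin \o gmaj).
Proof.
have s0 : (4 : R) != 0 by rewrite pnatr_eq0.
have p0 := normal_peak_gt0 s0.
have E : EFin \o gmaj = (fun x => ((normal_peak (4:R))^-1)%:E * (normal_pdf 0 4 x)%:E)%E.
  apply/funext => x; rewrite -EFinM /= normal_pdfE// /normal_fun /gmaj subr0.
  congr EFin; rewrite mulrA mulVf ?gt_eqF// mul1r; congr expR.
  by field.
by rewrite E; apply: integrableZl => //; exact: integrable_normal_pdf.
Qed.

Lemma Rintegral_heat_ker0 : \int[mu]_(z in [set: RR]) heat_ker 0 z = 1.
Proof.
have s0 : (Num.sqrt 2 : R) != 0 by rewrite gt_eqF// sqrtr_gt0.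
rewrite /Rintegral -[RHS]/(fine 1%:E) -(integral_normal_pdf 0 (Num.sqrt (2:R))).
congr fine; apply: eq_integral => z _; rewrite normal_pdfE// /normal_fun.
rewrite /heat_ker mul1r subr0 sqr_sqrtr//; congr (_ * expR _)%:E.
by field.
Qed.

Lemma continuous_heat_ker j : continuous (heat_ker j).
Proof.
have h0 : continuous (fun z : R => heat_peak * expR (- (z ^+ 2 / 4))).
  by move=> z; apply: cvgM; [exact: cvg_cst|exact: continuous_gauss].
have h2 : continuous (fun z : R => z ^+ 2 / 4 - 2^-1).
  move=> z; apply: cvgB; last exact: cvg_cst.
  by apply: cvgM; [exact: exprn_continuous|exact: cvg_cst].
case: j => [|[|j]] z; apply: cvgM; try exact: h0; try exact: cvg_cst.
- by apply: cvgN; apply: cvgM; [exact: cvg_id|exact: cvg_cst].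
- exact: h2.
Qed.

Lemma measurable_heat_ker j : measurable_fun [set: RR] (heat_ker j).
Proof. by apply: continuous_measurable_fun; exact: continuous_heat_ker. Qed.

Lemma is_derive_heat_peak (z : R) :
  is_derive z 1 (fun y => heat_peak * expR (- (y ^+ 2 / 4)))
    (- (z / 2) * (heat_peak * expR (- (z ^+ 2 / 4)))).
Proof.
have h1 : is_derive z 1 (fun y : R => - (y ^+ 2 / 4)) (- (z / 2)).
  apply: (is_derive_congr (is_derive_mul (is_derive_mul (is_derive_id z 1)
    (is_derive_id z 1)) (is_derive_cst (- 4^-1 : R) z 1))) => [y|] /=; last by field.
  by rewrite /cst expr2; field.
have h2 := is_derive_chain (is_derive_expR _) h1.
by apply: (is_derive_congr (is_derive_mul (is_derive_cst heat_peak z 1) h2)) => [//|] /=; rewrite /cst; ring.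
Qed.

Lemma is_derive_heat_ker j (z : R) : (j < 2)%N ->
  is_derive z 1 (heat_ker j) (heat_ker j.+1 z).
Proof.
have h0 := is_derive_heat_peak z.
case: j => [|[|//]] _.
  by apply: (is_derive_congr h0) => // y; rewrite /heat_ker mul1r.
have h1 : is_derive z 1 (fun y : R => - (y / 2)) (- 2^-1).
  apply: (is_derive_congr (is_derive_mul (is_derive_id z 1)
    (is_derive_cst (- 2^-1 : R) z 1))) => [y|] /=; last by ring.
  by rewrite /cst mulrN.
by apply: (is_derive_congr (is_derive_mul h1 h0)) => [y//|]; rewrite /heat_ker/=; field.
Qed.

(** 289 = 17^2 pays for the polynomial factors in [heat_ker_decay], and e for a shift in
    [heat_ker_shift_le]. *)
Definition ker_const : R := 289 * heat_peak * expR 1.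

Lemma ker_const_gt0 : 0 < ker_const.
Proof.
have h : 0 < 289 :> R by rewrite ltr0n.
exact: (mulr_gt0 (mulr_gt0 h heat_peak_gt0) (expR_gt0 1)).
Qed.

Let c289_ge0 : 0 <= 289 * heat_peak :> R.
Proof. by rewrite mulr_ge0 ?ler0n// ltW// heat_peak_gt0. Qed.

(** The polynomial in the kernel is at most 1 + y^2, and so is the weight; each is absorbed by 17
    exp(y^2 / 16), which costs half of the exponent - y^2 / 4. *)
Lemma heat_ker_decay j (y : R) :
  `|heat_ker j y| * (1 + y ^+ 2) <= 289 * heat_peak * expR (- (y ^+ 2 / 8)).
Proof.
have p0 := heat_peak_gt0; have e0 := expR_gt0 (- (y ^+ 2 / 4)).
have y2 : 0 <= y ^+ 2 by exact: sqr_ge0.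
rewrite /heat_ker normrM (gtr0_norm (mulr_gt0 p0 e0)).
apply: (@le_trans _ _ ((1 + y ^+ 2) ^+ 2 * (heat_peak * expR (- (y ^+ 2 / 4))))).
  rewrite mulrAC ler_wpM2r//; first by rewrite ltW// mulr_gt0.
  rewrite expr2 ler_wpM2r//; first lra.
  case: j => [|[|j]]; first by rewrite normr1; lra.
    by rewrite ler_norml; apply/andP; split; nra.
  by rewrite ler_norml; apply/andP; split; nra.
have h : 1 + y ^+ 2 <= 17 * expR (y ^+ 2 / 16).
  by have := expR_ge1Dx (y ^+ 2 / 16); lra.
have h2 : (1 + y ^+ 2) ^+ 2 <= 289 * expR (y ^+ 2 / 8).
  have -> : y ^+ 2 / 8 = y ^+ 2 / 16 + y ^+ 2 / 16 by field.
  rewrite expRD; have := expR_gt0 (y ^+ 2 / 16); nra.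
have -> : - (y ^+ 2 / 8) = y ^+ 2 / 8 - y ^+ 2 / 4 by field.
rewrite expRD (_ : _ * (expR _ * _) = 289 * expR (y ^+ 2 / 8) * (heat_peak * expR (- (y ^+ 2 / 4)))); last by ring.
by rewrite ler_wpM2r// ltW// mulr_gt0.
Qed.

Lemma heat_ker_le j (y : R) : `|heat_ker j y| <= 289 * heat_peak * expR (- (y ^+ 2 / 8)).
Proof.
apply: le_trans (heat_ker_decay j y); rewrite ler_peMr//.
by have := sqr_ge0 y; lra.
Qed.

(** A majorant uniform in h, for differentiation in x once the translation has been moved onto the
    kernel. For |h| <= 1, the square of z + 2 h gives (z + h)^2 / 8 >= z^2 / 32 - 1. *)
Lemma heat_ker_shift_le j (z h : R) : `|h| <= 1 -> `|heat_ker j (z + h)| <= ker_const * gmaj z.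
Proof.
move=> h1; apply: (le_trans (heat_ker_le _ _)).
have p0 := heat_peak_gt0.
rewrite /ker_const /gmaj -[leRHS]mulrA -expRD (ler_wpM2l c289_ge0)// ler_expR.
have h2 : h ^+ 2 <= 1 by rewrite -real_normK ?num_real// expr_le1.
have := sqr_ge0 (z + h *+ 2); rewrite mulr2n; nra.
Qed.

Lemma heat_ker_gmaj j (z : R) : `|heat_ker j z| <= ker_const * gmaj z.
Proof. by have := @heat_ker_shift_le j z 0; rewrite addr0 normr0; apply. Qed.

(** The factor sqrt |z| arises when the kernel is tested against 1/2-Hölder data. The weight of
    [heat_ker_decay] absorbs it, since sqrt |z| <= 1 + z^2. *)
Lemma heat_ker_sqrt_gmaj j (z : R) : Num.sqrt `|z| * `|heat_ker j z| <= ker_const * gmaj z.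
Proof.
have y2 : 0 <= z ^+ 2 by exact: sqr_ge0.
have p0 := heat_peak_gt0.
apply: (@le_trans _ _ (`|heat_ker j z| * (1 + z ^+ 2))).
  rewrite mulrC ler_wpM2l//.
  have E := sqr_sqrtr (normr_ge0 z); have F := real_normK (num_real z).
  have := sqr_ge0 (Num.sqrt `|z| - 1); have := sqr_ge0 (`|z| - 1).
  by rewrite !sqrrB1 E F; lra.
apply: (le_trans (heat_ker_decay _ _)).
rewrite /ker_const /gmaj -[leRHS]mulrA -expRD (ler_wpM2l c289_ge0)// ler_expR.
by nra.
Qed.

(* The family in [h] is the heat kernel at time [1 + h]. *)
Lemma is_derive_heat_scale (z h : R) : -1 < h ->
  is_derive h 1 (fun h => (Num.sqrt (1 + h))^-1 * heat_ker 0 (z / Num.sqrt (1 + h)))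
   ((1 + h)^-1 * ((Num.sqrt (1 + h))^-1 * heat_ker 2 (z / Num.sqrt (1 + h)))).
Proof.
move=> h1; have p0 : 0 < 1 + h by lra.
have s0 : 0 < Num.sqrt (1 + h) by rewrite sqrtr_gt0.
have sn0 : Num.sqrt (1 + h) != 0 by rewrite gt_eqF.
have sE : Num.sqrt (1 + h) ^+ 2 = 1 + h by rewrite sqr_sqrtr// ltW.
have ds : is_derive h 1 (fun h => Num.sqrt (1 + h)) ((2 * Num.sqrt (1 + h))^-1).
  apply: (is_derive_congr (is_derive_chain (is_derive1_sqrt p0)
    (is_derive_add (is_derive_cst (1:R) h 1) (is_derive_id h 1)))) => //.
  by rewrite add0r mulr1.
have di := is_derive_inv (f := fun h => Num.sqrt (1 + h)) sn0 ds.
have dz := is_derive_mul (is_derive_cst z h 1) di.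
have dk := is_derive_chain (g := fun h => z * (Num.sqrt (1 + h))^-1)
  (is_derive_heat_ker (j := 0) (z / Num.sqrt (1 + h)) isT) dz.
apply: (is_derive_congr (is_derive_mul di dk)) => //.
move: sE sn0; rewrite /heat_ker /= /cst; set s := Num.sqrt (1 + h) => sE sn0.
rewrite -sE; set e := expR _; set pk := heat_peak; by field.
Qed.

Lemma heat_scale_le (z h : R) : `|h| < 2^-1 ->
  `|(1 + h)^-1 * ((Num.sqrt (1 + h))^-1 * heat_ker 2 (z / Num.sqrt (1 + h)))| <=
  4 * ker_const * gmaj z.
Proof.
rewrite ltr_norml => /andP[h1 h2].
have p0 : 0 < 1 + h by lra.
have s0 : 0 < Num.sqrt (1 + h) by rewrite sqrtr_gt0.
have sE : Num.sqrt (1 + h) ^+ 2 = 1 + h by rewrite sqr_sqrtr// ltW.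
have i1 : (1 + h)^-1 <= 2 by rewrite -[leRHS]invrK lef_pV2 ?posrE//; lra.
have i2 : (Num.sqrt (1 + h))^-1 <= 2.
  by rewrite -[leRHS]invrK lef_pV2 ?posrE//; nra.
rewrite normrM [X in _ * X]normrM (gtr0_norm (x := _^-1)) ?invr_gt0//.
rewrite (gtr0_norm (x := (Num.sqrt _)^-1)) ?invr_gt0//.
have hk : `|heat_ker 2 (z / Num.sqrt (1 + h))| <= ker_const * gmaj z.
  apply: (le_trans (heat_ker_le _ _)).
  have pk := heat_peak_gt0.
  rewrite /ker_const /gmaj -[leRHS]mulrA -expRD (ler_wpM2l c289_ge0)// ler_expR.
  rewrite expr_div_n sE.
  (* As 1 + h <= 4, the exponent 1/8 of [heat_ker_le] degrades at most to the 1/32 of [gmaj]. *)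
  have i3 : 4^-1 <= (1 + h)^-1 by rewrite lef_pV2 ?posrE//; lra.
  by have := sqr_ge0 z; nra.
have g0 : 0 <= ker_const * gmaj z by apply: le_trans hk.
have i0 : 0 <= (1 + h)^-1 by rewrite invr_ge0 ltW.
have j0 : 0 <= (Num.sqrt (1 + h))^-1 by rewrite invr_ge0 ltW.
have -> : 4 * ker_const * gmaj z = 2 * (2 * (ker_const * gmaj z)) by ring.
by apply: ler_pM => //; apply: ler_pM.
Qed.

End kernels.

(** * The heat semigroup *)

Section heat_operator.
Context (R : realType).
Notation mu := (@lebesgue_measure R).
Let RR : measurableType _ := measurableTypeR R.

Definition bounded_cont (C : R) (phi : R -> R) :=
  continuous phi /\ forall x, `|phi x| <= C.

(** Convolution with the kernel at time s^2, in the rescaled variable z = (x - y) / s: it stays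
    meaningful at s = 0, and x and s occur only in the argument of phi. *)
Definition gauss_avg (j : nat) (phi : R -> R) (x s : R) : R :=
  \int[mu]_(z in [set: RR]) (phi (x - s * z) * heat_ker j z).

(* [heat_op j phi x t] is the j-th space derivative, at (x, t), of the solution
   of the heat equation with initial datum phi. *)
Definition heat_op (j : nat) (phi : R -> R) (x t : R) : R :=
  (Num.sqrt t ^+ j)^-1 * gauss_avg j phi x (Num.sqrt t).

Definition heat_const : R := @ker_const R * \int[mu]_(z in [set: RR]) gmaj z.

Lemma heat_const_ge0 : 0 <= heat_const.
Proof.
rewrite mulr_ge0 ?(ltW (ker_const_gt0 _))//.
by apply: Rintegral_ge0 => z _; exact: gmaj_ge0.
Qed.

Section fixed_datum.
Variables (C : R) (phi : R -> R).
Hypothesis bphi : bounded_cont C phi.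

Let C0 : 0 <= C. Proof. by apply: le_trans (bphi.2 0). Qed.

Lemma continuous_affine_comp (x s : R) : continuous (fun z => phi (x - s * z)).
Proof.
move=> z; apply: (@continuous_comp _ _ _ (fun z : R => x - s * z) phi); last exact: bphi.1.
by apply: cvgB; [exact: cvg_cst|apply: cvgM; [exact: cvg_cst|exact: cvg_id]].
Qed.

Lemma measurable_gauss_avg j (x s : R) :
  measurable_fun [set: RR] (fun z => phi (x - s * z) * heat_ker j z).
Proof.
apply: continuous_measurable_fun => z.
by apply: cvgM; [exact: continuous_affine_comp|exact: continuous_heat_ker].
Qed.

Lemma gauss_avg_dom j (x s : R) (z : RR) :
  `|phi (x - s * z) * heat_ker j z| <= C * @ker_const R * gmaj z.
Proof.
rewrite normrM -mulrA; apply: ler_pM => //; first exact: bphi.2.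
exact: heat_ker_gmaj.
Qed.

Lemma integrable_gauss_avg j (x s : R) :
  mu.-integrable [set: RR] (EFin \o (fun z => phi (x - s * z) * heat_ker j z)).
Proof.
apply: (dominated_integrable measurableT (integrable_gmaj R) (measurable_gauss_avg j x s)).
by move=> z _; exact: gauss_avg_dom.
Qed.

Lemma gauss_avg_le j (x s : R) : `|gauss_avg j phi x s| <= C * heat_const.
Proof.
rewrite mulrA; apply: (dominated_Rintegral_le measurableT (integrable_gmaj R) (measurable_gauss_avg j x s)).
by move=> z _; exact: gauss_avg_dom.
Qed.

Lemma heat_op_le j (x t : R) : `|heat_op j phi x t| <= C * heat_const / Num.sqrt t ^+ j.
Proof.
rewrite /heat_op normrM mulrC ler_pM ?gauss_avg_le//.
by rewrite ger0_norm// invr_ge0 exprn_ge0// sqrtr_ge0.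
Qed.

Lemma gauss_avg0 (x : R) : gauss_avg 0 phi x 0 = phi x.
Proof.
rewrite /gauss_avg; under eq_Rintegral do rewrite mul0r subr0.
rewrite RintegralZl//; first by rewrite Rintegral_heat_ker0 mulr1.
apply: (dominated_integrable measurableT (integrable_gmaj R) (measurable_heat_ker 0)).
by move=> z _; exact: heat_ker_gmaj.
Qed.

Lemma heat_op00 (x : R) : heat_op 0 phi x 0 = phi x.
Proof. by rewrite /heat_op expr0 invr1 mul1r sqrtr0 gauss_avg0. Qed.

(** The datum is merely continuous, so the translation in x is moved onto the smooth kernel before
    differentiating. *)
Lemma gauss_avg_shift j (x s h : R) : s != 0 ->
  gauss_avg j phi (x + s * h) s = \int[mu]_(z in [set: RR]) (phi (x - s * z) * heat_ker j (z + h)).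
Proof.
move=> s0; rewrite /gauss_avg.
have o : (1 : R) != 0 by rewrite oner_eq0.
rewrite (Rintegral_affine h o measurableT (measurable_gauss_avg j _ _) (integrable_gauss_avg j _ _)).
rewrite normr1 mul1r preimage_setT; apply: eq_Rintegral => z _.
by rewrite mul1r; congr (phi _ * _); ring.
Qed.

Lemma is_derive_gauss_avg j (x s : R) : (j < 2)%N -> s != 0 ->
  is_derive x 1 (fun y => gauss_avg j phi y s) (s^-1 * gauss_avg j.+1 phi x s).
Proof.
move=> j2 s0.
have ms h : measurable_fun [set: RR] (fun z => phi (x - s * z) * heat_ker j (z + h)).
  apply: continuous_measurable_fun => z.
  apply: cvgM; first exact: continuous_affine_comp.
  apply: (@continuous_comp _ _ _ (fun z : R => z + h) (heat_ker j)); last exact: continuous_heat_ker.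
  by apply: cvgD; [exact: cvg_id|exact: cvg_cst].
have dG : is_derive (0 : R) 1
    (fun h => \int[mu]_(z in [set: RR]) (phi (x - s * z) * heat_ker j (z + h)))
    (\int[mu]_(z in [set: RR]) (phi (x - s * z) * heat_ker j.+1 (z + 0))).
  apply: (is_derive_Rintegral measurableT (integrable_gmaj R) (@gmaj_ge0 R)
    (f := fun h z => phi (x - s * z) * heat_ker j (z + h))
    (f' := fun h z => phi (x - s * z) * heat_ker j.+1 (z + h))
    (e := 1) (C := C * @ker_const R)) => //.
  - move=> h; rewrite subr0 => h1.
    apply: (dominated_integrable measurableT (integrable_gmaj R) (ms h) (C := C * @ker_const R)).
    move=> z _; rewrite normrM -mulrA; apply: ler_pM => //; first exact: bphi.2.
    by apply: heat_ker_shift_le; exact: ltW.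
  - move=> h z _ _.
    have hc := is_derive_chain (g := fun h => z + h) (is_derive_heat_ker (z + h) j2)
      (is_derive_add (is_derive_cst z h 1) (is_derive_id h 1)).
    apply: (is_derive_congr (is_derive_mul (is_derive_cst (phi (x - s * z)) h 1) hc)) => //.
    by rewrite /cst /=; ring.
  - move=> h z; rewrite subr0 => h1 _; rewrite normrM -mulrA; apply: ler_pM => //; first exact: bphi.2.
    by apply: heat_ker_shift_le; exact: ltW.
have dq : is_derive x 1 (fun y => (y - x) / s) (s^-1).
  apply: (is_derive_congr (is_derive_mul (is_derive_sub (is_derive_id x 1) (is_derive_cst x x 1))
    (is_derive_cst s^-1 x 1))) => //.
  by rewrite /cst /=; ring.
have q0 : (x - x) / s = 0 by rewrite subrr mul0r.
rewrite -{1}q0 in dG.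
have dc := is_derive_chain (g := fun y => (y - x) / s) dG dq.
apply: (is_derive_congr dc) => [y|].
  by rewrite -gauss_avg_shift//; congr (gauss_avg _ _ _ _); field.
by rewrite mulrC /gauss_avg; congr (_ * _); apply: eq_Rintegral => z _; rewrite addr0.
Qed.

Lemma is_derive_heat_op j (x t : R) : (j < 2)%N -> 0 < t ->
  is_derive x 1 (fun y => heat_op j phi y t) (heat_op j.+1 phi x t).
Proof.
move=> j2 t0; have s0 : Num.sqrt t != 0 by rewrite gt_eqF// sqrtr_gt0.
apply: (is_derive_congr (is_derive_mul (is_derive_cst (Num.sqrt t ^+ j)^-1 x 1)
  (is_derive_gauss_avg x j2 s0))) => //.
by rewrite /heat_op /cst mul0r add0r exprS invfM mulrA [_^-1 * (_)^-1]mulrC.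
Qed.

(** The analogue of [gauss_avg_shift] for time: a dilation of s is moved onto the kernel. *)
Lemma gauss_avg_scale (x s l : R) : 0 < l ->
  gauss_avg 0 phi x (s * l) =
  \int[mu]_(z in [set: RR]) (phi (x - s * z) * (l^-1 * heat_ker 0 (z / l))).
Proof.
move=> l0; rewrite /gauss_avg.
have o : l^-1 != 0 by rewrite invr_eq0 gt_eqF.
rewrite (Rintegral_affine 0 o measurableT (measurable_gauss_avg 0 _ _) (integrable_gauss_avg 0 _ _)).
have ln0 : l != 0 by rewrite gt_eqF.
have il0 : 0 < l^-1 by rewrite invr_gt0.
have ia := (integrable_affine 0 o measurableT (measurable_gauss_avg 0 x (s * l))).2 (integrable_gauss_avg 0 _ _).
rewrite preimage_setT in ia *.
rewrite (gtr0_norm il0) -(RintegralZl l^-1 measurableT ia).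
apply: eq_Rintegral => z _; rewrite /= addr0 mulrCA; congr (phi _ * (_ * heat_ker _ _)); last by rewrite mulrC.
by field.
Qed.

(** The heat equation. With the relative increment h = (r - t) / t, time r corresponds to the kernel
    at time 1 + h, whose h-derivative at 0 is [heat_ker 2]. *)
Lemma is_derive_heat_op_time (x t : R) : 0 < t ->
  is_derive t 1 (fun r => heat_op 0 phi x r) (heat_op 2 phi x t).
Proof.
move=> t0; set s := Num.sqrt t.
have s0 : 0 < s by rewrite sqrtr_gt0.
have sE : s ^+ 2 = t by rewrite sqr_sqrtr// ltW.
pose k h z : R := (Num.sqrt (1 + h))^-1 * heat_ker 0 (z / Num.sqrt (1 + h)).
pose k' h z : R := (1 + h)^-1 * ((Num.sqrt (1 + h))^-1 * heat_ker 2 (z / Num.sqrt (1 + h))).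
have dG : is_derive (0 : R) 1
    (fun h => \int[mu]_(z in [set: RR]) (phi (x - s * z) * k h z))
    (\int[mu]_(z in [set: RR]) (phi (x - s * z) * k' 0 z)).
  apply: (is_derive_Rintegral measurableT (integrable_gmaj R) (@gmaj_ge0 R)
    (f := fun h z => phi (x - s * z) * k h z)
    (f' := fun h z => phi (x - s * z) * k' h z)
    (e := 2^-1) (C := C * (4 * @ker_const R))) => //.
  - move=> h; rewrite subr0 ltr_norml => /andP[h1 h2].
    rewrite /k; have: 0 < Num.sqrt (1 + h) by rewrite sqrtr_gt0; lra.
    set l := Num.sqrt (1 + h) => l0.
    have o : l^-1 != 0 by rewrite invr_eq0 gt_eqF.
    have := (integrable_affine 0 o measurableT
      (measurable_gauss_avg 0 x (s * l))).2 (integrable_gauss_avg 0 _ _).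
    rewrite preimage_setT => /(integrableZl measurableT l^-1).
    apply: eq_integrable => // z _; rewrite -EFinM/= addr0; congr EFin.
    rewrite mulrCA; congr (phi _ * (_ * heat_ker _ _)); last by rewrite mulrC.
    by have ln0 : l != 0 by [rewrite gt_eqF]; field.
  - move=> h z; rewrite subr0 ltr_norml => /andP[h1 h2] _.
    have h1' : -1 < h by lra.
    apply: (is_derive_congr (is_derive_mul (is_derive_cst (phi (x - s * z)) h 1)
      (is_derive_heat_scale z h1'))) => //.
    by rewrite /cst /k' mul0r add0r.
  - move=> h z; rewrite subr0 => h1 _; rewrite normrM -[leRHS]mulrA; apply: ler_pM => //; first exact: bphi.2.
    exact: heat_scale_le.
have dq : is_derive t 1 (fun r => (r - t) / t) (t^-1).
  apply: (is_derive_congr (is_derive_mul (is_derive_sub (is_derive_id t 1) (is_derive_cst t t 1))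
    (is_derive_cst t^-1 t 1))) => //.
  by rewrite /cst /=; ring.
have q0 : (t - t) / t = 0 by rewrite subrr mul0r.
rewrite -{1}q0 in dG.
have dc := is_derive_chain (g := fun y => (y - t) / t) dG dq.
have tn0 : t != 0 by rewrite gt_eqF.
have dE : (\int[mu]_(z in [set: RR]) (phi (x - s * z) * k' 0 z)) * t^-1 = heat_op 2 phi x t.
  rewrite /heat_op sE mulrC /gauss_avg; congr (_ * _); apply: eq_Rintegral => z _.
  by rewrite /k' addr0 sqrtr1 !invr1 !mul1r mulr1.
rewrite -dE; apply: (near_eq_is_derive _ dc).
near=> r; have r0 : 0 < r by near: r; exact: lt_nbhsr.
have e1 : 1 + (r - t) / t = r / t by field.
rewrite /heat_op expr0 invr1 mul1r -gauss_avg_scale; last by rewrite e1 sqrtr_gt0 divr_gt0.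
by rewrite e1 /s -sqrtrM ?(ltW t0)// mulrC divfK.
Unshelve. all: by end_near.
Qed.

(** Here [e] is the parity of the kernel; z -> - z turns the reflection of x about a / 2 into a
    reflection of the datum. *)
Lemma gauss_avg_odd (j : nat) (e a x s : R) : (forall y, phi (a - y) = - phi y) ->
  (forall z, heat_ker j (- z) = e * heat_ker j z) ->
  gauss_avg j phi (a - x) s = - e * gauss_avg j phi x s.
Proof.
move=> phiE kE; rewrite /gauss_avg.
have o : (-1 : R) != 0 by rewrite oppr_eq0 oner_eq0.
rewrite (Rintegral_affine 0 o measurableT (measurable_gauss_avg j _ _) (integrable_gauss_avg j _ _)).
rewrite preimage_setT normrN normr1 mul1r -RintegralZl//; last exact: integrable_gauss_avg.
apply: eq_Rintegral => z _; rewrite addr0 mulN1r kE.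
have -> : a - x - s * - z = a - (x - s * z) by ring.
by rewrite phiE; ring.
Qed.

Lemma heat_op0_odd (a x t : R) : (forall y, phi (a - y) = - phi y) ->
  heat_op 0 phi (a - x) t = - heat_op 0 phi x t.
Proof.
move=> /(gauss_avg_odd (j := 0) (e := 1) x (Num.sqrt t)) h.
rewrite /heat_op h ?mulN1r ?mulrN//.
by move=> z; rewrite /heat_ker sqrrN !mul1r.
Qed.

Lemma heat_op1_odd (a x t : R) : (forall y, phi (a - y) = - phi y) ->
  heat_op 1 phi (a - x) t = heat_op 1 phi x t.
Proof.
move=> /(gauss_avg_odd (j := 1) (e := -1) x (Num.sqrt t)) h.
rewrite /heat_op h ?opprK ?mul1r//.
by move=> z; rewrite /heat_ker sqrrN; ring.
Qed.

End fixed_datum.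

(** For the datum 1, the average of order 1 does not depend on x, and its x-derivative is this
    integral. *)
Lemma Rintegral_heat_ker2 : \int[mu]_(z in [set: RR]) heat_ker 2 z = 0.
Proof.
have b1 : bounded_cont 1 (fun _ : R => 1).
  by split=> [x|x]; [exact: cvg_cst|rewrite normr1].
have h1 := is_derive_gauss_avg b1 0 (isT : (1 < 2)%N) (oner_neq0 R).
have h2 := is_derive_cst (gauss_avg 1 (fun=> 1) 0 1) (0 : R) 1.
have E : (fun y => gauss_avg 1 (fun _ : R => 1) y 1) = cst (gauss_avg 1 (fun=> 1) 0 1).
  by apply/funext.
rewrite E in h1.
have [_ e1] := h1; have [_ e2] := h2; rewrite e2 invr1 mul1r in e1; rewrite e1.
by apply: eq_Rintegral => z _; rewrite mul1r.
Qed.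

(** Since [heat_ker 2] has mean zero, phi x may be subtracted from the datum; the difference phi (x
    - s z) - phi x is at most K sqrt (|s| |z|). *)
Lemma gauss_avg2_holder (C K : R) (phi : R -> R) (x s : R) : bounded_cont C phi ->
  (forall y, `|phi y - phi x| <= K * Num.sqrt `|y - x|) ->
  `|gauss_avg 2 phi x s| <= K * Num.sqrt `|s| * heat_const.
Proof.
move=> bphi hK.
have K0 : 0 <= K.
  by have := hK (x + 1); rewrite addrAC subrr add0r normr1 sqrtr1 mulr1; apply: le_trans.
have bc : bounded_cont `|phi x| (fun _ : R => phi x) by split=> // y; exact: cvg_cst.
have E : gauss_avg 2 phi x s = \int[mu]_(z in [set: RR]) ((phi (x - s * z) - phi x) * heat_ker 2 z).
  under eq_Rintegral do rewrite mulrBl.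
  rewrite RintegralB//; [|exact: (integrable_gauss_avg bphi)|exact: (integrable_gauss_avg bc 2 x s)].
  rewrite RintegralZl//; first by rewrite Rintegral_heat_ker2 mulr0 subr0.
  apply: (dominated_integrable measurableT (integrable_gmaj R) (measurable_heat_ker 2)).
  by move=> z _; exact: heat_ker_gmaj.
rewrite E mulrA; apply: (dominated_Rintegral_le measurableT (integrable_gmaj R)).
  apply: continuous_measurable_fun => z; apply: cvgM; last exact: continuous_heat_ker.
  by apply: cvgB; [exact: (continuous_affine_comp bphi)|exact: cvg_cst].
move=> z _; rewrite normrM.
apply: (@le_trans _ _ (K * Num.sqrt `|s| * (Num.sqrt `|z| * `|heat_ker 2 z|))).
  rewrite mulrA ler_wpM2r//; apply: le_trans (hK _) _.
  by rewrite addrAC subrr add0r normrN normrM sqrtrM// mulrA.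
by rewrite -[leRHS]mulrA ler_wpM2l ?heat_ker_sqrt_gmaj// mulr_ge0// sqrtr_ge0.
Qed.

Lemma cvg_gauss_avg (j : nat) (T : pseudoMetricType R) (A : set T) (p : T) (C : R)
    (psi : T -> R -> R) (X S : T -> R) (phi : R -> R) (x s : R) :
  (\forall q \near nbhs p, A q -> bounded_cont C (psi q)) ->
  (forall z, psi q (X q - S q * z) @[q --> within A (nbhs p)] --> phi (x - s * z)) ->
  gauss_avg j (psi q) (X q) (S q) @[q --> within A (nbhs p)] --> gauss_avg j phi x s.
Proof.
move=> bpsi cpsi.
apply: (dominated_cvg_param measurableT (integrable_gmaj R) (C := C * @ker_const R)).
  near=> q => Aq; have bq : bounded_cont C (psi q) by move: Aq; near: q.
  by split; [exact: (measurable_gauss_avg bq)|move=> z _; exact: (gauss_avg_dom bq)].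
by move=> z _; apply: cvgM; [exact: cpsi|exact: cvg_cst].
Unshelve. all: by end_near.
Qed.

(** Hölder continuity lowers the singularity from t^(-1) to the integrable t^(-3/4). *)
Lemma heat_op2_holder (C K : R) (phi : R -> R) (x t : R) : bounded_cont C phi -> 0 < t ->
  (forall y, `|phi y - phi x| <= K * Num.sqrt `|y - x|) ->
  `|heat_op 2 phi x t| <= K * heat_const / Num.sqrt (Num.sqrt t) ^+ 3.
Proof.
move=> bphi t0 hK; rewrite /heat_op normrM.
have s0 : 0 < Num.sqrt t by rewrite sqrtr_gt0.
have q0 : 0 < Num.sqrt (Num.sqrt t) by rewrite sqrtr_gt0.
rewrite gtr0_norm ?invr_gt0 ?exprn_gt0//.
have h := gauss_avg2_holder (Num.sqrt t) bphi hK.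
rewrite (gtr0_norm s0) in h.
have E : Num.sqrt t = Num.sqrt (Num.sqrt t) ^+ 2 by rewrite sqr_sqrtr// ltW.
have qn0 : Num.sqrt (Num.sqrt t) != 0 by rewrite gt_eqF.
have -> : K * heat_const / Num.sqrt (Num.sqrt t) ^+ 3 =
   (Num.sqrt t ^+ 2)^-1 * (K * Num.sqrt (Num.sqrt t) * heat_const).
  by move: E qn0; set q := Num.sqrt (Num.sqrt t) => E qn0; rewrite E; field.
by rewrite ler_wpM2l// invr_ge0 exprn_ge0// ltW.
Qed.

End heat_operator.

Lemma cvg_expn (R : realType) (T : Type) (F : set_system T) {FF : Filter F}
  (f : T -> R) (l : R) n : f x @[x --> F] --> l -> f x ^+ n @[x --> F] --> l ^+ n.
Proof.
by move=> fl; exact: (@cvg_comp _ _ _ f (fun y => y ^+ n) _ _ _ fl (@exprn_continuous R n l)).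
Qed.

(** * Fourth roots and the integrability of the Beta majorant *)

Section fourth_root.
Context (R : realType).
Implicit Types t r : R.

(** All powers of time in the Duhamel estimates are multiples of 1/4; written as integer powers of
    [rt4] they can be handled by [ring] and [field]. *)
Definition rt4 t : R := Num.sqrt (Num.sqrt t).

Lemma rt4_ge0 t : 0 <= rt4 t. Proof. exact: sqrtr_ge0. Qed.

Lemma rt4_gt0 t : 0 < t -> 0 < rt4 t. Proof. by move=> t0; rewrite !sqrtr_gt0. Qed.

Lemma rt4_neq0 t : 0 < t -> rt4 t != 0. Proof. by move=> t0; rewrite gt_eqF// rt4_gt0. Qed.

Lemma rt4_sqr t : rt4 t ^+ 2 = Num.sqrt t.
Proof. by rewrite sqr_sqrtr// sqrtr_ge0. Qed.

Lemma rt4_exp4 t : 0 <= t -> rt4 t ^+ 4 = t.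
Proof. by move=> t0; rewrite (exprM _ 2 2) rt4_sqr sqr_sqrtr. Qed.

Lemma rt4M t r : 0 <= t -> rt4 (t * r) = rt4 t * rt4 r.
Proof. by move=> t0; rewrite /rt4 sqrtrM// sqrtrM// sqrtr_ge0. Qed.

Lemma rt4_le t r : t <= r -> rt4 t <= rt4 r.
Proof. by move=> tr; do 2 apply: ler_wsqrtr. Qed.

Lemma rt41 : rt4 1 = 1. Proof. by rewrite /rt4 !sqrtr1. Qed.

Lemma rt40 : rt4 0 = 0. Proof. by rewrite /rt4 !sqrtr0. Qed.

Lemma continuous_rt4 : continuous rt4.
Proof.
move=> t; apply: (@continuous_comp _ _ _ Num.sqrt Num.sqrt); exact: sqrt_continuous.
Qed.

Lemma is_derive_rt4 t : 0 < t -> is_derive t 1 rt4 (4^-1 / rt4 t ^+ 3).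
Proof.
move=> t0; have s0 : 0 < Num.sqrt t by rewrite sqrtr_gt0.
apply: (is_derive_congr (is_derive_chain (is_derive1_sqrt s0) (is_derive1_sqrt t0))) => //.
have q0 := rt4_neq0 t0; rewrite -(rt4_sqr t) -/(rt4 _).
have -> : Num.sqrt (rt4 t ^+ 2) = rt4 t by rewrite sqrtr_sqr ger0_norm// rt4_ge0.
by field.
Qed.

(* Up to normalization the Beta(1/4, 1/4) density, which dominates all the Duhamel
   integrands. *)
Definition beta14 r : R := (rt4 r ^+ 3 * rt4 (1 - r) ^+ 3)^-1.

Lemma beta14_ge0 r : 0 <= beta14 r.
Proof. by rewrite invr_ge0 mulr_ge0// exprn_ge0// rt4_ge0. Qed.

Notation mu := (@lebesgue_measure R).
Let RR : measurableType _ := measurableTypeR R.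

(** Closed intervals avoiding the singularity at 0: the fundamental theorem of calculus applies on
    each, and monotone convergence gives ]0, 1]. The shift by 2 keeps the left end below 1. *)
Let I n : set RR := `[n.+2%:R^-1, 1]%classic.

Let I_cup : \bigcup_n I n = `]0, 1]%classic.
Proof.
apply/seteqP; split=> r.
  move=> [n _]; rewrite /I /= !in_itv/= => /andP[h ->]; rewrite andbT.
  by apply: lt_le_trans h; rewrite invr_gt0 ltr0n.
rewrite /= in_itv/= => /andP[r0 r1].
have [n _ /(_ n.+1) h] := near_infty_natSinv_lt (PosNum r0).
exists n => //; rewrite /I /= in_itv/= r1 andbT ltW//; exact: (h (leqnSn n)).
Qed.

Let q3 r : R := (rt4 r ^+ 3)^-1.

Let q3_ge0 r : 0 <= q3 r. Proof. by rewrite invr_ge0 exprn_ge0// rt4_ge0. Qed.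

Let cq3 r : 0 < r -> {for r, continuous q3}.
Proof.
move=> r0; apply: cvgV; first by rewrite expf_neq0// rt4_neq0.
by apply: cvg_expn; exact: continuous_rt4.
Qed.

Let mq3 : measurable_fun (`]0, 1]%classic : set RR) (q3 : RR -> R).
Proof.
apply: (@measurable_funS _ _ _ _ (`]0, +oo[%classic : set RR)) => //.
  by move=> r /=; rewrite !in_itv/= => /andP[->].
apply: open_continuous_measurable_fun; first exact: interval_open.
by move=> r; rewrite inE/= in_itv/= andbT => r0; exact: cq3.
Qed.

Let I_sub n : I n `<=` `]0, 1]%classic.
Proof. by rewrite -I_cup; exact: bigcup_sup. Qed.

Let int_I n : (\int[mu]_(r in I n) (q3 r)%:E <= 4%:E)%E.
Proof.
have a0 : (0 : R) < n.+2%:R^-1 by rewrite invr_gt0 ltr0n.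
have a1 : (n.+2%:R^-1 : R) < 1 by rewrite invf_lt1 ?ltr0n// ltr1n.
(* 4 r^(1/4) is a primitive of r^(-3/4), whence the bound 4 for every n. *)
have dF r : 0 < r -> is_derive r 1 (fun r => 4 * rt4 r) (q3 r).
  move=> r0; apply: (is_derive_congr (is_derive_mul (is_derive_cst (4:R) r 1) (is_derive_rt4 r0))) => //.
  by rewrite /cst /q3; have := rt4_neq0 r0 => ?; field.
rewrite (@continuous_FTC2 _ q3 (fun r => 4 * rt4 r) _ _ a1).
- rewrite -EFinB lee_fin rt41; have := rt4_ge0 (n.+2%:R^-1); lra.
- apply: continuous_in_subspaceT => r; rewrite inE/= in_itv/= => /andP[h _].
  by apply: cq3; apply: lt_le_trans h.
- split.
  + move=> r; rewrite in_itv/= => /andP[h _].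
    by have [] := dF _ (lt_trans a0 h).
  + apply: cvg_at_right_filter; exact: (is_derive_continuous (dF _ a0)).
  + by apply: cvg_at_left_filter; exact: (is_derive_continuous (dF _ ltr01)).
- move=> r; rewrite in_itv/= => /andP[h _].
  by rewrite derive1E; have [_ ->] := dF _ (lt_trans a0 h).
Qed.

Let iq3 : mu.-integrable (`]0, 1]%classic : set RR) (EFin \o q3).
Proof.
apply/integrableP; split; first exact/measurable_EFinP.
have -> : (\int[mu]_(x in `]0%R, 1%R]) `|(EFin \o q3) x| = \int[mu]_(x in \bigcup_n I n) (q3 x)%:E)%E.
  by rewrite I_cup; apply: eq_integral => r _; rewrite /= ger0_norm.
have nd : {homo I : n m / (n <= m)%N >-> (n <= m)%O}.
  move=> n m nm; apply/subsetPset => r; rewrite /I/= !in_itv/= => /andP[h ->]; rewrite andbT.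
  by apply: le_trans h; rewrite lef_pV2 ?posrE ?ltr0n// ler_nat.
have mI n : measurable (I n) by exact: measurable_itv.
have mf n : measurable_fun (I n) (fun r => (q3 r)%:E).
  by apply/measurable_EFinP; apply: measurable_funS (@I_sub n) mq3.
have cv := ge0_nondecreasing_set_cvg_integral (mu := mu) nd mI mf (fun n r _ => q3_ge0 r).
apply: (@le_lt_trans _ _ 4%:E); last exact: ltry.
rewrite -(cvg_lim _ cv)//; apply: lime_le; first by apply/cvg_ex; eexists; exact: cv.
by apply: nearW => n; exact: int_I.
Qed.

Let iq3' : mu.-integrable (`[0, 1[%classic : set RR) (EFin \o (fun r : RR => q3 (1 - r))).
Proof.
have o : (-1 : R) != 0 by rewrite oppr_eq0 oner_eq0.
have := (integrable_affine 1 o (measurable_itv _) mq3).2 iq3.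
have -> : ((fun z : RR => -1 * z + 1) @^-1` `]0, 1])%classic = `[0, 1[%classic.
  by apply/seteqP; split=> r /=; rewrite !in_itv/= => /andP[? ?]; apply/andP; split; lra.
apply: eq_integrable => // r _ /=; congr (q3 _)%:E; ring.
Qed.

Lemma continuous_beta14 r : 0 < r < 1 -> {for r, continuous beta14}.
Proof.
move=> /andP[r0 r1]; have r1' : 0 < 1 - r by lra.
apply: cvgV; first by rewrite mulf_neq0// expf_neq0// rt4_neq0.
apply: cvgM; apply: cvg_expn; first exact: continuous_rt4.
apply: (@continuous_comp _ _ _ (fun r => 1 - r) rt4); last exact: continuous_rt4.
by apply: cvgB; [exact: cvg_cst|exact: cvg_id].
Qed.

Lemma measurable_itv01 (f : RR -> R) :
  (forall r, 0 < r < 1 -> {for r, continuous (f : R -> R)}) ->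
  measurable_fun (`]0, 1[%classic : set RR) f.
Proof.
move=> cf; apply: open_continuous_measurable_fun; first exact: interval_open.
by move=> r; rewrite inE/= in_itv/=; exact: cf.
Qed.

(** One of r and 1 - r is at least 1/2, and its power -3/4 is then at most 2; so the product of the
    two powers is dominated by twice their sum. *)
Lemma integrable_beta14 : mu.-integrable (`]0, 1[%classic : set RR) (EFin \o beta14).
Proof.
have m01 : measurable (`]0, 1[%classic : set RR) by exact: measurable_itv.
have i1 : mu.-integrable (`]0, 1[%classic : set RR) (EFin \o q3).
  apply: (integrableS _ _ _ iq3) => //.
  by move=> r /=; rewrite !in_itv/= => /andP[h1 h2]; rewrite h1 ltW.
have i2 : mu.-integrable (`]0, 1[%classic : set RR) (EFin \o (fun r : RR => q3 (1 - r))).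
  apply: (integrableS _ _ _ iq3') => //.
  by move=> r; rewrite /= !in_itv/= => /andP[h1 h2]; rewrite h2 ltW.
have i12 := integrableD m01 i1 i2.
apply: (dominated_integrable m01 (w := fun r => q3 r + q3 (1 - r)) _ (C := 2)) => //.
  by apply: measurable_itv01 => r; exact: continuous_beta14.
move=> r; rewrite /= in_itv/= => /andP[r0 r1].
rewrite ger0_norm ?beta14_ge0// /beta14 invfM -/(q3 r) -/(q3 (1 - r)).
have hf s : 2^-1 <= s -> q3 s <= 2.
  move=> s2; have s0 : 0 < s by lra.
  have q0 := rt4_gt0 s0.
  rewrite /q3 -[leRHS]invrK lef_pV2 ?posrE ?exprn_gt0//.
  have [q1|q1] := leP (rt4 s) 1; last by rewrite (@le_trans _ _ 1)//; [lra|rewrite exprn_ege1// ltW].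
  rewrite (le_trans s2)// -[leLHS](rt4_exp4 (ltW s0)) exprS ler_piMl//.
  by rewrite exprn_ge0// ltW.
have p := q3_ge0 r; have p' := q3_ge0 (1 - r).
have [r2|r2] := leP (2^-1) r.
  have := hf _ r2; nra.
have := hf (1 - r) ltac:(lra); nra.
Qed.

Definition beta_const : R := \int[mu]_(r in `]0, 1[%classic : set RR) beta14 r.

Lemma beta_const_ge0 : 0 <= beta_const.
Proof. by apply: Rintegral_ge0 => r _; exact: beta14_ge0. Qed.

End fourth_root.

(** * Duhamel's formula *)

Section duhamel.
Context (R : realType).
Notation mu := (@lebesgue_measure R).
Let RR : measurableType _ := measurableTypeR R.
Let D01 : set RR := `]0, 1[%classic.
Implicit Types (N : R -> R -> R) (x t h s r : R).

Let mD01 : measurable D01. Proof. exact: measurable_itv. Qed.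

(** The rate s^(-1/2) is that of u_x for a continuous datum, and u_x enters the right-hand side. *)
Definition source N :=
  (forall x s, 0 < s -> {for (x, s), continuous (fun z : R * R => N z.1 z.2)}) /\
  (forall T, 0 < T -> exists2 C, 0 <= C &
     forall x s, 0 < s <= T -> `|N x s| <= C / Num.sqrt s).

(** With s = t r and heat time t (1 - r), the right-hand side becomes a multiple of [beta14 r]. *)
Definition heat_bounded j N := forall T, 0 < T -> exists2 C, 0 <= C &
  forall x s t, 0 < s <= T -> 0 < t <= T ->
    `|heat_op j (N ^~ s) x t| <= C / (rt4 s ^+ 3 * rt4 t ^+ 3).

Lemma cvg_joint N (T : Type) (F : set_system T) {FF : Filter F} (X S : T -> R) x s :
  {for (x, s), continuous (fun z : R * R => N z.1 z.2)} ->
  X q @[q --> F] --> x -> S q @[q --> F] --> s ->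
  N (X q) (S q) @[q --> F] --> N x s.
Proof.
move=> cN cX cS.
exact: (@cvg_comp _ _ _ (fun q => (X q, S q)) (fun z => N z.1 z.2) _ _ _ (cvg_pair cX cS) cN).
Qed.

Lemma source_slice N T : source N -> 0 < T -> exists C, forall s, T <= s <= T * 2 ->
  bounded_cont C (N ^~ s).
Proof.
move=> [cN bN] T0; have T2 : 0 < T * 2 by lra.
have [C C0 hC] := bN _ T2; exists (C / Num.sqrt T) => s /andP[s1 s2]; have s0 : 0 < s by lra.
split=> x.
  by apply: (cvg_joint (cN x s s0)); [exact: cvg_id|exact: cvg_cst].
apply: (le_trans (hC x s _)); first by rewrite s0.
by rewrite ler_wpM2l// lef_pV2 ?posrE ?sqrtr_gt0// ler_wsqrtr.
Qed.

Lemma source_slice1 N s : source N -> 0 < s -> exists C, bounded_cont C (N ^~ s).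
Proof.
move=> sN s0; have [C hC] := source_slice sN s0.
by exists C; apply: hC; rewrite lexx/=; lra.
Qed.

(** For j < 2 the natural bound s^(-1/2) t^(-j/2) is weaker in both variables than the exponents
    -3/4; on times up to T the surplus positive powers are controlled by powers of 1 + rt4 T. *)
Lemma heat_bounded_source j N : (j < 2)%N -> source N -> heat_bounded j N.
Proof.
move=> j2 [cN bN] T T0; have [C C0 hC] := bN T T0.
have H0 := heat_const_ge0 R.
have qT := rt4_ge0 T.
exists (C * heat_const R * ((1 + rt4 T) * (1 + rt4 T) ^+ 3)).
  have y0 : 0 <= 1 + rt4 T by lra.
  apply: mulr_ge0; first exact: mulr_ge0.
  by apply: mulr_ge0 => //; exact: exprn_ge0.
move=> x s t /andP[s0 sT] /andP[t0 tT].
have bc : bounded_cont (C / Num.sqrt s) (N ^~ s).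
  split=> y; first by apply: (cvg_joint (cN y s s0)); [exact: cvg_id|exact: cvg_cst].
  by apply: hC; rewrite s0.
apply: (le_trans (heat_op_le bc j x t)).
have qs := rt4_gt0 s0; have qt := rt4_gt0 t0.
have qsT := rt4_le sT; have qtT := rt4_le tT.
have i0 : 0 <= (rt4 s ^+ 3 * rt4 t ^+ 3)^-1 by rewrite invr_ge0 mulr_ge0// exprn_ge0// ltW.
have -> : C / Num.sqrt s * heat_const R / Num.sqrt t ^+ j =
   C * heat_const R * (rt4 s * (rt4 t ^+ 3 / (rt4 t ^+ 2) ^+ j)) * (rt4 s ^+ 3 * rt4 t ^+ 3)^-1.
  have sE := rt4_sqr s; have tE := rt4_sqr t; rewrite -sE -tE.
  move: (lt0r_neq0 qs) (lt0r_neq0 qt); clear -j2.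
  by case: j j2 => [|[|//]] _ ? ?; rewrite ?expr0 ?expr1; field; apply/andP.
apply: ler_wpM2r => //; apply: ler_wpM2l; first by rewrite mulr_ge0.
apply: ler_pM.
- exact: ltW.
- by rewrite divr_ge0// !exprn_ge0// ltW.
- lra.
- case: j j2 => [|[|//]] _.
    rewrite expr0 divr1; apply: lerXn2r; rewrite ?nnegrE; lra.
  rewrite expr1 (_ : _ / _ = rt4 t); last by field; exact: lt0r_neq0.
  apply: (@le_trans _ _ (1 + rt4 T)); first by lra.
  have y1 : 1 <= 1 + rt4 T by lra.
  by rewrite -[leLHS]expr1; exact: ler_weXn2l.
Qed.

Lemma near_within_dist (T : pseudoMetricType R) (A : set T) (p : T) (X : T -> R) x e :
  0 < e -> X q @[q --> within A (nbhs p)] --> x ->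
  \forall q \near nbhs p, A q -> `|x - X q| < e.
Proof. by move=> e0 /cvgrPdist_lt/(_ e e0). Qed.

(** For j = 0 the heat time t = 0 is allowed, the prefactor being 1: this gives the limits at
    vanishing heat time. *)
Lemma cvg_heat_op j N (T : pseudoMetricType R) (A : set T) (p : T)
    (X S U : T -> R) x s t : source N -> 0 < s -> (0 < t) || (j == 0)%N ->
  X q @[q --> within A (nbhs p)] --> x -> S q @[q --> within A (nbhs p)] --> s ->
  U q @[q --> within A (nbhs p)] --> t ->
  heat_op j (N ^~ (S q)) (X q) (U q) @[q --> within A (nbhs p)] --> heat_op j (N ^~ s) x t.
Proof.
move=> sN s0 tj cX cS cU.
have cV : Num.sqrt (U q) @[q --> within A (nbhs p)] --> Num.sqrt t.
  exact: (@cvg_comp _ _ _ U Num.sqrt _ _ _ cU (@sqrt_continuous R t)).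
apply: cvgM.
  case/orP: tj => [t0|/eqP ->]; last by rewrite expr0; under eq_fun do rewrite expr0; exact: cvg_cst.
  apply: cvgV; first by rewrite expf_neq0// gt_eqF// sqrtr_gt0.
  exact: cvg_expn.
(* [source_slice] at 3 s / 4 covers [3 s / 4, 3 s / 2], which contains all times within s / 4 of
   s. *)
have s20 : 0 < s / 2 * (3 / 2) by lra.
have [C hC] := source_slice sN s20.
apply: (cvg_gauss_avg (C := C)).
  have s40 : 0 < s / 4 by lra.
  have := near_within_dist s40 cS; apply: filterS => q hq Aq; apply: hC.
  by move: (hq Aq); rewrite ltr_distlC => /andP[? ?]; apply/andP; split; lra.
move=> z; apply: (cvg_joint (sN.1 _ _ s0)); last exact: cS.
by apply: cvgB => //; apply: cvgM => //; exact: cvg_cst.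
Qed.

(* [duh j N x t h] is the j-th space derivative of
   \int_0^t e^{(t + |h| - s) d_x^2} N(s) ds; the substitution s = t r makes the
   domain of integration and the majorant independent of t. *)
Definition duh (j : nat) N x t h : R :=
  t * \int[mu]_(r in D01) heat_op j (N ^~ (t * r)) x (t * (1 - r) + `|h|).

Lemma continuous_duh_integrand j N x t h r : source N -> 0 < t -> 0 < r < 1 ->
  {for r, continuous (fun r => heat_op j (N ^~ (t * r)) x (t * (1 - r) + `|h|))}.
Proof.
move=> sN t0 /andP[r0 r1].
have tr0 : 0 < t * r by rewrite mulr_gt0.
have tr1 : (0 < t * (1 - r) + `|h|) || (j == 0)%N.
  by rewrite ltr_wpDr// mulr_gt0// subr_gt0.
have := @cvg_heat_op j N R setT r (fun=> x) (fun r => t * r) (fun r => t * (1 - r) + `|h|) _ _ _ sN tr0 tr1.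
rewrite withinET; apply; first exact: cvg_cst.
  by apply: cvgM; [exact: cvg_cst|exact: cvg_id].
apply: cvgD; last exact: cvg_cst.
by apply: cvgM; [exact: cvg_cst|apply: cvgB; [exact: cvg_cst|exact: cvg_id]].
Qed.

Lemma measurable_duh_integrand j N x t h : source N -> 0 < t ->
  measurable_fun D01 (fun r => heat_op j (N ^~ (t * r)) x (t * (1 - r) + `|h|)).
Proof. by move=> sN t0; apply: measurable_itv01 => r; exact: continuous_duh_integrand. Qed.

(** The lag |h| only moves the heat time away from the singularity, so the bound without lag holds
    for every h. *)
Lemma duh_integrand_dom j N (T C : R) x t h r : 0 <= C ->
  (forall x s t, 0 < s <= T -> 0 < t <= T ->
    `|heat_op j (N ^~ s) x t| <= C / (rt4 s ^+ 3 * rt4 t ^+ 3)) ->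
  0 < t -> t + `|h| <= T -> 0 < r < 1 ->
  `|heat_op j (N ^~ (t * r)) x (t * (1 - r) + `|h|)| <= C / rt4 t ^+ 6 * beta14 r.
Proof.
move=> C0 hC t0 tT /andP[r0 r1]; have r1' : 0 < 1 - r by lra.
have h0 := normr_ge0 h.
have tr0 : 0 < t * r by rewrite mulr_gt0.
have tr1 : 0 < t * (1 - r) by rewrite mulr_gt0.
apply: (le_trans (hC _ _ _ _ _)).
- by rewrite tr0/=; nra.
- by rewrite ltr_wpDr//=; nra.
rewrite -mulrA ler_wpM2l// /beta14 -invfM lef_pV2 ?posrE.
- have -> : rt4 t ^+ 6 * (rt4 r ^+ 3 * rt4 (1 - r) ^+ 3) = rt4 (t * r) ^+ 3 * rt4 (t * (1 - r)) ^+ 3.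
    by rewrite !rt4M ?(ltW t0)//; ring.
  rewrite ler_wpM2l ?exprn_ge0 ?rt4_ge0//.
  by apply: lerXn2r; rewrite ?nnegrE ?rt4_ge0//; apply: rt4_le; lra.
- by rewrite mulr_gt0 ?exprn_gt0 ?rt4_gt0//; lra.
- by rewrite !mulr_gt0 ?exprn_gt0 ?rt4_gt0.
Qed.

Lemma integrable_duh j N x t h : source N -> heat_bounded j N -> 0 < t ->
  mu.-integrable D01 (EFin \o (fun r => heat_op j (N ^~ (t * r)) x (t * (1 - r) + `|h|))).
Proof.
move=> sN bN t0.
have T0 : 0 < t + `|h| by rewrite ltr_wpDr.
have [C C0 hC] := bN _ T0.
apply: (dominated_integrable mD01 (integrable_beta14 R) (measurable_duh_integrand j x h sN t0)).
move=> r; rewrite /D01/= in_itv/=.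
exact: (duh_integrand_dom x C0 hC t0 (lexx _)).
Qed.

Lemma cvg_duh j N (T : pseudoMetricType R) (A : set T) (p : T) (X U H : T -> R) x t h :
  source N -> heat_bounded j N -> 0 < t ->
  X q @[q --> within A (nbhs p)] --> x -> U q @[q --> within A (nbhs p)] --> t ->
  H q @[q --> within A (nbhs p)] --> h ->
  duh j N (X q) (U q) (H q) @[q --> within A (nbhs p)] --> duh j N x t h.
Proof.
move=> sN bN t0 cX cU cH; apply: cvgM => //.
have cH' : `|H q| @[q --> within A (nbhs p)] --> `|h| by exact: cvg_norm.
have T0 : 0 < t * 2 + (`|h| + 1) by rewrite ltr_wpDr ?mulr_gt0// addr_ge0.
have [C C0 hC] := bN _ T0.
have q0 : 0 < rt4 (t / 2) by rewrite rt4_gt0 ?divr_gt0.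
apply: (dominated_cvg_param mD01 (integrable_beta14 R) (C := C / rt4 (t / 2) ^+ 6)).
  have t20 : 0 < t / 2 by lra.
  have := near_within_dist t20 cU; have := near_within_dist ltr01 cH'; apply: filterS2 => q hH hU Aq.
  move: (hH Aq) (hU Aq); rewrite !ltr_distlC => /andP[h1 h2] /andP[u1 u2].
  have Uq : 0 < U q by lra.
  split; first exact: measurable_duh_integrand.
  move=> r; rewrite /D01/= in_itv/= => r01.
  apply: (le_trans (duh_integrand_dom (X q) C0 hC Uq _ r01)); first lra.
  rewrite ler_wpM2r ?beta14_ge0// ler_wpM2l// lef_pV2 ?posrE ?exprn_gt0// ?rt4_gt0//.
  by apply: lerXn2r; rewrite ?nnegrE ?rt4_ge0//; apply: rt4_le; lra.
move=> r; rewrite /D01/= in_itv/= => /andP[r0 r1].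
apply: (cvg_heat_op sN) => //.
- by rewrite mulr_gt0.
- by rewrite ltr_wpDr// mulr_gt0// subr_gt0.
- by apply: cvgM => //; exact: cvg_cst.
- by apply: cvgD => //; apply: cvgM => //; exact: cvg_cst.
Qed.

Lemma duh_le j N x t h (C : R) : source N -> 0 < t ->
  (forall r, 0 < r < 1 ->
    `|heat_op j (N ^~ (t * r)) x (t * (1 - r) + `|h|)| <= C * beta14 r) ->
  `|duh j N x t h| <= t * (C * beta_const R).
Proof.
move=> sN t0 hC; rewrite /duh normrM gtr0_norm// ler_wpM2l ?(ltW t0)// /beta_const.
apply: (dominated_Rintegral_le mD01 (integrable_beta14 R) (measurable_duh_integrand j x h sN t0)).
by move=> r; rewrite /D01/= in_itv/=; exact: hC.
Qed.

(** For j = 1 the hypothesis [heat_bounded 2 N] is the one that will come from Hölder continuity of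
    N. *)
Lemma is_derive_duh j N x t h : (j < 2)%N -> source N ->
  heat_bounded j N -> heat_bounded j.+1 N -> 0 < t ->
  is_derive x 1 (fun y => duh j N y t h) (duh j.+1 N x t h).
Proof.
move=> j2 sN bN bN' t0.
have T0 : 0 < t + `|h| by rewrite ltr_wpDr.
have [C C0 hC] := bN' _ T0.
have dI : is_derive x 1 (fun y => \int[mu]_(r in D01) heat_op j (N ^~ (t * r)) y (t * (1 - r) + `|h|))
    (\int[mu]_(r in D01) heat_op j.+1 (N ^~ (t * r)) x (t * (1 - r) + `|h|)).
  apply: (is_derive_Rintegral mD01 (integrable_beta14 R) (@beta14_ge0 R)
    (f := fun y r => heat_op j (N ^~ (t * r)) y (t * (1 - r) + `|h|))
    (f' := fun y r => heat_op j.+1 (N ^~ (t * r)) y (t * (1 - r) + `|h|))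
    (e := 1) (C := C / rt4 t ^+ 6)) => //.
  - by move=> y _; exact: integrable_duh.
  - move=> y r _; rewrite /D01/= in_itv/= => /andP[r0 r1].
    have tr0 : 0 < t * r by rewrite mulr_gt0.
    have [K bK] := source_slice1 sN tr0.
    by apply: (is_derive_heat_op bK _ j2); rewrite ltr_wpDr// mulr_gt0// subr_gt0.
  - move=> y r _; rewrite /D01/= in_itv/=.
    exact: (duh_integrand_dom y C0 hC t0 (lexx _)).
apply: (is_derive_congr (is_derive_mul (is_derive_cst t x 1) dI)) => //.
by rewrite /cst mul0r add0r.
Qed.

Lemma is_derive_norm_pos h : 0 < h -> is_derive h 1 (fun y : R => `|y|) 1.
Proof.
move=> h0; apply: (near_eq_is_derive _ (is_derive_id h 1)).
by near=> y; rewrite gtr0_norm//; near: y; exact: lt_nbhsr.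
Unshelve. all: by end_near.
Qed.

Lemma is_derive_duh_lag N x t h : source N -> heat_bounded 2 N -> 0 < t -> 0 < h ->
  is_derive h 1 (fun k => duh 0 N x t k) (duh 2 N x t h).
Proof.
move=> sN bN' t0 h0.
have bN : heat_bounded 0 N by exact: heat_bounded_source.
(* Differentiation takes place on |k - h| < h, where k is positive and below 2 h; so [|k|] is k and
   heat times stay below t + 2 h. *)
have T0 : 0 < t + h * 2 by lra.
have [C C0 hC] := bN' _ T0.
have dI : is_derive h 1 (fun k => \int[mu]_(r in D01) heat_op 0 (N ^~ (t * r)) x (t * (1 - r) + `|k|))
    (\int[mu]_(r in D01) heat_op 2 (N ^~ (t * r)) x (t * (1 - r) + `|h|)).
  apply: (is_derive_Rintegral mD01 (integrable_beta14 R) (@beta14_ge0 R)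
    (f := fun k r => heat_op 0 (N ^~ (t * r)) x (t * (1 - r) + `|k|))
    (f' := fun k r => heat_op 2 (N ^~ (t * r)) x (t * (1 - r) + `|k|))
    (e := h) (C := C / rt4 t ^+ 6)) => //.
  - by move=> k _; exact: integrable_duh.
  - move=> k r; rewrite ltr_distlC /D01/= in_itv/= => /andP[k1 k2] /andP[r0 r1].
    have k0 : 0 < k by lra.
    have tr0 : 0 < t * r by rewrite mulr_gt0.
    have [K bK] := source_slice1 sN tr0.
    have p0 : 0 < t * (1 - r) + `|k| by rewrite ltr_wpDr// mulr_gt0// subr_gt0.
    have dl := is_derive_add (is_derive_cst (t * (1 - r)) k 1) (is_derive_norm_pos k0).
    have := is_derive_chain (g := fun k => t * (1 - r) + `|k|) (is_derive_heat_op_time bK x p0) dl.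
    by move=> dc; apply: (is_derive_congr dc) => //; rewrite add0r mulr1.
  - move=> k r; rewrite ltr_distlC /D01/= in_itv/= => /andP[k1 k2].
    apply: (duh_integrand_dom x C0 hC t0).
    by rewrite gtr0_norm; lra.
apply: (is_derive_congr (is_derive_mul (is_derive_cst t h 1) dI)) => //.
by rewrite /cst mul0r add0r.
Qed.

Lemma duhB j N N' x t : source N -> source N' -> source (fun y s => N y s - N' y s) ->
  heat_bounded j N -> heat_bounded j N' -> 0 < t ->
  duh j (fun y s => N y s - N' y s) x t 0 = duh j N x t 0 - duh j N' x t 0.
Proof.
move=> sN sN' sB bN bN' t0; rewrite /duh -mulrBr -RintegralB//; last 2 first.
- exact: integrable_duh.
- exact: integrable_duh.
congr (_ * _); apply: eq_Rintegral => r; rewrite inE /D01/= in_itv/= => /andP[r0 r1].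
have tr0 : 0 < t * r by rewrite mulr_gt0.
have [K bK] := source_slice1 sN tr0.
have [K' bK'] := source_slice1 sN' tr0.
rewrite /heat_op -mulrBr /gauss_avg -RintegralB//; last 2 first.
- exact: (integrable_gauss_avg bK).
- exact: (integrable_gauss_avg bK').
by congr (_ * _); apply: eq_Rintegral => z _; rewrite mulrBl.
Qed.

Lemma duh0_odd N (a : R) x t : source N -> 0 < t ->
  (forall y s, 0 < s -> N (a - y) s = - N y s) ->
  duh 0 N (a - x) t 0 = - duh 0 N x t 0.
Proof.
move=> sN t0 oN; have bN : heat_bounded 0 N by exact: heat_bounded_source.
rewrite /duh -mulrN; congr (_ * _).
rewrite -mulN1r -RintegralZl//; last exact: integrable_duh.
apply: eq_Rintegral => r; rewrite inE /D01/= in_itv/= => /andP[r0 r1].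
have tr0 : 0 < t * r by rewrite mulr_gt0.
have [K bK] := source_slice1 sN tr0.
by rewrite mulN1r (heat_op0_odd bK)// => y; exact: oN.
Qed.

Lemma duh1_odd N (a : R) x t : source N -> 0 < t ->
  (forall y s, 0 < s -> N (a - y) s = - N y s) ->
  duh 1 N (a - x) t 0 = duh 1 N x t 0.
Proof.
move=> sN t0 oN; rewrite /duh; apply: (congr1 (fun z => t * z)).
apply: eq_Rintegral => r; rewrite inE /D01/= in_itv/= => /andP[r0 r1].
have tr0 : 0 < t * r by rewrite mulr_gt0.
have [K bK] := source_slice1 sN tr0.
by rewrite (heat_op1_odd bK)// => y; exact: oN.
Qed.

End duhamel.

(** * The time derivative of Duhamel's integral, and Hölder bounds *)

Section duhamel_time.
Context (R : realType).
Notation mu := (@lebesgue_measure R).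
Let RR : measurableType _ := measurableTypeR R.
Let D01 : set RR := `]0, 1[%classic.
Implicit Types (N : R -> R -> R) (x t h s r : R).

Let mD01 : measurable D01. Proof. exact: measurable_itv. Qed.

Let preimage_scale (a b : R) : a < b ->
  ((fun z : RR => (b - a) * z + a) @^-1` `]a, b[)%classic = D01.
Proof.
move=> ab; have ba0 : 0 < b - a by lra.
apply/seteqP; split=> r; rewrite /D01 /= !in_itv/= => /andP[h1 h2]; apply/andP; split.
- have : 0 < (b - a) * r by lra.
  by rewrite pmulr_rgt0.
- have : (b - a) * r < (b - a) * 1 by lra.
  by rewrite ltr_pM2l.
- by have := mulr_gt0 ba0 h1; lra.
- by have : (b - a) * r < (b - a) * 1 by [rewrite ltr_pM2l]; lra.
Qed.

Lemma Rintegral_itvoo_scale (a b : R) (G : RR -> R) : a < b ->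
  measurable_fun (`]a, b[%classic : set RR) G ->
  mu.-integrable D01 (EFin \o (fun r => G ((b - a) * r + a))) ->
  mu.-integrable (`]a, b[%classic : set RR) (EFin \o G) /\
  \int[mu]_(s in (`]a, b[%classic : set RR)) G s =
  (b - a) * \int[mu]_(r in D01) G ((b - a) * r + a).
Proof.
move=> ab mG iG; have ba0 : 0 < b - a by lra.
have o : b - a != 0 by rewrite gt_eqF.
have E := preimage_scale ab.
have mI : measurable (`]a, b[%classic : set RR) by exact: measurable_itv.
have ia := integrable_affine a o mI mG; rewrite E in ia.
have iI := ia.1 iG; split=> //.
by rewrite (Rintegral_affine a o mI mG iI) E gtr0_norm.
Qed.

(** The mean over the sources at times in (t, t + |h|) of their heat flow at time t + |h|. *)
Definition duh_new N x t h : R :=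
  \int[mu]_(r in D01) heat_op 0 (N ^~ (t + `|h| * r)) x (`|h| * (1 - r)).

Let continuous_lag_integrand N x c s : source N -> 0 < s ->
  {for s, continuous (fun s => heat_op 0 (N ^~ s) x (c - s))}.
Proof.
move=> sN s0.
have tr1 : (0 < c - s) || (0 == 0)%N by rewrite eqxx orbT.
have := @cvg_heat_op R 0 N R setT s (fun=> x) id (fun s => c - s) _ _ _ sN s0 tr1.
rewrite withinET; apply; [exact: cvg_cst|exact: cvg_id|].
by apply: cvgB; [exact: cvg_cst|exact: cvg_id].
Qed.

(** In the unscaled variable s, the three terms integrate the same function [G] over (0, t + h), (0,
    t) and (t, t + h). *)
Lemma duh_split N x t h : source N -> 0 < t -> 0 < h ->
  duh 0 N x (t + h) 0 = duh 0 N x t h + h * duh_new N x t h.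
Proof.
move=> sN t0 h0; have bN : heat_bounded 0 N by exact: heat_bounded_source.
pose G (s : RR) : R := heat_op 0 (N ^~ s) x (t + h - s).
have mG a b : 0 <= a -> measurable_fun (`]a, b[%classic : set RR) G.
  move=> a0; apply: open_continuous_measurable_fun; first exact: interval_open.
  move=> s; rewrite inE/= in_itv/= => /andP[as_ _].
  by apply: continuous_lag_integrand => //; apply: le_lt_trans as_.
have th0 : 0 < t + h by lra.
have tth : t < t + h by lra.
have hn0 : t + h - t != 0 by rewrite gt_eqF//; lra.
have E1 r : heat_op 0 (N ^~ ((t + h) * r)) x ((t + h) * (1 - r) + `|(0:R)|) = G ((t + h - 0) * r + 0).
  by rewrite normr0 /G !subr0 !addr0; congr (heat_op _ _ _ _); ring.
have E2 r : heat_op 0 (N ^~ (t * r)) x (t * (1 - r) + `|h|) = G ((t - 0) * r + 0).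
  by rewrite gtr0_norm// /G !subr0 !addr0; congr (heat_op _ _ _ _); ring.
have E3 r : heat_op 0 (N ^~ (t + `|h| * r)) x (`|h| * (1 - r)) = G ((t + h - t) * r + t).
  have e : t + h - t = h by ring.
  by rewrite gtr0_norm// /G e (addrC (h * r)); congr (heat_op _ _ _ _); ring.
have i1 := integrable_duh x 0 sN bN th0.
have [] := Rintegral_itvoo_scale th0 (mG 0 _ (lexx _)).
  by move: i1; apply: eq_integrable => // r _ /=; rewrite E1.
move=> I1 S1.
have [] := Rintegral_itvoo_scale t0 (mG 0 _ (lexx _)).
  by move: (integrable_duh x h sN bN t0); apply: eq_integrable => // r _ /=; rewrite E2.
move=> I2 S2.
have I3 : mu.-integrable (`]t, t + h[%classic : set RR) (EFin \o G).
  apply: (integrableS _ _ _ I1) => //.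
  by move=> s /=; rewrite !in_itv/= => /andP[s1 ->]; rewrite andbT; exact: lt_trans s1.
have mI3 : measurable (`]t, t + h[%classic : set RR) by exact: measurable_itv.
have [] := Rintegral_itvoo_scale tth (mG t _ (ltW t0)).
  have := (integrable_affine t hn0 mI3 (mG t _ (ltW t0))).2 I3.
  by rewrite preimage_scale.
move=> _ S3.
have sp := Rintegral_itvB (f := G) (a := BRight 0) (b := BLeft (t + h)) (x := t) I1.
rewrite !bnd_simp in sp; have {}sp := sp (ltW t0) tth.
have S2' : \int[mu]_(s in (`]0, t]%classic : set RR)) G s = \int[mu]_(s in (`]0, t[%classic : set RR)) G s.
  exact/esym/(Rintegral_itv_bndo_bndc I2).
have -> : duh 0 N x (t + h) 0 = \int[mu]_(s in (`]0, t + h[%classic : set RR)) G s.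
  by rewrite S1 subr0 /duh; apply: (congr1 (fun z => (t + h) * z)); apply: eq_Rintegral => r _; rewrite E1 subr0.
have -> : duh 0 N x t h = \int[mu]_(s in (`]0, t[%classic : set RR)) G s.
  by rewrite S2 subr0 /duh; apply: (congr1 (fun z => t * z)); apply: eq_Rintegral => r _; rewrite E2 subr0.
have -> : h * duh_new N x t h = \int[mu]_(s in (`]t, t + h[%classic : set RR)) G s.
  rewrite S3 /duh_new; congr (_ * _); first by ring.
  by apply: eq_Rintegral => r _; rewrite E3.
rewrite -S2' -sp; ring.
Qed.

(** This makes [beta14] a majorant for bounded integrands too. *)
Let beta14_ge1 r : 0 < r < 1 -> 1 <= beta14 r.
Proof.
move=> /andP[r0 r1]; have r1' : 0 < 1 - r by lra.
have q0 := rt4_gt0 r0; have q1 := rt4_gt0 r1'.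
have b0 : rt4 r <= 1 by rewrite -(rt41 R) rt4_le// ltW.
have b1 : rt4 (1 - r) <= rt4 1 by apply: rt4_le; lra.
rewrite rt41 in b1.
rewrite /beta14 -[leLHS]invr1 lef_pV2 ?posrE ?mulr_gt0 ?exprn_gt0//.
by apply: mulr_ile1; rewrite ?exprn_ge0 ?(ltW q0) ?(ltW q1)// exprn_ile1// ltW.
Qed.

(** The heat flow acts for times tending to 0 and becomes the identity. The base time U q varies as
    well, because left difference quotients start at a moving point. *)
Lemma cvg_duh_new N (T : pseudoMetricType R) (A : set T) (p : T) (U H : T -> R) x t :
  source N -> 0 < t ->
  U q @[q --> within A (nbhs p)] --> t -> H q @[q --> within A (nbhs p)] --> 0 ->
  duh_new N x (U q) (H q) @[q --> within A (nbhs p)] --> N x t.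
Proof.
move=> sN t0 cU cH.
have cH' : `|H q| @[q --> within A (nbhs p)] --> (0 : R) by rewrite -(normr0 R); exact: cvg_norm.
have E : N x t = \int[mu]_(r in D01) (fun=> N x t) r.
  have m1 : mu D01 = 1%E.
    by rewrite /D01 lebesgue_measure_itv/= lte_fin ltr01 -EFinB subr0.
  by have := Rintegral_cst mu mD01 (N x t); rewrite /= m1 mulr1 => ->.
rewrite [X in _ --> X]E.
have s20 : 0 < 3 * t / 4 by lra.
have [C hC] := source_slice sN s20.
have t40 : 0 < t / 4 by lra.
have H0 := heat_const_ge0 R.
apply: (dominated_cvg_param mD01 (integrable_beta14 R) (C := C * heat_const R)).
  have := near_within_dist t40 cU; have := near_within_dist t40 cH'; apply: filterS2 => q hH hU Aq.
  move: (hH Aq) (hU Aq); rewrite sub0r normrN normr_id ltr_distlC => h1 /andP[u1 u2].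
  have h00 := normr_ge0 (H q).
  split.
    apply: measurable_itv01 => r /andP[r0 r1].
    have s0 : 0 < U q + `|H q| * r by nra.
    have tr1 : (0 < `|H q| * (1 - r)) || (0 == 0)%N by rewrite eqxx orbT.
    have := @cvg_heat_op R 0 N R setT r (fun=> x) (fun r => U q + `|H q| * r)
      (fun r => `|H q| * (1 - r)) _ _ _ sN s0 tr1.
    rewrite withinET; apply; first exact: cvg_cst.
      by apply: cvgD; [exact: cvg_cst|apply: cvgM; [exact: cvg_cst|exact: cvg_id]].
    by apply: cvgM; [exact: cvg_cst|apply: cvgB; [exact: cvg_cst|exact: cvg_id]].
  move=> r; rewrite /D01/= in_itv/= => /andP[r0 r1].
  have hr0 : 0 <= `|H q| * r by rewrite mulr_ge0// ltW.
  have hr1 : `|H q| * r <= `|H q| by rewrite ler_piMr// ltW.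
  have bc : bounded_cont C (N ^~ (U q + `|H q| * r)) by apply: hC; apply/andP; split; lra.
  have := heat_op_le bc 0 x (`|H q| * (1 - r)); rewrite expr0 divr1 => hle.
  apply: (le_trans hle); rewrite ler_peMr ?beta14_ge1 ?r0//.
  by apply: le_trans hle.
move=> r; rewrite /D01/= in_itv/= => /andP[r0 r1].

rewrite -[X in _ --> X](heat_op00 (N ^~ t) x).
apply: (cvg_heat_op sN) => //.
- by rewrite eqxx orbT.
- exact: cvg_cst.
- rewrite -[X in _ --> X]addr0 -(mul0r r); apply: cvgD => //.
  by apply: cvgM => //; exact: cvg_cst.
- by rewrite -[X in _ --> X](mul0r (1 - r)); apply: cvgM => //; exact: cvg_cst.
Qed.

(** The mean value theorem in the lag over [0, h]: the derivative exists for positive lag, and at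
    lag 0 continuity is enough. *)
Lemma duh_increment N x t h : source N -> heat_bounded 2 N -> 0 < t -> 0 < h ->
  exists2 k, 0 < k < h & duh 0 N x (t + h) 0 - duh 0 N x t 0 =
    h * (duh 2 N x t k + duh_new N x t h).
Proof.
move=> sN bN t0 h0; have bN0 : heat_bounded 0 N by exact: heat_bounded_source.
have cts : {within `[0, h], continuous (fun k => duh 0 N x t k)}.
  apply: continuous_subspaceT => k.
  have := @cvg_duh R 0 N R setT k (fun=> x) (fun=> t) id x t k sN bN0 t0.
  by rewrite withinET; apply; [exact: cvg_cst|exact: cvg_cst|exact: cvg_id].
have [k] := MVT h0 (fun k hk => is_derive_duh_lag x sN bN t0 (proj1 (andP hk))) cts.
rewrite in_itv/= subr0 => k01 E; exists k => //.
have addr_sub (a b c d : R) : a - c = d -> a + b - c = d + b.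
  by move=> <-; rewrite addrAC.
by rewrite (duh_split x sN t0 h0) mulrDr; apply: addr_sub; rewrite E mulrC.
Qed.

Lemma is_derive_duh_time N x t : source N -> heat_bounded 2 N -> 0 < t ->
  is_derive t 1 (fun s => duh 0 N x s 0) (duh 2 N x t 0 + N x t).
Proof.
move=> sN bN t0; apply/is_derive_quot/cvgrPdist_lt => e e0.
have e20 : 0 < e / 2 by lra.
have c1 : duh 2 N x q.1 q.2 @[q --> within setT (nbhs (t, (0:R)))] --> duh 2 N x t 0.
  by apply: (cvg_duh sN) => //; rewrite ?withinET; [exact: cvg_cst|exact: cvg_fst|exact: cvg_snd].
have c2 : duh_new N x q.1 q.2 @[q --> within setT (nbhs (t, (0:R)))] --> N x t.
  by apply: (@cvg_duh_new N _ setT (t, (0:R)) fst snd x t sN t0); rewrite withinET; [exact: cvg_fst|exact: cvg_snd].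
have /nbhs_ballP[d1 /= d10 H1] := near_within_dist e20 c1.
have /nbhs_ballP[d2 /= d20 H2] := near_within_dist e20 c2.
pose d := Num.min (Num.min d1 d2) (t / 2).
have d0 : 0 < d by rewrite !lt_min d10 d20/=; lra.
(* Both one-sided quotients at t are forward increments, starting at t or at a point y < t; a bound
   uniform in the base point s covers them. *)
have key s h : 0 < s -> 0 < h -> `|t - s| < d -> h < d ->
   `|duh 2 N x t 0 + N x t - (duh 0 N x (s + h) 0 - duh 0 N x s 0) / h| < e.
  move=> s0 h0 ts hd; have [k /andP[k0 kh] ->] := duh_increment x sN bN s0 h0.
  have hn : h != 0 by rewrite gt_eqF.
  rewrite mulrAC divff// mul1r.
  have B1 : `|duh 2 N x t 0 - duh 2 N x s k| < e / 2.
    apply: (H1 (s, k)) => //; split => /=; rewrite /ball/=.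
      by apply: lt_le_trans ts _; rewrite !ge_min lexx.
    by rewrite sub0r normrN gtr0_norm// (lt_trans kh)// (lt_le_trans hd)// !ge_min lexx.
  have B2 : `|N x t - duh_new N x s h| < e / 2.
    apply: (H2 (s, h)) => //; split => /=; rewrite /ball/=.
      by apply: lt_le_trans ts _; rewrite !ge_min lexx orbT.
    by rewrite sub0r normrN gtr0_norm// (lt_le_trans hd)// !ge_min lexx orbT.
  rewrite opprD addrACA (splitr e); apply: (le_lt_trans (ler_normD _ _)).
  exact: ltrD.
apply/nbhs_ballP; exists d => //= y; rewrite /ball/= => yd yt.
have dt : d <= t / 2 by rewrite !ge_min lexx orbT.
have [ty|yt'] := ltP t y.
  have h0 : 0 < y - t by lra.
  rewrite -normrN opprB gtr0_norm// in yd.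
  have tt : `|t - t| < d by rewrite subrr normr0.
  have ty' : t + (y - t) = y by ring.
  by have := key t (y - t) t0 h0 tt yd; rewrite ty'.
have {yt yt'} yt : y < t by rewrite lt_neqAle yt.
have h0 : 0 < t - y by lra.
have yd' := yd; rewrite gtr0_norm// in yd'.
have y0 : 0 < y by lra.
have yt' : y + (t - y) = t by ring.
have fr (k l r s : R) : (k - l) / (r - s) = (l - k) / (s - r).
  by rewrite -(opprB l) -(opprB s) invrN mulrNN.
have hk := key y (t - y) y0 h0 yd yd'; rewrite yt' in hk.
by rewrite (fr (duh 0 N x y 0)).
Qed.

Lemma derive_bounded_lipschitz (f f' : R -> R) (M : R) :
  (forall x, is_derive x 1 f (f' x)) -> (forall x, `|f' x| <= M) ->
  forall x y, `|f x - f y| <= M * `|x - y|.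
Proof.
move=> df bf.
have cf : continuous f by move=> x; exact: (is_derive_continuous (df x)).
have key x y : x < y -> `|f y - f x| <= M * `|y - x|.
  move=> xy; have [c _ ->] := MVT xy (fun x _ => df x) (continuous_subspaceT cf).
  by rewrite normrM ler_wpM2r.
move=> x y; have [xy|xy|->] := ltgtP x y; last by rewrite !subrr normr0 mulr0.
- by rewrite distrC (distrC x) key.
- exact: key.
Qed.

(** A minimum is at most the geometric mean. With q = t^(1/4), it interpolates between a sup bound
    t^(-1/2) and a Lipschitz bound t^(-1). *)
Lemma min_le_sqrt (q d a : R) : 0 < q -> 0 <= a -> 0 <= d ->
  Num.min (a / q ^+ 2) (a / q ^+ 4 * d) <= a / q ^+ 3 * Num.sqrt d.
Proof.
move=> q0 a0 d0; have qn0 : q != 0 by rewrite gt_eqF.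
have s0 := sqrtr_ge0 d; have sE := sqr_sqrtr d0.
have i0 : 0 <= a / q ^+ 4 by rewrite divr_ge0// exprn_ge0// ltW.
have [h|h] := leP (Num.sqrt d) q.
  rewrite ge_min; apply/orP; right.
  have -> : a / q ^+ 3 * Num.sqrt d = a / q ^+ 4 * (q * Num.sqrt d) by field.
  by rewrite ler_wpM2l// -{1}sE expr2 ler_wpM2r.
rewrite ge_min; apply/orP; left.
have -> : a / q ^+ 2 = a / q ^+ 4 * (q * q) by field.
have -> : a / q ^+ 3 * Num.sqrt d = a / q ^+ 4 * (q * Num.sqrt d) by field.
by rewrite ler_wpM2l// ler_wpM2l// ltW.
Qed.

Lemma heat_op1_holder (C : R) (phi : R -> R) x y t : bounded_cont C phi -> 0 < t ->
  `|heat_op 1 phi x t - heat_op 1 phi y t| <=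
  2 * C * heat_const R / rt4 t ^+ 3 * Num.sqrt `|x - y|.
Proof.
move=> bphi t0; have q0 := rt4_gt0 t0; have H0 := heat_const_ge0 R.
have C0 : 0 <= C by apply: le_trans (bphi.2 0).
have h1 z : `|heat_op 1 phi z t| <= C * heat_const R / rt4 t ^+ 2.
  by have := heat_op_le bphi 1 z t; rewrite expr1 rt4_sqr.
have h2 z : `|heat_op 2 phi z t| <= 2 * C * heat_const R / rt4 t ^+ 4.
  apply: (le_trans (heat_op_le bphi 2 z t)); rewrite -rt4_sqr -exprM.
  rewrite ler_wpM2r ?invr_ge0 ?exprn_ge0 ?(ltW q0)//.
  by have h := mulr_ge0 C0 H0; rewrite -[leRHS]mulrA; lra.
have h3 := derive_bounded_lipschitz (fun z => is_derive_heat_op bphi z (isT : (1 < 2)%N) t0) h2 x y.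
have a0 : 0 <= 2 * C * heat_const R by apply: mulr_ge0 => //; exact: mulr_ge0.
apply: (le_trans _ (min_le_sqrt q0 a0 (normr_ge0 _))).
rewrite le_min h3 andbT; apply: (le_trans (ler_normB _ _)).
have -> : 2 * C * heat_const R / rt4 t ^+ 2 = C * heat_const R / rt4 t ^+ 2 + C * heat_const R / rt4 t ^+ 2 by ring.
by apply: lerD.
Qed.

(** The weight s^(-3/4) is the worst one that [heat_bounded] tolerates in the source time. *)
Definition half_holder N := forall T, 0 < T -> exists2 K, 0 <= K &
  forall x y s, 0 < s <= T -> `|N x s - N y s| <= K / rt4 s ^+ 3 * Num.sqrt `|x - y|.

Lemma heat_bounded2 N : source N -> half_holder N -> heat_bounded 2 N.
Proof.
move=> sN hN T T0; have [K K0 hK] := hN T T0; have H0 := heat_const_ge0 R.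
exists (K * heat_const R); first exact: mulr_ge0.
move=> x s t sT /andP[t0 tT]; have [s0 _] := andP sT.
have [C bC] := source_slice1 sN s0.
have := heat_op2_holder (x := x) bC t0 (fun y => hK y x s sT).
move=> h; apply: (le_trans h); rewrite -/(rt4 t).
have qs := rt4_neq0 s0; have qt := rt4_neq0 t0.
by rewrite le_eqVlt; apply/orP; left; apply/eqP; field; rewrite qs qt.
Qed.

(** Integrating s^(-1/2) (t - s)^(-3/4) gives t^(-1/4), better than t^(-3/4); the surplus t^(1/2) is
    at most rt4 T ^+ 2. *)
Lemma duh1_half_holder N : source N -> half_holder (fun x t => duh 1 N x t 0).
Proof.
move=> sN T T0; have bN : heat_bounded 1 N by exact: heat_bounded_source.
have [C C0 hC] := sN.2 T T0; have H0 := heat_const_ge0 R; have B0 := beta_const_ge0 R.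
exists (rt4 T ^+ 2 * (2 * C * heat_const R * beta_const R)).
  by rewrite (mulr_ge0 _ (mulr_ge0 (mulr_ge0 (mulr_ge0 (ler0n _ 2) C0) H0) B0))// exprn_ge0// rt4_ge0.
move=> x y t /andP[t0 tT]; rewrite /duh -mulrBr -RintegralB//; [|exact: integrable_duh..].
have q0 := rt4_gt0 t0; have qn0 := rt4_neq0 t0.
set d := Num.sqrt `|x - y|; have d0 : 0 <= d by exact: sqrtr_ge0.
pose g (r : RR) : R := heat_op 1 (N ^~ (t * r)) x (t * (1 - r) + `|0 : R|) -
    heat_op 1 (N ^~ (t * r)) y (t * (1 - r) + `|0 : R|).
have mg : measurable_fun D01 g.
  by apply: measurable_funB; exact: measurable_duh_integrand.
have L : `|\int[mu]_(r in D01) g r| <= (2 * C * heat_const R / rt4 t ^+ 5 * d) * beta_const R.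
  rewrite /beta_const; apply: (dominated_Rintegral_le mD01 (integrable_beta14 R) mg).
  move=> r; rewrite /D01/= in_itv/= => /andP[r0 r1]; have r1' : 0 < 1 - r by lra.
  have tr0 : 0 < t * r by rewrite mulr_gt0.
  have tr1 : 0 < t * (1 - r) by rewrite mulr_gt0.
  have trT : t * r <= T by nra.
  have bc : bounded_cont (C / Num.sqrt (t * r)) (N ^~ (t * r)).
    split=> z; first by apply: (cvg_joint (sN.1 z _ tr0)); [exact: cvg_id|exact: cvg_cst].
    by apply: hC; rewrite tr0.
  rewrite /g normr0 addr0.
  apply: (le_trans (heat_op1_holder x y bc tr1)).
  rewrite -(rt4_sqr (t * r)) !rt4M ?(ltW t0)// /beta14 -/d.
  have a0 := rt4_gt0 r0; have b0 := rt4_gt0 r1'.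
  have an0 := rt4_neq0 r0; have bn0 := rt4_neq0 r1'.
  have a1 : rt4 r <= 1 by rewrite -(rt41 R) rt4_le// ltW.
  (* r^(-1/2) is written as r^(-3/4) r^(1/4), to fit [beta14] up to a factor at most 1. *)
  have -> : 2 * (C / (rt4 t * rt4 r) ^+ 2) * heat_const R / (rt4 t * rt4 (1 - r)) ^+ 3 * d =
    (2 * C * heat_const R / rt4 t ^+ 5 * d) * (rt4 r ^+ 3 * rt4 (1 - r) ^+ 3)^-1 * rt4 r.
    by field; do ?[apply/andP; split].
  rewrite ler_piMr// mulr_ge0//; last by rewrite invr_ge0 mulr_ge0// exprn_ge0// ltW.
  apply: mulr_ge0 => //; apply: divr_ge0; last by rewrite exprn_ge0// ltW.
  exact: (mulr_ge0 (mulr_ge0 (ler0n _ 2) C0) H0).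
rewrite normrM (gtr0_norm t0); apply: (le_trans (ler_wpM2l (ltW t0) L)).
have qT := rt4_le tT.
have -> : t * (2 * C * heat_const R / rt4 t ^+ 5 * d * beta_const R) =
   rt4 t ^+ 2 * ((2 * C * heat_const R * beta_const R) / rt4 t ^+ 3 * d).
  by rewrite -{1}(rt4_exp4 (ltW t0)); field.
have -> : rt4 T ^+ 2 * (2 * C * heat_const R * beta_const R) / rt4 t ^+ 3 * d =
   rt4 T ^+ 2 * ((2 * C * heat_const R * beta_const R) / rt4 t ^+ 3 * d) by rewrite !mulrA.
apply: ler_wpM2r.
  apply: mulr_ge0 => //; apply: divr_ge0; last by rewrite exprn_ge0// ltW.
  exact: (mulr_ge0 (mulr_ge0 (mulr_ge0 (ler0n _ 2) C0) H0) B0).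
by apply: lerXn2r; rewrite ?nnegrE ?rt4_ge0.
Qed.

End duhamel_time.

(** * Exponentially weighted bounds for Duhamel's integral *)

Section weighted.
Context (R : realType).
Notation mu := (@lebesgue_measure R).
Let RR : measurableType _ := measurableTypeR R.
Implicit Types (N u v : R -> R -> R) (x t h s r K M T : R).

Lemma rt4_le_expR x : 0 <= x -> rt4 x <= expR x.
Proof.
move=> x0; apply: le_trans (expR_ge1Dx x).
have q0 := rt4_ge0 x; have E := rt4_exp4 x0.
have h1 := sqr_ge0 (rt4 x - 1); have h2 := sqr_ge0 (rt4 x ^+ 2 - 1).
have e4 : rt4 x ^+ 4 = (rt4 x ^+ 2) ^+ 2 by rewrite -exprM.
by rewrite sqrrB1 in h1; rewrite sqrrB1 -e4 E in h2; lra.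
Qed.

(** The weight brings exp(- K (t - s)) <= (K (t - s))^(-1/4). For j < 2 this extra quarter power of
    t - s is still integrable, and the gain K^(-1/4) is as small as desired on bounded times. *)
Lemma duh_weighted j N K M t x : (j < 2)%N -> source N -> 0 < K -> 0 <= M -> 0 < t ->
  (forall y s, 0 < s <= t -> `|N y s| <= M * expR (K * s) / Num.sqrt s) ->
  `|duh j N x t 0| <= heat_const R * beta_const R * rt4 t / rt4 K * (M * expR (K * t) / Num.sqrt t ^+ j).
Proof.
move=> j2 sN K0 M0 t0 hN.
have H0 := heat_const_ge0 R; have B0 := beta_const_ge0 R.
have qt := rt4_gt0 t0; have qtn := rt4_neq0 t0; have qK := rt4_gt0 K0; have qKn := rt4_neq0 K0.
have e0 := expR_gt0 (K * t).
pose A := M * heat_const R * expR (K * t) / (rt4 K * rt4 t ^+ (3 + 2 * j)).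
have A0 : 0 <= A.
  apply: divr_ge0; first exact: (mulr_ge0 (mulr_ge0 M0 H0) (ltW e0)).
  by apply: mulr_ge0; [exact: ltW|rewrite exprn_ge0// ltW].
have -> : heat_const R * beta_const R * rt4 t / rt4 K * (M * expR (K * t) / Num.sqrt t ^+ j) =
    t * (A * beta_const R).
  rewrite /A -(rt4_sqr t) -exprM exprD -{4}(rt4_exp4 (ltW t0)).
  have pn : rt4 t ^+ (2 * j) != 0 by rewrite expf_neq0.
  by set p := _ ^+ (2 * j) in pn *; field; rewrite pn qtn qKn.
apply: (duh_le sN t0) => r /andP[r0 r1]; have r1' : 0 < 1 - r by lra.
have tr0 : 0 < t * r by rewrite mulr_gt0.
have trt : t * r <= t by exact: (ler_piMr (ltW t0) (ltW r1)).
have bc : bounded_cont (M * expR (K * (t * r)) / Num.sqrt (t * r)) (N ^~ (t * r)).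
  split=> z; first by apply: (cvg_joint (sN.1 z _ tr0)); [exact: cvg_id|exact: cvg_cst].
  by apply: hN; rewrite tr0.
rewrite normr0 addr0; apply: (le_trans (heat_op_le bc j x _)).
have a0 := rt4_gt0 r0; have b0 := rt4_gt0 r1'.
have a1 := rt4_le (ltW r1); rewrite rt41 in a1.
have b1 : rt4 (1 - r) <= rt4 1 by apply: rt4_le; lra.
rewrite rt41 in b1.
have an := rt4_neq0 r0; have bn := rt4_neq0 r1'.
have eE : expR (K * (t * r)) <= expR (K * t) / (rt4 K * rt4 t * rt4 (1 - r)).
  have -> : K * (t * r) = K * t - K * (t * (1 - r)) by ring.
  have d0 : 0 < rt4 K * rt4 t * rt4 (1 - r) by do ! apply: mulr_gt0.
  have m0 : 0 <= K * (t * (1 - r)) by do ! apply: mulr_ge0; exact: ltW.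
  rewrite expRD expRN ler_wpM2l ?(ltW e0)// lef_pV2 ?posrE ?expR_gt0 ?d0//.
  by apply: le_trans (rt4_le_expR m0); rewrite !rt4M ?(ltW K0) ?(ltW t0)// mulrA.
have sj : Num.sqrt (t * (1 - r)) ^+ j = (rt4 t * rt4 (1 - r)) ^+ (2 * j).
  by rewrite -(rt4_sqr (t * (1 - r))) rt4M ?(ltW t0)// -exprM.
rewrite sj -(rt4_sqr (t * r)) rt4M ?(ltW t0)//.
apply: (@le_trans _ _ (M * (expR (K * t) / (rt4 K * rt4 t * rt4 (1 - r))) / (rt4 t * rt4 r) ^+ 2 *
  heat_const R / (rt4 t * rt4 (1 - r)) ^+ (2 * j))).
  have i1 : 0 <= ((rt4 t * rt4 (1 - r)) ^+ (2 * j))^-1.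
    by rewrite invr_ge0 exprn_ge0//; apply: mulr_ge0; exact: ltW.
  have i2 : 0 <= ((rt4 t * rt4 r) ^+ 2)^-1 by rewrite invr_ge0 sqr_ge0.
  by do 3 apply: ler_wpM2r => //; exact: ler_wpM2l.
have -> : M * (expR (K * t) / (rt4 K * rt4 t * rt4 (1 - r))) / (rt4 t * rt4 r) ^+ 2 *
  heat_const R / (rt4 t * rt4 (1 - r)) ^+ (2 * j) = A * (rt4 r ^+ 2 * rt4 (1 - r) ^+ (1 + 2 * j))^-1.
  rewrite /A !exprMn !exprD.
  by field; rewrite (expf_neq0 j bn) (expf_neq0 j qtn) bn an qtn qKn.
rewrite ler_wpM2l// /beta14 lef_pV2 ?posrE ?mulr_gt0 ?exprn_gt0//.
have c1 : rt4 r ^+ 3 <= rt4 r ^+ 2 by rewrite exprS ler_piMl// exprn_ge0// ltW.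
have c2 : rt4 (1 - r) ^+ 3 <= rt4 (1 - r) ^+ (1 + 2 * j).
  apply: ler_wiXn2l => //; first exact: ltW.
  by case: j j2 {A A0 sj} => [|[|]].
by apply: ler_pM => //; rewrite exprn_ge0// ltW.
Qed.

(** The datum is regarded as a source constant in time, evaluated at time 1. *)
Lemma cvg_heat_op_fixed j (C : R) (phi : R -> R) (T : pseudoMetricType R) (A : set T) (p : T)
    (X U : T -> R) x t : bounded_cont C phi -> (0 < t) || (j == 0)%N ->
  X q @[q --> within A (nbhs p)] --> x -> U q @[q --> within A (nbhs p)] --> t ->
  heat_op j phi (X q) (U q) @[q --> within A (nbhs p)] --> heat_op j phi x t.
Proof.
move=> [cphi bphi] tj cX cU.
have C0 : 0 <= C by apply: le_trans (bphi 0).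
have sN : source (fun y _ : R => phi y).
  split=> [y s s0|S S0].
    exact: (@cvg_comp _ _ _ (fst : R * R -> R) phi _ _ _ cvg_fst (cphi y)).
  exists (C * Num.sqrt S); first by rewrite mulr_ge0// sqrtr_ge0.
  move=> y s /andP[s0 sS]; have ss : 0 < Num.sqrt s by rewrite sqrtr_gt0.
  by rewrite ler_pdivlMr//; apply: ler_pM => //; exact: ler_wsqrtr.
exact: (cvg_heat_op (S := fun=> 1) sN ltr01 tj cX (cvg_cst _) cU).
Qed.

End weighted.

(** * Picard iteration *)

Section picard.
Context (R : realType).
Implicit Types (u v N : R -> R -> R) (x y t h s r K M T : R).

Lemma lipschitz_continuous (g : R -> R) M :
  (forall y z, `|g y - g z| <= M * `|y - z|) -> continuous g.
Proof.
move=> gM y; apply/cvgrPdist_lt => e e0.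
have M0 : 0 <= M by have := gM (y + 1) y; rewrite addrAC subrr add0r normr1 mulr1; apply: le_trans.
have d0 : 0 < e / (M + 1) by rewrite divr_gt0//; lra.
apply/nbhs_ballP; exists (e / (M + 1)) => //= z; rewrite /ball/= => yz.
apply: (le_lt_trans (gM _ _)).
apply: (@le_lt_trans _ _ ((M + 1) * `|y - z|)); first by rewrite ler_wpM2r//; lra.
by rewrite mulrC -ltr_pdivlMr//; lra.
Qed.

(** The rate s^(1/4) gives boundedness of u and attainment of the initial datum. *)
Lemma source_small N t x : source N -> 0 < t -> exists2 C, 0 <= C &
  forall y s, 0 < s <= t -> `|duh 0 N y s 0| <= C * rt4 s.
Proof.
move=> sN t0; have [C C0 hC] := sN.2 t t0.
have H0 := heat_const_ge0 R; have B0 := beta_const_ge0 R.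
have e0 := expR_gt0 (1 * t).
exists (heat_const R * beta_const R * (C * expR (1 * t))).
  by apply: mulr_ge0; apply: mulr_ge0 => //; exact: ltW.
move=> y s /andP[s0 st].
have hN z r : 0 < r <= s -> `|N z r| <= C * expR (1 * r) / Num.sqrt r.
  move=> /andP[r0 rs]; apply: (le_trans (hC z r _)); first by rewrite r0/= (le_trans rs).
  rewrite ler_wpM2r ?invr_ge0 ?sqrtr_ge0// ler_peMr//.
  by have := expR_ge1Dx (1 * r); lra.
have := duh_weighted y (isT : (0 < 2)%N) sN ltr01 C0 s0 hN.
rewrite rt41 divr1 expr0 divr1 => h; apply: (le_trans h).
rewrite mulrAC; apply: ler_wpM2r; first exact: rt4_ge0.
apply: ler_wpM2l; first exact: mulr_ge0.
by apply: ler_wpM2l => //; rewrite ler_expR; lra.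
Qed.

Definition jointly_continuous u := forall x s, 0 < s ->
  {for (x, s), continuous (fun z : R * R => u z.1 z.2)}.

Definition singular_bound v := forall T, 0 < T -> exists2 C, 0 <= C &
  forall x s, 0 < s <= T -> `|v x s| <= C / Num.sqrt s.

Variables (phi : R -> R) (Cphi : R) (b f : R -> R) (L : R).
Hypotheses (bphi : bounded_cont Cphi phi)
  (b1 : forall y, `|b y| <= 1) (bl : forall y z, `|b y - b z| <= `|y - z|)
  (fL : forall y, `|f y| <= L) (fl : forall y z, `|f y - f z| <= L * `|y - z|).

Let L0 : 0 <= L. Proof. exact: le_trans (fL 0). Qed.

Let C0 : 0 <= Cphi. Proof. exact: le_trans (bphi.2 0). Qed.

Definition reaction u v : R -> R -> R := fun x s => f (u x s) - b (u x s) * v x s.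

Lemma reaction_le u v x s : `|reaction u v x s| <= L + `|v x s|.
Proof.
apply: (le_trans (ler_normB _ _)); apply: lerD => //.
by rewrite normrM ler_piMl.
Qed.

(** The product is split so that the bounded factor b(u) meets the difference of the gradients; the
    singular gradient v' then multiplies only the difference of u. *)
Lemma reaction_diff u v u' v' x y s s' :
  `|reaction u v x s - reaction u' v' y s'| <=
  (`|v' y s'| + L) * `|u x s - u' y s'| + `|v x s - v' y s'|.
Proof.
have -> : reaction u v x s - reaction u' v' y s' =
    (f (u x s) - f (u' y s')) + - ((b (u x s) - b (u' y s')) * v' y s') +
    - (b (u x s) * (v x s - v' y s')) by rewrite /reaction; ring.
apply: (le_trans (ler_normD _ _)); rewrite normrN normrM.
apply: lerD; last by rewrite ler_piMl.
apply: (le_trans (ler_normD _ _)); rewrite normrN normrM mulrDl addrC.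
by apply: lerD => //; rewrite mulrC ler_wpM2l.
Qed.

Lemma source_reaction u v : jointly_continuous u -> jointly_continuous v ->
  singular_bound v -> source (reaction u v).
Proof.
have cb : continuous b by apply: (@lipschitz_continuous b 1) => y z; rewrite mul1r.
have cf : continuous f by apply: lipschitz_continuous fl.
move=> cu cv bv; split=> [x s s0|T T0].
  have cus := cu x s s0; have cvs := cv x s s0.
  apply: cvgB; first exact: (@cvg_comp _ _ _ (fun z : R * R => u z.1 z.2) f _ _ _ cus (cf _)).
  apply: cvgM => //.
  exact: (@cvg_comp _ _ _ (fun z : R * R => u z.1 z.2) b _ _ _ cus (cb _)).
have [C Cp hC] := bv T T0; exists (L * Num.sqrt T + C).
  by rewrite addr_ge0// mulr_ge0// sqrtr_ge0.
move=> x s /andP[s0 sT]; apply: (le_trans (reaction_le _ _ _ _)).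
have ss : 0 < Num.sqrt s by rewrite sqrtr_gt0.
rewrite mulrDl; apply: lerD; last by apply: hC; rewrite s0.
by rewrite -mulrA ler_peMr// ler_pdivlMr// mul1r ler_wsqrtr.
Qed.

Let step j N x t := heat_op j phi x t + duh j N x t 0.

Lemma jointly_continuous_mild j N : source N -> heat_bounded j N -> jointly_continuous (step j N).
Proof.
move=> sN bN x t t0; apply: cvgD.
  have := @cvg_heat_op_fixed R j Cphi phi (R * R)%type setT (x, t) fst snd x t bphi.
  by rewrite withinET t0; apply => //; [exact: cvg_fst|exact: cvg_snd].
have := @cvg_duh R j N (R * R)%type setT (x, t) fst snd (fun=> 0) x t 0 sN bN t0.
by rewrite withinET; apply; [exact: cvg_fst|exact: cvg_snd|exact: cvg_cst].
Qed.

Lemma heat_op1_bound x t : `|heat_op 1 phi x t| <= Cphi * heat_const R / Num.sqrt t.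
Proof. by have := heat_op_le bphi 1 x t; rewrite expr1. Qed.

Lemma weight_exists T D : 0 < D -> 0 < T ->
  exists2 K, 0 < K & forall t, 0 < t <= T ->
   heat_const R * beta_const R * rt4 t / rt4 K <= D^-1.
Proof.
move=> D0 T0; have H0 := heat_const_ge0 R; have B0 := beta_const_ge0 R.
have HB := mulr_ge0 H0 B0.
have qT := rt4_ge0 T; have HBT := mulr_ge0 HB qT.
(* The weight will be K = k^4, so that its fourth root is explicit; the summand 1 keeps k
   positive. *)
pose k := D * (heat_const R * beta_const R * rt4 T + 1).
have k0 : 0 < k by rewrite mulr_gt0//; lra.
have qk : rt4 (k ^+ 4) = k.
  rewrite /rt4 (exprM k 2 2) sqrtr_sqr ger0_norm ?sqr_ge0// sqrtr_sqr ger0_norm//.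
  exact: ltW.
exists (k ^+ 4); first by rewrite exprn_gt0.
move=> t /andP[t0 tT]; rewrite qk /k ler_pdivrMr// mulrA mulVf ?gt_eqF// mul1r.
have := ler_wpM2l HB (rt4_le tT); lra.
Qed.

Lemma source_bound_exp N M t : 0 <= M ->
  (forall y s, 0 < s <= t -> `|N y s| <= M / Num.sqrt s) ->
  forall K, 0 < K -> forall y s, 0 < s <= t -> `|N y s| <= M * expR (K * s) / Num.sqrt s.
Proof.
move=> M0 hN K K0 y s st; have [s0 _] := andP st; apply: (le_trans (hN y s st)).
rewrite ler_wpM2r ?invr_ge0 ?sqrtr_ge0// ler_peMr//.
by have := expR_ge1Dx (K * s); have := mulr_ge0 (ltW K0) (ltW s0); lra.
Qed.

Lemma singular_bound_step N : source N -> singular_bound (step 1 N).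
Proof.
move=> sN T T0; have [C Cp hC] := sN.2 T T0; have H0 := heat_const_ge0 R.
have [K K0 hK] := weight_exists ltr01 T0.
exists (Cphi * heat_const R + C * expR (K * T)).
  by apply: addr_ge0; apply: mulr_ge0 => //; exact: expR_ge0.
move=> x t /andP[t0 tT]; apply: (le_trans (ler_normD _ _)); rewrite mulrDl.
apply: lerD; first exact: heat_op1_bound.
have hCt y s : 0 < s <= t -> `|N y s| <= C / Num.sqrt s.
  by move=> /andP[s0 st]; apply: hC; rewrite s0 (le_trans st).
have := duh_weighted x (isT : (1 < 2)%N) sN K0 Cp t0 (source_bound_exp Cp hCt K0).
rewrite expr1 => h; apply: (le_trans h).
have W0 : 0 <= C * expR (K * t) / Num.sqrt t.
  by rewrite divr_ge0 ?sqrtr_ge0// mulr_ge0// expR_ge0.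
have hKt : heat_const R * beta_const R * rt4 t / rt4 K <= 1^-1 by apply: hK; rewrite t0.
apply: (le_trans (ler_wpM2r W0 hKt)); rewrite invr1 mul1r.
rewrite ler_wpM2r ?invr_ge0 ?sqrtr_ge0// ler_wpM2l// ler_expR.
by rewrite ler_wpM2l// ltW.
Qed.

Fixpoint picard n : (R -> R -> R) * (R -> R -> R) :=
  match n with
  | 0 => (heat_op 0 phi, heat_op 1 phi)
  | n.+1 => let N := reaction (picard n).1 (picard n).2 in (step 0 N, step 1 N)
  end.

Let un n := (picard n).1.
Let vn n := (picard n).2.
Let Nn n := reaction (un n) (vn n).

Lemma picard_admissible n : [/\ jointly_continuous (un n), jointly_continuous (vn n) &
  singular_bound (vn n)].
Proof.
elim: n => [|n [cu cv bv]].
  have hc j : jointly_continuous (heat_op j phi).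
    move=> x t t0.
    have := @cvg_heat_op_fixed R j Cphi phi (R * R)%type setT (x, t) fst snd x t bphi.
    by rewrite withinET t0; apply => //; [exact: cvg_fst|exact: cvg_snd].
  split; [exact: hc|exact: hc|].
  move=> T T0; exists (Cphi * heat_const R); first by rewrite mulr_ge0// heat_const_ge0.
  by move=> x s _; exact: heat_op1_bound.
have sN := source_reaction cu cv bv.
split; [exact: (jointly_continuous_mild sN (heat_bounded_source _ sN))..|].
exact: singular_bound_step.
Qed.

Lemma picard_source n : source (Nn n).
Proof. by have [? ? ?] := picard_admissible n; exact: source_reaction. Qed.

(** Uniform in n, because the reaction grows at most linearly in the gradient: |f| <= L and |b| <=
    1. The contraction estimate rests on it, as [reaction_diff] involves the gradient itself. *)
Lemma picard_gradient_bound T : 0 < T -> exists2 V, 0 <= V &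
  forall n x s, 0 < s <= T -> `|vn n x s| <= V / Num.sqrt s.
Proof.
move=> T0; have [K K0 hK] := weight_exists (ltr0Sn R 1) T0.
have H0 := heat_const_ge0 R; have sT0 := sqrtr_ge0 T.
pose A := Cphi * heat_const R; have A0 : 0 <= A by exact: mulr_ge0.
have LT := mulr_ge0 L0 sT0.
(* V solves V = A + (V + L sqrt T) / 2, so the induction reproduces it when the weighted Duhamel
   factor is 1/2. *)
pose V := 2 * A + L * Num.sqrt T; have V0 : 0 <= V by rewrite /V; lra.
have key n x s : 0 < s <= T -> `|vn n x s| <= V * expR (K * s) / Num.sqrt s.
  elim: n x s => [|n IH] x s /andP[s0 sT].
    apply: (le_trans (heat_op1_bound x s)); rewrite ler_wpM2r ?invr_ge0 ?sqrtr_ge0//.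
    have e1 : 1 <= expR (K * s).
      by have := expR_ge1Dx (K * s); have := mulr_ge0 (ltW K0) (ltW s0); lra.
    by apply: (@le_trans _ _ V); [rewrite /V -/A; lra|rewrite ler_peMr].
  have hN y r : 0 < r <= s -> `|Nn n y r| <= (V + L * Num.sqrt T) * expR (K * r) / Num.sqrt r.
    move=> /andP[r0 rs]; have rT := le_trans rs sT.
    apply: (le_trans (reaction_le _ _ _ _)); rewrite addrC mulrDl mulrDl.
    apply: lerD; first by apply: IH; rewrite r0.
    have ss : 0 < Num.sqrt r by rewrite sqrtr_gt0.
    have e1 : 1 <= expR (K * r).
      by have := expR_ge1Dx (K * r); have := mulr_ge0 (ltW K0) (ltW r0); lra.
    rewrite ler_pdivlMr// -mulrA ler_wpM2l//.
    by apply: (le_trans (ler_wsqrtr rT)); rewrite ler_peMr.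
  have V1 : 0 <= V + L * Num.sqrt T by exact: addr_ge0.
  apply: (le_trans (ler_normD _ _)).
  have hd := duh_weighted x (isT : (1 < 2)%N) (picard_source n) K0 V1 s0 hN.
  rewrite expr1 in hd.
  have e1 : 1 <= expR (K * s).
    by have := expR_ge1Dx (K * s); have := mulr_ge0 (ltW K0) (ltW s0); lra.
  have i0 : 0 <= (Num.sqrt s)^-1 by rewrite invr_ge0 sqrtr_ge0.
  have W0 : 0 <= (V + L * Num.sqrt T) * expR (K * s) / Num.sqrt s.
    by apply: mulr_ge0 => //; apply: mulr_ge0 => //; exact: expR_ge0.
  have hKs : heat_const R * beta_const R * rt4 s / rt4 K <= 2^-1 by apply: hK; rewrite s0.
  have hd2 := le_trans hd (ler_wpM2r W0 hKs).
  apply: (le_trans (lerD (heat_op1_bound x s) hd2)).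
  rewrite -/A mulrA -mulrDl ler_wpM2r// mulrA.
  have h : A <= A * expR (K * s) by rewrite ler_peMr.
  apply: (@le_trans _ _ ((A + 2^-1 * (V + L * Num.sqrt T)) * expR (K * s))).
    by rewrite mulrDl lerD2r.
  by rewrite ler_wpM2r ?expR_ge0// /V; lra.
exists (V * expR (K * T)); first by rewrite mulr_ge0// expR_ge0.
move=> n x s /andP[s0 sT]; apply: (le_trans (key n x s _)); first by rewrite s0.
rewrite ler_wpM2r ?invr_ge0 ?sqrtr_ge0// ler_wpM2l// ler_expR.
by rewrite ler_wpM2l// ltW.
Qed.

Lemma picard_contraction T : 0 < T -> exists2 E, 0 <= E &
  forall n x s, 0 < s <= T ->
    `|un n.+1 x s - un n x s| <= E * 2^-1 ^+ n /\
    `|vn n.+1 x s - vn n x s| <= E * 2^-1 ^+ n / Num.sqrt s.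
Proof.
move=> T0; have [V V0 hV] := picard_gradient_bound T0.
have sT0 := sqrtr_ge0 T; have LT := mulr_ge0 L0 sT0.
(* D is the Lipschitz constant of the reaction along the iterates in the weighted norms; a Duhamel
   factor 1 / (2 D) makes the map contract by 1/2. *)
pose D := V + L * Num.sqrt T + 1; have D0 : 0 < D by rewrite /D; lra.
have D20 : 0 < 2 * D by lra.
have [K K0 hK] := weight_exists D20 T0.
have HB := mulr_ge0 (heat_const_ge0 R) (beta_const_ge0 R).
have e1 s : 0 < s -> 1 <= expR (K * s).
  by move=> s0; have := expR_ge1Dx (K * s); have := mulr_ge0 (ltW K0) (ltW s0); lra.
have [C Cp hC] := (picard_source 0).2 T T0.
have Kd s : 0 < s <= T -> heat_const R * beta_const R * rt4 s / rt4 K <= (2 * D)^-1 by exact: hK.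
have st_weak N M j x s : (j < 2)%N -> source N -> 0 <= M -> 0 < s <= T ->
    (forall y r, 0 < r <= s -> `|N y r| <= M * expR (K * r) / Num.sqrt r) ->
    `|duh j N x s 0| <= (2 * D)^-1 * M * expR (K * s) / Num.sqrt s ^+ j.
  move=> j2 sN M0 sT hN; have [s0 _] := andP sT.
  have hd := duh_weighted x j2 sN K0 M0 s0 hN.
  have W0 : 0 <= M * expR (K * s) / Num.sqrt s ^+ j.
    by rewrite divr_ge0 ?exprn_ge0 ?sqrtr_ge0// mulr_ge0// expR_ge0.
  by apply: (le_trans (le_trans hd (ler_wpM2r W0 (Kd s sT)))); rewrite !mulrA.
pose d0 := (2 * D)^-1 * C; have d00 : 0 <= d0 by rewrite mulr_ge0// invr_ge0 ltW.
have key n x s : 0 < s <= T ->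
    `|un n.+1 x s - un n x s| <= d0 * 2^-1 ^+ n * expR (K * s) /\
    `|vn n.+1 x s - vn n x s| <= d0 * 2^-1 ^+ n * expR (K * s) / Num.sqrt s.
  elim: n x s => [|n IH] x s sT; have [s0 sT'] := andP sT.
    have hN y r : 0 < r <= s -> `|Nn 0 y r| <= C * expR (K * r) / Num.sqrt r.
      move=> /andP[r0 rs]; have rT := le_trans rs sT'.
      apply: (le_trans (hC y r _)); first by rewrite r0.
      by rewrite ler_wpM2r ?invr_ge0 ?sqrtr_ge0// ler_peMr// e1.
    rewrite /un /vn /= /step !(addrC (heat_op _ _ _ _)) !addrK expr0 mulr1; split.
      by have := st_weak _ _ 0 x s isT (picard_source 0) Cp sT hN; rewrite expr0 divr1.
    by have := st_weak _ _ 1 x s isT (picard_source 0) Cp sT hN; rewrite expr1.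
  pose dN : R -> R -> R := fun y r => Nn n.+1 y r - Nn n y r.
  have sB : source dN.
    have [c1 c2] := picard_source n.+1; have [c3 c4] := picard_source n; split.
      by move=> y r r0; apply: cvgB; [exact: c1|exact: c3].
    move=> S S0; have [E1 E10 hE1] := c2 S S0; have [E2 E20 hE2] := c4 S S0.
    exists (E1 + E2); first exact: addr_ge0.
    move=> y r rS; apply: (le_trans (ler_normB _ _)); rewrite mulrDl.
    by apply: lerD; [exact: hE1|exact: hE2].
  pose M := d0 * 2^-1 ^+ n * D.
  have p0 : 0 <= d0 * 2^-1 ^+ n by rewrite mulr_ge0// exprn_ge0// invr_ge0.
  have M0 : 0 <= M by rewrite mulr_ge0// ltW.
  have hN y r : 0 < r <= s -> `|dN y r| <= M * expR (K * r) / Num.sqrt r.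
    move=> /andP[r0 rs]; have rT := le_trans rs sT'.
    have r01 : 0 < r <= T by rewrite r0.
    have [h1 h2] := IH y r r01.
    have ss : 0 < Num.sqrt r by rewrite sqrtr_gt0.
    apply: (le_trans (reaction_diff _ _ _ _ _ _ _ _)).
    have hVL : `|vn n y r| + L <= (V + L * Num.sqrt T) / Num.sqrt r.
      rewrite mulrDl; apply: lerD; first exact: hV.
      by rewrite ler_pdivlMr// ler_wpM2l// ler_wsqrtr.
    apply: (@le_trans _ _ ((V + L * Num.sqrt T) / Num.sqrt r * (d0 * 2^-1 ^+ n * expR (K * r)) +
        d0 * 2^-1 ^+ n * expR (K * r) / Num.sqrt r)).
      by apply: lerD => //; apply: ler_pM => //; rewrite addr_ge0.
    rewrite /M /D le_eqVlt; apply/orP; left; apply/eqP; ring.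
  have DE : (2 * D)^-1 * M = d0 * 2^-1 ^+ n.+1.
    by rewrite /M exprS; field; rewrite gt_eqF.
  have b01 : heat_bounded 0 (Nn n.+1) by apply: heat_bounded_source => //; exact: picard_source.
  have b02 : heat_bounded 0 (Nn n) by apply: heat_bounded_source => //; exact: picard_source.
  have b11 : heat_bounded 1 (Nn n.+1) by apply: heat_bounded_source => //; exact: picard_source.
  have b12 : heat_bounded 1 (Nn n) by apply: heat_bounded_source => //; exact: picard_source.
  have eu : un n.+2 x s - un n.+1 x s = duh 0 dN x s 0.
    rewrite (duhB x (picard_source n.+1) (picard_source n) sB b01 b02 s0).
    by rewrite /un /= /step opprD addrACA subrr add0r.
  have ev : vn n.+2 x s - vn n.+1 x s = duh 1 dN x s 0.
    rewrite (duhB x (picard_source n.+1) (picard_source n) sB b11 b12 s0).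
    by rewrite /vn /= /step opprD addrACA subrr add0r.
  rewrite -DE; split; [rewrite eu|rewrite ev].
    by have := st_weak dN M 0 x s isT sB M0 sT hN; rewrite expr0 divr1.
  by have := st_weak dN M 1 x s isT sB M0 sT hN; rewrite expr1.
exists (d0 * expR (K * T)); first by rewrite mulr_ge0// expR_ge0.
move=> n x s sT; have [h1 h2] := key n x s sT; have [s0 sT'] := andP sT.
have p0 : 0 <= d0 * 2^-1 ^+ n by rewrite mulr_ge0// exprn_ge0// invr_ge0.
have ee : d0 * 2^-1 ^+ n * expR (K * s) <= d0 * expR (K * T) * 2^-1 ^+ n.
  by rewrite [leRHS]mulrAC ler_wpM2l// ler_expR ler_wpM2l// ltW.
split; first exact: le_trans ee.
by apply: (le_trans h2); rewrite ler_wpM2r// invr_ge0 sqrtr_ge0.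
Qed.

End picard.

(** * The limit of the iteration is a mild solution *)

Section limits.
Context (R : realType).
Implicit Types (u v N : R -> R -> R) (x y t h s r K M T : R).

Lemma cvg_half_pow (C : R) : C * 2^-1 ^+ n @[n --> \oo] --> (0 : R).
Proof.
rewrite -[X in _ --> X](mulr0 C); apply: cvgM; first exact: cvg_cst.
by apply: cvg_expr; rewrite ger0_norm ?invr_ge0//; lra.
Qed.

Lemma half_powS_le (E : R) n : 0 <= E -> E * 2^-1 ^+ n.+1 <= E * 2^-1 ^+ n.
Proof.
move=> E0; apply: ler_wpM2l => //.
by rewrite exprS ler_piMl ?exprn_ge0 ?invr_ge0//; lra.
Qed.

Lemma le_half_pow_eq0 (a C : R) : (forall n, `|a| <= C * 2^-1 ^+ n) -> a = 0.
Proof.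
move=> h; apply/eqP; rewrite -normr_le0.
apply: (ler_cvg_to (cvg_cst `|a|) (cvg_half_pow C)).
exact: nearW.
Qed.

Lemma geometric_limit (a : nat -> R) (E : R) : 0 <= E ->
  (forall n, `|a n.+1 - a n| <= E * 2^-1 ^+ n) ->
  forall n, `|limn a - a n| <= 2 * E * 2^-1 ^+ n.
Proof.
move=> E0 ha.
(* The factor 1 - 2^-k, exact for the geometric sum, lets the induction close. *)
have tele n k : `|a (n + k)%N - a n| <= 2 * E * 2^-1 ^+ n * (1 - 2^-1 ^+ k).
  elim: k => [|k IH]; first by rewrite addn0 subrr normr0 expr0 subrr mulr0.
  rewrite addnS -(subrKA (a (n + k)%N)).
  apply: (le_trans (ler_normD _ _)); apply: (le_trans (lerD (ha _) IH)).
  by rewrite exprD exprS le_eqVlt; apply/orP; left; apply/eqP; field.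
have tele1 n k : `|a (n + k)%N - a n| <= 2 * E * 2^-1 ^+ n.
  apply: (le_trans (tele _ _)); apply: ler_piMr.
    by apply: mulr_ge0; [exact: mulr_ge0|rewrite exprn_ge0 ?invr_ge0].
  by rewrite gerBl exprn_ge0 ?invr_ge0.
have tele2 n m : (n <= m)%N -> `|a m - a n| <= 2 * E * 2^-1 ^+ n.
  by move=> /subnKC <-; exact: tele1.
have ca : cvgn a.
  apply: cauchy_cvg; apply: cauchy_exP => e e0.
  have /cvgrPdist_lt/(_ _ e0)[n _ /(_ n (leqnn n))] := cvg_half_pow (2 * E).
  rewrite sub0r normrN /= => hn; exists (a n), n => // m /= nm.
  rewrite /ball/= distrC; apply: le_lt_trans (tele2 _ _ nm) _.
  exact: le_lt_trans (ler_norm _) hn.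
move=> n.
have c1 : `|a m - a n| @[m --> \oo] --> `|limn a - a n|.
  by apply: cvg_norm; apply: cvgB => //; exact: cvg_cst.
apply: (ler_cvg_to c1 (cvg_cst (2 * E * 2^-1 ^+ n))).
by exists n => // m /=; exact: tele2.
Qed.

(** Convergence is uniform on time strips away from 0, which suffices for continuity at positive
    times. *)
Lemma jointly_continuous_limit (w : nat -> R -> R -> R) u :
  (forall n, jointly_continuous (w n)) ->
  (forall T, 0 < T -> exists2 E, 0 <= E & forall n x s, 0 < s <= T ->
     `|u x s - w n x s| <= E * 2^-1 ^+ n / Num.sqrt s) ->
  jointly_continuous u.
Proof.
move=> cw hw x s s0; have T0 : 0 < 2 * s by lra.
have [E E0 hE] := hw _ T0.
have s20 : 0 < s / 2 by lra.
have q0 : 0 < Num.sqrt (s / 2) by rewrite sqrtr_gt0.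
apply/cvgrPdist_lt => e e0.
have e30 : 0 < e / 3 by lra.
have /cvgrPdist_lt/(_ _ e30)[n _ /(_ n (leqnn n))] := cvg_half_pow (E / Num.sqrt (s / 2)).
rewrite sub0r normrN /= => hn.
have {}hE y r : s / 2 < r < 2 * s -> `|u y r - w n y r| < e / 3.
  move=> /andP[r1 r2]; have r0 : 0 < r by lra.
  apply: (le_lt_trans (hE n y r _)); first by rewrite r0 ltW.
  apply: le_lt_trans hn; rewrite ger0_norm; last first.
    by rewrite mulr_ge0 ?exprn_ge0 ?invr_ge0// divr_ge0// ltW.
  rewrite mulrAC ler_wpM2r ?exprn_ge0 ?invr_ge0//.
  rewrite ler_wpM2l// lef_pV2 ?posrE ?sqrtr_gt0//.
  by apply: ler_wsqrtr; exact: ltW.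
have := cw n x s s0 => /cvgrPdist_lt/(_ _ e30) hc.
have hs : \forall q \near ((x, s) : R * R), s / 2 < q.2 < 2 * s.
  have hs1 : \forall r \near s, s / 2 < r < 2 * s.
    near=> r; apply/andP; split; near: r; [apply: lt_nbhsr|apply: lt_nbhsl]; lra.
  have c2 : q.2 @[q --> nbhs ((x, s) : R * R)] --> s by exact: cvg_snd.
  exact: (c2 _ hs1).
near=> q; have hq : s / 2 < q.2 < 2 * s by near: q.
have hc' : `|w n x s - w n q.1 q.2| < e / 3 by near: q.
have h1 : `|u x s - w n x s| < e / 3 by apply: hE; lra.
have h2 := hE q.1 _ hq.
rewrite /= -(subrKA (w n x s)) -[X in `|_ + X|](subrKA (w n q.1 q.2)).
apply: (le_lt_trans (ler_normD _ _)).
have := ler_normD (w n x s - w n q.1 q.2) (w n q.1 q.2 - u q.1 q.2).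
rewrite (distrC (w n q.1 q.2)); lra.
Unshelve. all: by end_near.
Qed.

Lemma sourceB N N' : source N -> source N' -> source (fun y s => N y s - N' y s).
Proof.
move=> [c1 c2] [c3 c4]; split.
  by move=> y r r0; apply: cvgB; [exact: c1|exact: c3].
move=> S S0; have [E1 E10 hE1] := c2 S S0; have [E2 E20 hE2] := c4 S S0.
exists (E1 + E2); first exact: addr_ge0.
move=> y r rS; apply: (le_trans (ler_normB _ _)); rewrite mulrDl.
by apply: lerD; [exact: hE1|exact: hE2].
Qed.

Lemma duh_source_bound j t : (j < 2)%N -> 0 < t -> exists2 G, 0 <= G & forall N M x,
  source N -> 0 <= M -> (forall y s, 0 < s <= t -> `|N y s| <= M / Num.sqrt s) ->
  `|duh j N x t 0| <= G * M.
Proof.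
move=> j2 t0; exists (heat_const R * beta_const R * rt4 t / rt4 1 * (expR (1 * t) / Num.sqrt t ^+ j)).
  have H := mulr_ge0 (mulr_ge0 (heat_const_ge0 R) (beta_const_ge0 R)) (rt4_ge0 t).
  by rewrite rt41 divr1 mulr_ge0// divr_ge0 ?expR_ge0// exprn_ge0// sqrtr_ge0.
move=> N M x sN M0 hN.
have := duh_weighted x j2 sN ltr01 M0 t0 (source_bound_exp M0 hN ltr01).
have e (a c d : R) : d * (M * a * c) = d * (a * c) * M by ring.
by rewrite e.
Qed.

Variables (phi : R -> R) (Cphi : R) (b f : R -> R) (L : R).
Hypotheses (bphi : bounded_cont Cphi phi)
  (b1 : forall y, `|b y| <= 1) (bl : forall y z, `|b y - b z| <= `|y - z|)
  (fL : forall y, `|f y| <= L) (fl : forall y z, `|f y - f z| <= L * `|y - z|)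
  (bN : forall y, b (- y) = - b y) (fN : forall y, f (- y) = - f y).

Let L0 : 0 <= L. Proof. exact: le_trans (fL 0). Qed.

Lemma reaction_odd u v (a : R) :
  (forall y s, 0 < s -> u (a - y) s = - u y s) ->
  (forall y s, 0 < s -> v (a - y) s = v y s) ->
  forall y s, 0 < s -> reaction b f u v (a - y) s = - reaction b f u v y s.
Proof. by move=> ou ev y s s0; rewrite /reaction ou// ev// bN fN; ring. Qed.

(** Both sides of Duhamel's formula are within a multiple of 2^-n of the iterate of rank n + 1, so
    they agree. Oddness is carried along the iterates jointly with evenness of the gradients. *)
Lemma mild_solution : exists u v,
  [/\ jointly_continuous u, jointly_continuous v, singular_bound v,
      forall x t, 0 < t ->
        u x t = heat_op 0 phi x t + duh 0 (reaction b f u v) x t 0 /\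
        v x t = heat_op 1 phi x t + duh 1 (reaction b f u v) x t 0 &
      forall a, (forall y, phi (a - y) = - phi y) ->
        forall y s, 0 < s -> u (a - y) s = - u y s].
Proof.
pose un n := (picard phi b f n).1; pose vn n := (picard phi b f n).2.
pose Nn n := reaction b f (un n) (vn n).
have adm n := picard_admissible bphi b1 bl fL fl n.
have sNn n : source (Nn n) := picard_source bphi b1 bl fL fl n.
pose u x t := limn (fun n => un n x t); pose v x t := limn (fun n => vn n x t).
have lim_bound T : 0 < T -> exists2 E, 0 <= E & forall n x s, 0 < s <= T ->
    `|u x s - un n x s| <= E * 2^-1 ^+ n /\
    `|v x s - vn n x s| <= E * 2^-1 ^+ n / Num.sqrt s.
  move=> T0; have [E E0 hE] := picard_contraction bphi b1 bl fL fl T0.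
  exists (2 * E); first by rewrite mulr_ge0.
  move=> n x s sT; have [s0 _] := andP sT; split.
    by apply: geometric_limit => // m; have [] := hE m x s sT.
  have Es : 0 <= E / Num.sqrt s by rewrite divr_ge0// sqrtr_ge0.
  have := geometric_limit (a := fun n => vn n x s) Es _ n.
  rewrite (_ : 2 * (E / _) * _ = 2 * E * 2^-1 ^+ n / Num.sqrt s); last by ring.
  by apply => m; have [_] := hE m x s sT; rewrite mulrAC.
have cu : jointly_continuous u.
  apply: (@jointly_continuous_limit un) => [n|T T0]; first by have [] := adm n.
  have [E E0 hE] := lim_bound T T0; exists (E * Num.sqrt T); first by rewrite mulr_ge0// sqrtr_ge0.
  move=> n x s sT; have [s0 sT'] := andP sT; have [h _] := hE n x s sT.
  have p0 : 0 <= E * 2^-1 ^+ n by rewrite mulr_ge0// exprn_ge0// invr_ge0.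
  rewrite ler_pdivlMr ?sqrtr_gt0//.
  apply: (@le_trans _ _ (E * 2^-1 ^+ n * Num.sqrt s)); first by rewrite ler_wpM2r// sqrtr_ge0.
  by rewrite [leRHS]mulrAC ler_wpM2l// ler_wsqrtr.
have cv : jointly_continuous v.
  apply: (@jointly_continuous_limit vn) => [n|T T0]; first by have [] := adm n.
  by have [E E0 hE] := lim_bound T T0; exists E => // n x s sT; have [] := hE n x s sT.
have bv : singular_bound v.
  move=> T T0; have [E E0 hE] := lim_bound T T0; have [_ _ bv0] := adm 0.
  have [C C0 hC] := bv0 T T0; exists (E + C); first exact: addr_ge0.
  move=> x s sT; have [_ h] := hE 0 x s sT; rewrite expr0 mulr1 in h.
  by rewrite -[v x s](subrK (vn 0 x s)) mulrDl (le_trans (ler_normD _ _))// lerD// hC.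
have sN : source (reaction b f u v) by apply: (source_reaction (L := L)).
have sB n : source (fun y s => reaction b f u v y s - Nn n y s) by exact: sourceB.
have diffN t : 0 < t -> exists2 D, 0 <= D & forall n y s, 0 < s <= t ->
    `|reaction b f u v y s - Nn n y s| <= D * 2^-1 ^+ n / Num.sqrt s.
  move=> t0; have [E E0 hE] := lim_bound t t0.
  have [V V0 hV] := picard_gradient_bound bphi b1 bl fL fl t0.
  exists ((V + L * Num.sqrt t + 1) * E).
    by rewrite mulr_ge0// addr_ge0// addr_ge0// mulr_ge0// sqrtr_ge0.
  move=> n y s st; have [s0 st'] := andP st; have [h1 h2] := hE n y s st.
  have ss : 0 < Num.sqrt s by rewrite sqrtr_gt0.
  apply: (le_trans (reaction_diff b1 bl fl _ _ _ _ _ _ _ _)).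
  have hVL : `|vn n y s| + L <= (V + L * Num.sqrt t) / Num.sqrt s.
    rewrite mulrDl; apply: lerD; first exact: hV.
    by rewrite ler_pdivlMr// ler_wpM2l// ler_wsqrtr.
  apply: (@le_trans _ _ ((V + L * Num.sqrt t) / Num.sqrt s * (E * 2^-1 ^+ n) +
      E * 2^-1 ^+ n / Num.sqrt s)).
    by apply: lerD => //; apply: ler_pM => //; rewrite addr_ge0.
  by rewrite le_eqVlt; apply/orP; left; apply/eqP; ring.
have diffD j t x : (j < 2)%N -> 0 < t -> exists C, forall n,
    `|duh j (reaction b f u v) x t 0 - duh j (Nn n) x t 0| <= C * 2^-1 ^+ n.
  move=> j2 t0; have [D D0 hD] := diffN t t0; have [G G0 hG] := duh_source_bound j2 t0.
  exists (G * D) => n; rewrite -duhB//; [|exact: heat_bounded_source..].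
  rewrite -mulrA; apply: hG => //; first by rewrite mulr_ge0// exprn_ge0// invr_ge0.
  exact: hD.
have unS n x t : un n.+1 x t = heat_op 0 phi x t + duh 0 (Nn n) x t 0 by [].
have vnS n x t : vn n.+1 x t = heat_op 1 phi x t + duh 1 (Nn n) x t 0 by [].
have subDD (p q r s : R) : p - (q + r) = (p - (q + s)) - (r - s) by ring.
exists u, v; split => //.
  move=> x t t0; have [E E0 hE] := lim_bound t t0.
  have tt : 0 < t <= t by rewrite t0 lexx.
  split; apply/eqP; rewrite -subr_eq0; apply/eqP.
    have [C hC] := @diffD 0 t x isT t0.
    apply: (@le_half_pow_eq0 _ (E + C)) => n.
    have [h _] := hE n.+1 x t tt.
    have e : u x t - (heat_op 0 phi x t + duh 0 (reaction b f u v) x t 0) =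
      (u x t - un n.+1 x t) - (duh 0 (reaction b f u v) x t 0 - duh 0 (Nn n) x t 0).
      by rewrite unS; exact: subDD.
    rewrite e (le_trans (ler_normB _ _))// mulrDl lerD// (le_trans h)//.
    exact: half_powS_le.
  have [C hC] := @diffD 1 t x isT t0.
  apply: (@le_half_pow_eq0 _ (E / Num.sqrt t + C)) => n.
  have [_ h] := hE n.+1 x t tt.
  have e : v x t - (heat_op 1 phi x t + duh 1 (reaction b f u v) x t 0) =
    (v x t - vn n.+1 x t) - (duh 1 (reaction b f u v) x t 0 - duh 1 (Nn n) x t 0).
    by rewrite vnS; exact: subDD.
  rewrite e (le_trans (ler_normB _ _))// mulrDl lerD// (le_trans h)//.
  rewrite [leRHS]mulrAC ler_wpM2r ?invr_ge0 ?sqrtr_ge0//.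
  exact: half_powS_le.
move=> a oa.
have odd_n n : (forall y s, 0 < s -> un n (a - y) s = - un n y s) /\
    (forall y s, 0 < s -> vn n (a - y) s = vn n y s).
  elim: n => [|n [IH1 IH2]].
    by split=> y s s0; [exact: (heat_op0_odd bphi)|exact: (heat_op1_odd bphi)].
  have oN := reaction_odd IH1 IH2.
  split=> y s s0.
    by rewrite !unS (heat_op0_odd bphi _ _ oa) (duh0_odd _ (sNn n) s0 oN) opprD.
  by rewrite !vnS (heat_op1_odd bphi _ _ oa) (duh1_odd _ (sNn n) s0 oN).
move=> y s s0; have [E E0 hE] := lim_bound s s0.
have ss : 0 < s <= s by rewrite s0 lexx.
apply/eqP; rewrite -subr_eq0 opprK; apply/eqP.
apply: (@le_half_pow_eq0 _ (E + E)) => n.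
have [h1 _] := hE n (a - y) s ss; have [h2 _] := hE n y s ss.
have -> : u (a - y) s + u y s = (u (a - y) s - un n (a - y) s) + (u y s - un n y s).
  by have [ev _] := odd_n n; rewrite (ev y s s0); ring.
by rewrite mulrDl (le_trans (ler_normD _ _))// lerD.
Qed.

End limits.

(** * Regularity of the mild solution *)

Section regularity.
Context (R : realType).
Implicit Types (u v N : R -> R -> R) (x y t h s r K M T : R).
Variables (phi : R -> R) (Cphi : R) (b f : R -> R) (L : R).
Hypotheses (bphi : bounded_cont Cphi phi)
  (b1 : forall y, `|b y| <= 1) (bl : forall y z, `|b y - b z| <= `|y - z|)
  (fL : forall y, `|f y| <= L) (fl : forall y z, `|f y - f z| <= L * `|y - z|)
  (bN : forall y, b (- y) = - b y) (fN : forall y, f (- y) = - f y).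

Let L0 : 0 <= L. Proof. exact: le_trans (fL 0). Qed.

Let C0 : 0 <= Cphi. Proof. exact: le_trans (bphi.2 0). Qed.

(** The gradient v is 1/2-Hölder with weight s^(-3/4). For u, boundedness and |u_x| <= V s^(-1/2)
    interpolate to weight s^(-1/4); multiplied by the size s^(-1/2) of v, this gives s^(-3/4)
    again. *)
Lemma mild_half_holder u v :
  jointly_continuous u -> jointly_continuous v -> singular_bound v ->
  (forall x t, 0 < t ->
        u x t = heat_op 0 phi x t + duh 0 (reaction b f u v) x t 0 /\
        v x t = heat_op 1 phi x t + duh 1 (reaction b f u v) x t 0) ->
  half_holder (reaction b f u v).
Proof.
move=> cu cv bv uvE T T0; set N := reaction b f u v in uvE *.
have sN : source N by apply: (source_reaction (L := L)).
have H0 := heat_const_ge0 R.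
have [V V0 hV] := bv T T0.
have [D D0 hD] := duh1_half_holder sN T0.
have [G G0 hG] := source_small 0 sN T0.
pose B := Cphi * heat_const R + G * rt4 T.
have B0 : 0 <= B by exact: addr_ge0 (mulr_ge0 C0 H0) (mulr_ge0 G0 (rt4_ge0 T)).
pose H := 2 * Cphi * heat_const R + D.
have hu x s : 0 < s <= T -> `|u x s| <= B.
  move=> sT; have [s0 sT'] := andP sT; have [-> _] := uvE x s s0.
  apply: (le_trans (ler_normD _ _)); apply: lerD.
    by have := heat_op_le bphi 0 x s; rewrite expr0 divr1.
  by apply: (le_trans (hG x s sT)); rewrite ler_wpM2l// rt4_le.
have hv x y s : 0 < s <= T -> `|v x s - v y s| <= H / rt4 s ^+ 3 * Num.sqrt `|x - y|.
  move=> sT; have [s0 sT'] := andP sT.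
  have [_ ->] := uvE x s s0; have [_ ->] := uvE y s s0.
  rewrite /H opprD addrACA; apply: (le_trans (ler_normD _ _)).
  rewrite [X in X * _]mulrDl mulrDl; apply: lerD.
    exact: heat_op1_holder.
  exact: hD.
have dux x s : 0 < s -> is_derive x 1 (u ^~ s) (v x s).
  move=> s0; have [_ ->] := uvE x s s0.
  have -> : u ^~ s = fun y => heat_op 0 phi y s + duh 0 N y s 0.
    by apply/funext => y; have [] := uvE y s s0.
  by apply: is_derive_add; [exact: (is_derive_heat_op bphi)|
    apply: is_derive_duh => //; exact: heat_bounded_source].
have hul x y s : 0 < s <= T -> `|u x s - u y s| <= (V + 2 * B) / rt4 s * Num.sqrt `|x - y|.
  move=> sT; have [s0 sT'] := andP sT.
  have q0 := rt4_gt0 s0; have qn := rt4_neq0 s0.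
  set d := `|x - y|; have d0 : 0 <= d by exact: normr_ge0.
  have sd := sqrtr_ge0 d.
  have sd2 : Num.sqrt d * Num.sqrt d = d by rewrite -expr2 sqr_sqrtr.
  (* For points closer than s^(1/2) the gradient bound is used, otherwise the sup bound. *)
  have [dq|dq] := leP (Num.sqrt d) (rt4 s).
    have h1 := derive_bounded_lipschitz (fun z => dux z s s0) (fun z => hV z s sT) x y.
    apply: (le_trans h1); rewrite -/d -(rt4_sqr s).
    apply: (@le_trans _ _ (V / rt4 s * Num.sqrt d)).
      have -> : V / rt4 s * Num.sqrt d = V / rt4 s ^+ 2 * (rt4 s * Num.sqrt d) by field.
      rewrite ler_wpM2l// ?divr_ge0 ?exprn_ge0 ?(ltW q0)//.
      by rewrite -{1}sd2 ler_wpM2r.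
    by rewrite !ler_wpM2r ?invr_ge0 ?(ltW q0)//; lra.
  apply: (@le_trans _ _ (2 * B)).
    by apply: (le_trans (ler_normB _ _)); have := hu x s sT; have := hu y s sT; lra.
  have r1 : 1 <= (rt4 s)^-1 * Num.sqrt d by rewrite mulrC ler_pdivlMr// mul1r ltW.
  rewrite -mulrA; apply: (@le_trans _ _ (V + 2 * B)); first lra.
  by rewrite ler_peMr//; lra.
exists ((V + L * rt4 T ^+ 2) * (V + 2 * B) + H).
  have h1 : 0 <= L * rt4 T ^+ 2 by rewrite mulr_ge0// exprn_ge0// rt4_ge0.
  apply: addr_ge0; first by apply: mulr_ge0; lra.
  exact: addr_ge0 (mulr_ge0 (mulr_ge0 (ler0n _ 2) C0) H0) D0.
move=> x y s sT; have [s0 sT'] := andP sT.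
have q0 := rt4_gt0 s0; have qn := rt4_neq0 s0.
apply: (le_trans (reaction_diff b1 bl fl _ _ _ _ _ _ _ _)).
rewrite [X in _ <= X * _]mulrDl [leRHS]mulrDl; apply: lerD; last exact: hv.
apply: (@le_trans _ _ ((V + L * rt4 T ^+ 2) / rt4 s ^+ 2 * ((V + 2 * B) / rt4 s * Num.sqrt `|x - y|))).
  apply: ler_pM => //; [by rewrite addr_ge0| |exact: hul].
  rewrite mulrDl; apply: lerD; first by rewrite rt4_sqr; exact: hV.
  rewrite ler_pdivlMr ?exprn_gt0// ler_wpM2l//.
  by apply: lerXn2r; rewrite ?nnegrE ?rt4_ge0// rt4_le.
by rewrite le_eqVlt; apply/orP; left; apply/eqP; field.
Qed.

Lemma truncated_solution : exists u ux uxx : R -> R -> R,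
  [/\ [/\ jointly_continuous u, jointly_continuous ux & jointly_continuous uxx],
      forall x, u x 0 = phi x,
      forall x, u q.1 q.2 @[q --> within [set q | 0 <= q.2] (nbhs ((x, 0) : R * R))] --> phi x,
      forall x t, 0 < t -> [/\ is_derive x 1 (u ^~ t) (ux x t),
         is_derive x 1 (ux ^~ t) (uxx x t) &
         is_derive t 1 (u x) (uxx x t + (f (u x t) - b (u x t) * ux x t))] &
      forall a, (forall y, phi (a - y) = - phi y) ->
        forall y s, 0 < s -> u (a - y) s = - u y s].
Proof.
have [u [v [cu cv bv uvE ou]]] := mild_solution bphi b1 bl fL fl bN fN.
set N := reaction b f u v in uvE.
have sN : source N by apply: (source_reaction (L := L)).
have hN : half_holder N by exact: mild_half_holder.
have b0 : heat_bounded 0 N by exact: heat_bounded_source.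
have b1' : heat_bounded 1 N by exact: heat_bounded_source.
have b2 : heat_bounded 2 N by exact: heat_bounded2.
(* The limit u satisfies Duhamel's formula for t > 0. Taking the formula itself as solution also
   fixes the value at t = 0: it is phi, since [duh] carries the factor t. *)
pose U x t := heat_op 0 phi x t + duh 0 N x t 0.
pose W x t := heat_op 2 phi x t + duh 2 N x t 0.
have UE x t : 0 < t -> u x t = U x t by move=> t0; have [h _] := uvE x t t0; exact: h.
have near2 x t : 0 < t -> \forall q \near ((x, t) : R * R), 0 < q.2.
  move=> t0; have c2 : q.2 @[q --> nbhs ((x, t) : R * R)] --> t by exact: cvg_snd.
  exact: (c2 _ (lt_nbhsr t0)).
exists U, v, W; split.
- split=> //; first exact: (jointly_continuous_mild bphi sN b0).
  exact: (jointly_continuous_mild bphi sN b2).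
- by move=> x; rewrite /U heat_op00 /duh mul0r addr0.
- move=> x; rewrite -[X in _ --> X](heat_op00 phi x) -[X in _ --> X]addr0.
  apply: cvgD.
    apply: (cvg_heat_op_fixed (C := Cphi) bphi); first by rewrite eqxx orbT.
      exact: cvg_within_filter cvg_fst.
    exact: cvg_within_filter cvg_snd.
  have [G G0 hG] := source_small 0 sN ltr01.
  have c2 : q.2 @[q --> nbhs ((x, 0) : R * R)] --> (0 : R) by exact: cvg_snd.
  have cG : G * rt4 q.2 @[q --> nbhs ((x, 0) : R * R)] --> (0 : R).
    have c3 : rt4 q.2 @[q --> nbhs ((x, 0) : R * R)] --> rt4 0.
      exact: (@cvg_comp _ _ _ (fun q : R * R => q.2) (@rt4 R) _ _ _ c2 (@continuous_rt4 R 0)).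
    rewrite rt40 in c3.
    by rewrite -[X in _ --> X](mulr0 G); apply: cvgM => //; exact: cvg_cst.
  apply/cvgrPdist_lt => e e0; rewrite near_withinE.
  have n1 : \forall q \near ((x, 0) : R * R), q.2 < 1.
    exact: (c2 _ (lt_nbhsl ltr01)).
  have /cvgrPdist_lt/(_ _ e0) := cG; apply: filterS2 n1 => q q1 hq /= q0.
  rewrite sub0r normrN; move: q0; rewrite le_eqVlt => /orP[/eqP <-|q0].
    by rewrite /duh mul0r normr0.
  apply: le_lt_trans (hG q.1 q.2 _) _; first by rewrite q0 ltW.
  by move: hq; rewrite sub0r normrN; apply: le_lt_trans; exact: ler_norm.
- move=> x t t0; split.
  + have [_ ->] := uvE x t t0.
    by apply: is_derive_add; [exact: (is_derive_heat_op bphi)|exact: is_derive_duh].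
  + have -> : v ^~ t = fun y => heat_op 1 phi y t + duh 1 N y t 0.
      by apply/funext => y; have [] := uvE y t t0.
    by apply: is_derive_add; [exact: (is_derive_heat_op bphi)|exact: is_derive_duh].
  + have -> : f (U x t) - b (U x t) * v x t = N x t by rewrite -UE.
    rewrite /W -addrA; apply: is_derive_add; first exact: (is_derive_heat_op_time bphi).
    exact: is_derive_duh_time.
- by move=> a oa y s s0; rewrite -!UE//; exact: ou.
Qed.

End regularity.

(** * Comparison principle *)

Section comparison.
Context (R : realType).

Lemma near_left_point (x : R) (P Q : R -> Prop) :
  (\forall y \near x^', P y) -> (\forall y \near x, Q y) ->
  exists y, [/\ y < x, P y & Q y].
Proof.
move=> /nbhs_ballP[e1 /= e10 H1] /nbhs_ballP[e2 /= e20 H2].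
pose e := Num.min e1 e2 / 2; have m0 : 0 < Num.min e1 e2 by rewrite lt_min e10.
have e0 : 0 < e by rewrite divr_gt0.
have ee : e < Num.min e1 e2 by rewrite /e; lra.
have [ee1 ee2] : e < e1 /\ e < e2 by move: ee; rewrite lt_min => /andP.
have B : `|x - (x - e)| = e by rewrite opprB addrCA subrr addr0 gtr0_norm.
have yx : x - e < x by lra.
exists (x - e); split => //; last by apply: H2; rewrite /ball/= B.
by apply: H1; [rewrite /ball/= B|rewrite lt_eqF].
Qed.

Lemma near_right_point (x : R) (P Q : R -> Prop) :
  (\forall y \near x^', P y) -> (\forall y \near x, Q y) ->
  exists y, [/\ x < y, P y & Q y].
Proof.
move=> /nbhs_ballP[e1 /= e10 H1] /nbhs_ballP[e2 /= e20 H2].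
pose e := Num.min e1 e2 / 2; have m0 : 0 < Num.min e1 e2 by rewrite lt_min e10.
have e0 : 0 < e by rewrite divr_gt0.
have ee : e < Num.min e1 e2 by rewrite /e; lra.
have [ee1 ee2] : e < e1 /\ e < e2 by move: ee; rewrite lt_min => /andP.
have B : `|x - (x + e)| = e by rewrite opprD addrA subrr sub0r normrN gtr0_norm.
have yx : x < x + e by lra.
exists (x + e); split => //; last by apply: H2; rewrite /ball/= B.
by apply: H1; [rewrite /ball/= B|rewrite gt_eqF].
Qed.

(** One-sided, for minima in time: at the final time only earlier times can be compared. *)
Lemma left_min_derive_le0 (f : R -> R) (x d : R) :
  (\forall y \near x, y < x -> f x <= f y) -> is_derive x 1 f d -> d <= 0.
Proof.
move=> fmin /is_derive_quot/cvgrPdist_lt dq; rewrite leNgt; apply/negP => d0.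
have [y [yx h1 h2]] := near_left_point (dq d d0) fmin.
move: h1; rewrite ltr_distlC => /andP[h1 _].
have : 0 < (f y - f x) / (y - x) by lra.
rewrite nmulr_lgt0 ?invr_lt0 ?subr_lt0//.
by have := h2 yx; lra.
Qed.

Lemma right_min_derive_ge0 (f : R -> R) (x d : R) :
  (\forall y \near x, x < y -> f x <= f y) -> is_derive x 1 f d -> 0 <= d.
Proof.
move=> fmin /is_derive_quot/cvgrPdist_lt dq; rewrite leNgt; apply/negP => d0.
have d0' : 0 < - d by lra.
have [y [yx h1 h2]] := near_right_point (dq _ d0') fmin.
move: h1; rewrite ltr_distlC => /andP[_ h1].
have : (f y - f x) / (y - x) < 0 by lra.
rewrite pmulr_llt0 ?invr_gt0 ?subr_gt0//.
by have := h2 yx; lra.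
Qed.

Lemma local_min_derive0 (f : R -> R) (x d : R) :
  (\forall y \near x, f x <= f y) -> is_derive x 1 f d -> d = 0.
Proof.
move=> fmin fd; apply/eqP; rewrite eq_le; apply/andP; split.
- by apply: left_min_derive_le0 fd; apply: filterS fmin.
- by apply: right_min_derive_ge0 fd; apply: filterS fmin.
Qed.

(** If d < 0, then g, which vanishes at x, is negative just to the right, and by the mean value
    theorem f falls below its minimum. *)
Lemma local_min_second_derive (f g : R -> R) (x d : R) :
  (\forall y \near x, f x <= f y) -> nbhs x [set y : R | is_derive y 1 f (g y)] ->
  is_derive x 1 g d -> 0 <= d.
Proof.
move=> fmin fg gd; rewrite leNgt; apply/negP => d0.
have fx := nbhs_singleton fg.
have gx := local_min_derive0 fmin fx.
have d0' : 0 < - d by lra.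
have /is_derive_quot/cvgrPdist_lt/(_ _ d0')/nbhs_ballP[e1 /= e10 H1] := gd.
have [y [yx h1 [h2 h3]]] : exists y, [/\ x < y, ball x e1 y &
    (f x <= f y) /\ forall z, x <= z <= y -> is_derive z 1 f (g z)].
  have /nbhs_ballP[e2 /= e20 H2] := fg.
  have n1 : \forall y \near x^', ball x e1 y.
    by apply/nbhs_ballP; exists e1.
  have n2 : \forall y \near x, f x <= f y /\ ball x e2 y.
    by apply: filterI => //; apply/nbhs_ballP; exists e2.
  have [y [yx h1 [h2 h3]]] := near_right_point n1 n2; exists y; split => //.
  split => // z /andP[xz zy]; apply: H2; move: h3; rewrite /ball/= !ltr_distlC => /andP[? ?].
  by apply/andP; split; lra.
have cf : {within `[x, y], continuous f}.
  apply: continuous_in_subspaceT => z; rewrite inE/= in_itv/= => zxy.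
  exact: (is_derive_continuous (h3 z zxy)).
have df z : z \in `]x, y[ -> is_derive z 1 f (g z).
  by rewrite in_itv/= => /andP[z1 z2]; apply: h3; rewrite !ltW.
have [c] := MVT yx df cf; rewrite in_itv/= => /andP[c1 c2] E.
have Bc : ball x e1 c.
  by move: h1; rewrite /ball/= !ltr_distlC => /andP[? ?]; apply/andP; split; lra.
have cn : c != x by rewrite gt_eqF.
move: (H1 _ Bc cn); rewrite gx subr0 ltr_distlC => /andP[_ hq].
have : g c / (c - x) < 0 by lra.
rewrite pmulr_llt0 ?invr_gt0 ?subr_gt0// => gc.
have : g c * (y - x) < 0 by rewrite pmulr_llt0// subr_gt0.
by rewrite -E; lra.
Qed.

(* At a negative minimum of [exp(-K t) (u - psi)] the derivatives of u and psi
   are ordered; [touch] is the contradiction with the equation of u. *)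
Lemma comparison (a T K : R) (u ut ux uxx psi psit psix psixx : R -> R -> R) :
  0 < a -> 0 < T ->
  {within `[- a, a] `*` `[0, T], continuous (fun q : R * R => u q.1 q.2 - psi q.1 q.2)} ->
  (forall t, 0 <= t <= T -> psi (- a) t <= u (- a) t /\ psi a t <= u a t) ->
  (forall x, - a <= x <= a -> psi x 0 <= u x 0) ->
  (forall x t : R, 0 < t -> [/\ is_derive x 1 (u ^~ t) (ux x t),
     is_derive x 1 (ux ^~ t) (uxx x t) & is_derive t 1 (u x) (ut x t)]) ->
  (forall x t : R, - a < x < a -> 0 < t <= T -> u x t < psi x t ->
     [/\ nbhs x [set y : R | is_derive y 1 (psi ^~ t) (psix y t)],
      is_derive x 1 (psix ^~ t) (psixx x t) & is_derive t 1 (psi x) (psit x t)]) ->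
  forall touch : (forall x t : R, - a < x < a -> 0 < t <= T -> u x t < psi x t ->
     ux x t = psix x t -> psixx x t <= uxx x t ->
     ut x t - psit x t <= K * (u x t - psi x t) -> False),
  forall x t, - a <= x <= a -> 0 <= t <= T -> psi x t <= u x t.
Proof.
move=> a0 T0 cw bd init du dpsi touch.
pose z (q : R * R) := expR (- (K * q.2)) * (u q.1 q.2 - psi q.1 q.2).
pose Q : set (R * R) := `[- a, a] `*` `[0, T].
have cz : {within Q, continuous z}.
  move=> q; apply: cvgM; last exact: cw.
  apply: (@continuous_subspaceT _ _ Q (fun q : R * R => expR (- (K * q.2)))) => p.
  apply: (@continuous_comp _ _ _ (fun q : R * R => - (K * q.2)) expR); last exact: continuous_expR.
  apply: cvgN; apply: cvgM; first exact: cvg_cst.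
  by case: p => p1 p2; exact: cvg_snd.
have Q0 : Q !=set0 by exists (0, 0); split; rewrite /= in_itv/=; apply/andP; split; lra.
have cQ : compact Q by apply: compact_setX; exact: segment_compact.
have [[x t] Qxt zmin] := compact_EVT_min Q0 cQ cz.
have [zxt|zxt] := leP 0 (z (x, t)).
  move=> y s ya sT; have := zmin (y, s).
  rewrite inE => /(_ _) zy; have {}zy : z (x, t) <= z (y, s) by apply: zy; split; rewrite /= in_itv.
  have := le_trans zxt zy; rewrite /z pmulr_rge0 ?expR_gt0//= subr_ge0.
  by [].
exfalso; move: Qxt; rewrite inE => -[/=]; rewrite !in_itv/= => xa tT.
have uz : u x t < psi x t by move: zxt; rewrite /z pmulr_rlt0 ?expR_gt0//= subr_lt0.
have t0 : 0 < t.
  case/andP: tT; rewrite le_eqVlt => /orP[/eqP t0|//] _.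
  by have := init x xa; rewrite t0 leNgt uz.
have {}xa : - a < x < a.
  have [b1 b2] := bd t tT.
  move: xa => /andP[x1 x2]; rewrite !lt_neqAle x1 x2 !andbT; apply/andP; split; apply/eqP => xE.
  - by move: b1; rewrite xE leNgt uz.
  - by move: b2; rewrite -xE leNgt uz.
have tT' : 0 < t <= T by rewrite t0; case/andP: tT.
have [du1 du2 du3] := du x t t0.
have [dp1 dp2 dp3] := dpsi x t xa tT' uz.
have wmin : \forall y \near x, u x t - psi x t <= u y t - psi y t.
  have xn : \forall y \near x, - a < y < a.
    by case/andP: xa => x1 x2; near=> y; apply/andP; split; near: y; [exact: lt_nbhsr|exact: lt_nbhsl].
  apply: filterS xn => y /andP[y1 y2].
  have := zmin (y, t); rewrite inE => /(_ _) zy.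
  have : z (x, t) <= z (y, t) by apply: zy; split; rewrite /= in_itv/= ?tT// !ltW.
  by rewrite /z ler_pM2l ?expR_gt0.
have e1 : ux x t = psix x t.
  apply/eqP; rewrite -subr_eq0; apply/eqP.
  apply: (local_min_derive0 wmin (f := fun y => u y t - psi y t)).
  exact: is_derive_sub du1 (nbhs_singleton dp1).
have e2 : psixx x t <= uxx x t.
  rewrite -subr_ge0; apply: (@local_min_second_derive (fun y => u y t - psi y t)
    (fun y => ux y t - psix y t) x _ wmin).
    by apply: filterS dp1 => y dy; apply: is_derive_sub => //; have [] := du y t t0.
apply: (touch x t xa tT' uz e1 e2).
have dK : is_derive t 1 (fun s => - (K * s)) (- K).
  apply: (is_derive_congr (is_derive_mul (is_derive_cst (- K) t 1) (is_derive_id t 1))) => [y|].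
    by rewrite /cst mulNr.
  by rewrite /cst mul0r add0r mulr1.
have de := is_derive_chain (g := fun s => - (K * s)) (is_derive_expR _) dK.
have dz := is_derive_mul de (is_derive_sub du3 dp3).
have : expR (- (K * t)) * - K * (u x t - psi x t) + expR (- (K * t)) * (ut x t - psit x t) <= 0.
  apply: left_min_derive_le0 dz.
  have tn : \forall s \near t, 0 < s by exact: lt_nbhsr.
  apply: filterS tn => s s0 st.
  have := zmin (x, s); rewrite inE => /(_ _) zs.
  apply: zs; split; rewrite /= in_itv/=; first by case/andP: xa => x1 x2; rewrite !ltW.
  by rewrite ltW//=; case/andP: tT => _; apply: le_trans; exact: ltW.
rewrite -mulrA -mulrDr pmulr_rle0 ?expR_gt0//; lra.
Unshelve. all: by end_near.
Qed.

End comparison.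

(** * Truncation and odd extension *)

Section clamp.
Context (R : realType).
Implicit Types (x y z lo hi : R).

Definition clamp lo hi y : R := Num.max lo (Num.min y hi).

Lemma clamp_id lo hi y : lo <= y <= hi -> clamp lo hi y = y.
Proof. by move=> /andP[h1 h2]; rewrite /clamp (min_idPl h2) (max_idPr h1). Qed.

Lemma clamp_itv lo hi y : lo <= hi -> lo <= clamp lo hi y <= hi.
Proof. by move=> h; rewrite /clamp le_max lexx/= ge_max h ge_min lexx orbT. Qed.

Lemma clamp_lo lo hi y : lo <= hi -> y <= lo -> clamp lo hi y = lo.
Proof. by move=> h yl; rewrite /clamp; apply/max_idPl; rewrite ge_min yl. Qed.

Lemma clamp_hi lo hi y : lo <= hi -> hi <= y -> clamp lo hi y = hi.
Proof. by move=> h yl; rewrite /clamp (min_idPr yl); exact/max_idPr. Qed.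

Lemma clamp_lipschitz lo hi y z : lo <= hi -> `|clamp lo hi y - clamp lo hi z| <= `|y - z|.
Proof.
move=> h; wlog yz : y z / y <= z.
  by move=> H; have [/H//|/ltW/H] := leP y z; rewrite distrC (distrC z).
have C t : [\/ t <= lo /\ clamp lo hi t = lo, hi <= t /\ clamp lo hi t = hi |
    lo <= t <= hi /\ clamp lo hi t = t].
  have [t1|t1] := leP t lo; first by constructor 1; rewrite clamp_lo.
  have [t2|t2] := leP hi t; first by constructor 2; rewrite clamp_hi.
  by constructor 3; rewrite clamp_id !ltW.
have E : clamp lo hi y <= clamp lo hi z /\ clamp lo hi z - clamp lo hi y <= z - y.
  by case: (C y) => -[? ->]; case: (C z) => -[? ->]; split; lra.
by rewrite distrC (distrC y) !ger0_norm ?subr_ge0//; case: E.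
Qed.

Lemma clampN y hi : 0 <= hi -> clamp (- hi) hi (- y) = - clamp (- hi) hi y.
Proof.
move=> h; have h' : - hi <= hi by lra.
have [y1|y1] := leP y (- hi); first by rewrite (clamp_lo h' y1) clamp_hi ?opprK//; lra.
have [y2|y2] := leP hi y; first by rewrite (clamp_hi h' y2) clamp_lo//; lra.
by rewrite !clamp_id//; apply/andP; split; lra.
Qed.

(** The derivative p c^(p - 1) is at most p on ]0, 1] because p > 1. The endpoint 0 is treated
    apart, where z^p <= z. *)
Lemma powR_lipschitz (p : R) y z : 1 < p -> 0 <= y <= 1 -> 0 <= z <= 1 ->
  `|y `^ p - z `^ p| <= p * `|y - z|.
Proof.
move=> p1; wlog yz : y z / y <= z.
  by move=> H y01 z01; have [/H->//|/ltW/H] := leP y z; rewrite distrC (distrC z); apply.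
move=> /andP[y0 y1] /andP[z0 z1].
have p0 : 0 <= p by lra.
have mono : y `^ p <= z `^ p by apply: ge0_ler_powR.
rewrite distrC (distrC y) !ger0_norm ?subr_ge0//.
move: y0; rewrite le_eqVlt => /orP[/eqP y0|y0].
  rewrite -y0 powR0 ?subr0; last by rewrite gt_eqF//; lra.
  move: z0; rewrite le_eqVlt => /orP[/eqP <-|z0].
    by rewrite powR0 ?mulr0// gt_eqF//; lra.
  apply: (@le_trans _ _ z); first by apply: ge1r_powR; [rewrite z0|exact: ltW].
  by rewrite ler_peMl//; lra.
move: yz; rewrite le_eqVlt => /orP[/eqP ->|yz]; first by rewrite !subrr mulr0.
have df c : c \in `]y, z[ -> is_derive c 1 (fun t => t `^ p) (p * c `^ (p - 1)).
  by rewrite in_itv/= => /andP[c1 _]; apply: is_derive1_powR; exact: lt_trans c1.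
have cf : {within `[y, z], continuous (fun t => t `^ p)}.
  apply: continuous_in_subspaceT => t; rewrite inE/= in_itv/= => /andP[t1 _].
  by apply: is_derive_continuous; apply: is_derive1_powR; exact: lt_le_trans t1.
have [c] := MVT yz df cf; rewrite in_itv/= => /andP[c1 c2] ->.
have h : c `^ (p - 1) <= 1 `^ (p - 1) by apply: ge0_ler_powR; rewrite ?nnegrE; lra.
rewrite powR1 in h.
by rewrite ler_wpM2r ?subr_ge0 ?(ltW yz)// ler_piMr.
Qed.

Definition pow01 (p : R) y : R := clamp 0 1 y `^ p.

(* An odd, bounded, globally Lipschitz function equal to [y^p - lambda y] on
   [0, 1]. *)
Definition nonlin (p lambda : R) y : R := pow01 p y - pow01 p (- y) - lambda * clamp (-1) 1 y.

Lemma pow01_itv p y : 0 <= p -> 0 <= pow01 p y <= 1.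
Proof.
move=> p0; have /andP[c0 c1] := clamp_itv y (ler01 : (0 : R) <= 1).
have h : clamp 0 1 y `^ p <= 1 `^ p by apply: ge0_ler_powR; rewrite ?nnegrE.
by rewrite powR_ge0/=; rewrite powR1 in h.
Qed.

Lemma nonlinN p lambda y : nonlin p lambda (- y) = - nonlin p lambda y.
Proof. by rewrite /nonlin opprK clampN//; ring. Qed.

Let N11 : (-1 : R) <= 1. Proof. lra. Qed.

Lemma nonlin_le p lambda y : 1 < p -> `|nonlin p lambda y| <= 2 * p + `|lambda|.
Proof.
move=> p1; have p0 : 0 <= p by lra.
have /andP[a0 a1] := pow01_itv y p0; have /andP[b0 b1] := pow01_itv (- y) p0.
apply: (le_trans (ler_normB _ _)); apply: lerD.
  by rewrite ler_norml; apply/andP; split; lra.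
rewrite normrM ler_piMr// ler_norml; exact: clamp_itv.
Qed.

Lemma nonlin_lipschitz p lambda y z : 1 < p ->
  `|nonlin p lambda y - nonlin p lambda z| <= (2 * p + `|lambda|) * `|y - z|.
Proof.
move=> p1.
have hp a b : `|pow01 p a - pow01 p b| <= p * `|a - b|.
  apply: (le_trans (powR_lipschitz p1 (clamp_itv a ler01) (clamp_itv b ler01))).
  by rewrite ler_wpM2l ?clamp_lipschitz//; lra.
have -> : nonlin p lambda y - nonlin p lambda z =
  (pow01 p y - pow01 p z) + - (pow01 p (- y) - pow01 p (- z)) +
  - (lambda * (clamp (-1) 1 y - clamp (-1) 1 z)) by rewrite /nonlin; ring.
apply: (le_trans (ler_normD _ _)); rewrite mulrDl; apply: lerD; last first.
  by rewrite normrN normrM ler_wpM2l// clamp_lipschitz.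
apply: (le_trans (ler_normD _ _)); rewrite normrN.
have h1 := hp y z; have h2 := hp (- y) (- z).
have e : `|- y - - z| = `|y - z| by rewrite -opprD normrN.
by rewrite e in h2; lra.
Qed.

Lemma nonlin0 p lambda : nonlin p lambda 0 = 0.
Proof. by rewrite /nonlin oppr0 clamp_id ?mulr0 ?subrr ?subr0//; lra. Qed.

Lemma nonlinE p lambda y : 1 < p -> 0 <= y <= 1 ->
  nonlin p lambda y = y `^ p - lambda * y.
Proof.
move=> p1 /andP[y0 y1]; have pn : p != 0 by rewrite gt_eqF//; lra.
have yn : pow01 p (- y) = 0 by rewrite /pow01 clamp_lo ?powR0//; lra.
by rewrite /nonlin yn subr0 /pow01 !clamp_id ?y0//; apply/andP; split; lra.
Qed.

End clamp.

(** * The odd periodic extension of the datum *)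

Section odd_extension.
Context (R : realType).
Implicit Types (x y t : R).

Let pi0 : 0 < pi :> R. Proof. exact: pi_gt0. Qed.

Lemma sin_asin_bound t : -1 <= sin t <= 1.
Proof. by rewrite sin_geN1 sin_le1. Qed.

Lemma asin_sin_itv t : - (pi / 2) <= asin (sin t) <= pi / 2.
Proof. by rewrite asin_geNpi2 ?asin_lepi2// sin_asin_bound. Qed.

Let m1 : - (pi / 2) \in `[- (pi / 2), (pi / 2 : R)].
Proof. by have pp := pi_gt0 R; rewrite in_itv/= lexx/=; lra. Qed.

Let m2 : (pi / 2 : R) \in `[- (pi / 2), (pi / 2 : R)].
Proof. by have pp := pi_gt0 R; rewrite in_itv/= lexx andbT; lra. Qed.

Let asin1 : asin 1 = pi / 2 :> R. Proof. by have := sinK m2; rewrite sin_pihalf. Qed.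

Let asinN1 : asin (-1) = - (pi / 2) :> R.
Proof. by have := sinK m1; rewrite sinN sin_pihalf. Qed.

(** Where sin t is 1 or -1, asin is at an end of its domain; there the value is extremal, so a
    one-sided estimate suffices, and it follows from monotonicity of sin on [- pi / 2, pi / 2]. *)
Lemma continuous_asin_sin : continuous (fun t : R => asin (sin t)).
Proof.
move=> t; have pp := pi_gt0 R; have [/andP[s1 s2]|] := boolP (-1 < sin t < 1).
  apply: (@continuous_comp _ _ _ (@sin R) (@asin R)); first exact: continuous_sin.
  by apply: continuous_asin; rewrite s1.
have mA s : asin (sin s) \in `[- (pi / 2), (pi / 2 : R)] by rewrite in_itv/= asin_sin_itv.
have sA (s : R) : sin (asin (sin s)) = sin s 
  by apply: asinK; rewrite in_itv/=; exact: sin_asin_bound.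
rewrite negb_and -!leNgt => /orP[h|h].
  have st : sin t = -1 by apply/eqP; rewrite eq_le h sin_geN1.
  have at_ : asin (sin t) = - (pi / 2) by rewrite st.
  apply/cvgrPdist_lt => e e0; rewrite at_.
  (* The minimum with pi / 2 keeps - pi / 2 + d in the range where sin is monotone. *)
  pose d := Num.min e (pi / 2); have d0 : 0 < d by rewrite lt_min e0/=; lra.
  have d2 : d <= pi / 2 by rewrite ge_min lexx orbT.
  have md : - (pi / 2) + d \in `[- (pi / 2), (pi / 2 : R)] by rewrite in_itv/=; apply/andP; split; lra.
  have sd : sin t < sin (- (pi / 2) + d).
    have := ltr_sin m1 md; rewrite sinN sin_pihalf st => ->; lra.
  have H : \forall s \near t, sin s < sin (- (pi / 2) + d) by exact: ((@continuous_sin R t) _ (lt_nbhsl sd)).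
  apply: filterS H => s /= hs.
  have : asin (sin s) < - (pi / 2) + d by rewrite -ltr_sin// sA.
  have /andP[g1 _] := asin_sin_itv s => g2.
  have de : d <= e by rewrite ge_min lexx.
  by rewrite ltr_distlC; apply/andP; split; lra.
have st : sin t = 1 by apply/eqP; rewrite eq_le h sin_le1.
have at_ : asin (sin t) = pi / 2 by rewrite st.
apply/cvgrPdist_lt => e e0; rewrite at_.
pose d := Num.min e (pi / 2); have d0 : 0 < d by rewrite lt_min e0/=; lra.
have d2 : d <= pi / 2 by rewrite ge_min lexx orbT.
have md : pi / 2 - d \in `[- (pi / 2), (pi / 2 : R)] by rewrite in_itv/=; apply/andP; split; lra.
have sd : sin (pi / 2 - d) < sin t.
  by have := ltr_sin md m2; rewrite sin_pihalf st => ->; lra.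
have H : \forall s \near t, sin (pi / 2 - d) < sin s by exact: ((@continuous_sin R t) _ (lt_nbhsr sd)).
apply: filterS H => s /= hs.
have : pi / 2 - d < asin (sin s) by rewrite -ltr_sin// sA.
have /andP[_ g1] := asin_sin_itv s => g2.
have de : d <= e by rewrite ge_min lexx.
by rewrite ltr_distlC; apply/andP; split; lra.
Qed.

Variables (alpha : R) (phi : R -> R).
Hypothesis a0 : 0 < alpha.

(* [x |-> 2 alpha / pi * asin (sin (pi x / 2 alpha))] is the triangle wave equal to
   the identity on [-alpha, alpha]; the sign of the cosine turns the even reflection
   of [phi] into an odd one. *)
Definition odd_ext x : R :=
  Num.sg (cos (pi / (2 * alpha) * x)) *
  phi (clamp (- alpha) alpha (2 * alpha / pi * asin (sin (pi / (2 * alpha) * x)))).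

Let an0 : alpha != 0. Proof. by rewrite gt_eqF. Qed.
Let pin0 : pi != 0 :> R. Proof. by rewrite gt_eqF. Qed.

Lemma odd_ext_odd1 x : odd_ext (2 * alpha - x) = - odd_ext x.
Proof.
rewrite /odd_ext.
have -> : pi / (2 * alpha) * (2 * alpha - x) = - (pi / (2 * alpha) * x) + pi by field.
by rewrite cosDpi sinDpi cosN sinN opprK sgrN mulNr.
Qed.

Lemma odd_ext_odd2 x : odd_ext (- (2 * alpha) - x) = - odd_ext x.
Proof.
rewrite /odd_ext.
have -> : pi / (2 * alpha) * (- (2 * alpha) - x) = - (pi / (2 * alpha) * x + pi) by field.
by rewrite cosN sinN cosDpi sinDpi opprK sgrN mulNr.
Qed.

Lemma odd_extE x : phi (- alpha) = 0 -> phi alpha = 0 -> - alpha <= x <= alpha ->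
  odd_ext x = phi x.
Proof.
move=> p1 p2 /andP[x1 x2]; rewrite /odd_ext.
set th := pi / (2 * alpha) * x.
have key (p y : R) : p != 0 -> y = 2 * alpha / p * (p / (2 * alpha) * y).
  by move=> pn; field; apply/andP.
have xE : x = 2 * alpha / pi * th by exact: key.
have c0 : 0 < pi / (2 * alpha) by rewrite divr_gt0// mulr_gt0.
have e1 : pi / (2 * alpha) * alpha = pi / 2 by field.
have th1 : - (pi / 2) <= th by rewrite -e1 -mulrN ler_pM2l.
have th2 : th <= pi / 2 by rewrite -e1 ler_pM2l.
rewrite sinK ?in_itv/= ?th1// -xE clamp_id ?x1//.
(* At the two endpoints the sign factor is not 1, but phi vanishes there. *)
have [xa|xa] := eqVneq x alpha; first by rewrite xa p2 mulr0.
have [xb|xb] := eqVneq x (- alpha); first by rewrite xb p1 mulr0.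
have xa' : x < alpha by rewrite lt_neqAle xa.
have xb' : - alpha < x by rewrite lt_neqAle eq_sym xb.
rewrite gtr0_sg ?mul1r// cos_gt0_pihalf//.
by rewrite -e1 -mulrN !ltr_pM2l// xb'.
Qed.

Lemma odd_ext_le C x : 0 <= C -> (forall y, - alpha <= y <= alpha -> `|phi y| <= C) ->
  `|odd_ext x| <= C.
Proof.
move=> C0 hC; rewrite /odd_ext normrM normr_sg.
have h : `|phi (clamp (- alpha) alpha (2 * alpha / pi * asin (sin (pi / (2 * alpha) * x))))| <= C.
  by have h := a0; apply: hC; apply: clamp_itv; lra.
by case: (_ != 0); rewrite ?mul1r ?mul0r.
Qed.

(** The sign jumps only where the cosine vanishes; there the triangle wave reaches alpha or - alpha,
    and phi is 0. *)
Lemma continuous_odd_ext : {within `[- alpha, alpha], continuous phi} ->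
  phi (- alpha) = 0 -> phi alpha = 0 -> continuous odd_ext.
Proof.
move=> cphi p1 p2 x; have pp := pi_gt0 R.
have aa : - alpha <= alpha by have h := a0; lra.
(* Only the values of phi on the interval are controlled; clamping the argument yields a function
   continuous on the whole line. *)
pose psi y := phi (clamp (- alpha) alpha y).
have ccl : continuous (clamp (- alpha) alpha).
  by apply: (@lipschitz_continuous R _ 1) => y z; rewrite mul1r clamp_lipschitz.
have cpsi : continuous psi.
  move=> y; apply/cvgrPdist_lt => e e0.
  have cI : `[- alpha, alpha]%classic (clamp (- alpha) alpha y) by rewrite /= in_itv/= clamp_itv.
  have /cvgrPdist_lt/(_ _ e0) := (subspace_continuousP _ _).1 cphi _ cI.
  rewrite near_withinE => H.
  have H' : \forall z \near y, `[- alpha, alpha]%classic (clamp (- alpha) alpha z) ->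
      `|phi (clamp (- alpha) alpha y) - phi (clamp (- alpha) alpha z)| < e by exact: (ccl y _ H).
  by apply: filterS H' => z; apply; rewrite /= in_itv/= clamp_itv.
have cth : continuous (fun y : R => pi / (2 * alpha) * y).
  by move=> y; apply: cvgM; [exact: cvg_cst|exact: cvg_id].
have ctri : continuous (fun y : R => 2 * alpha / pi * asin (sin (pi / (2 * alpha) * y))).
  move=> y; apply: cvgM; first exact: cvg_cst.
  apply: (@continuous_comp _ _ _ (fun y : R => pi / (2 * alpha) * y) (fun t => asin (sin t))).
    exact: cth.
  exact: continuous_asin_sin.
have cp : continuous (fun y => psi (2 * alpha / pi * asin (sin (pi / (2 * alpha) * y)))).
  move=> y; apply: (@continuous_comp _ _ _ (fun y : R => 2 * alpha / pi * asin (sin (pi / (2 * alpha) * y))) psi).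
    exact: ctri.
  exact: cpsi.
have cc : continuous (fun y : R => cos (pi / (2 * alpha) * y)).
  move=> y; apply: (@continuous_comp _ _ _ (fun y : R => pi / (2 * alpha) * y) (@cos R)).
    exact: cth.
  exact: continuous_cos.
have [c0|c0] := eqVneq (cos (pi / (2 * alpha) * x)) 0.
  have k1 (p : R) : p != 0 -> 2 * alpha / p * (p / 2) = alpha by move=> ?; field.
  have z0 : psi (2 * alpha / pi * asin (sin (pi / (2 * alpha) * x))) = 0.
    have := cos2Dsin2 (pi / (2 * alpha) * x); rewrite c0 expr0n add0r => /eqP.
    rewrite sqrf_eq1 => /orP[]/eqP ->.
      rewrite asin1.
      rewrite (k1 _ pin0).
      by rewrite /psi (clamp_hi aa (lexx _)).
    rewrite asinN1.
    rewrite mulrN (k1 _ pin0).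
    by rewrite /psi (clamp_lo aa (lexx _)).
  have ox : odd_ext x = 0 by rewrite /odd_ext c0 sgr0 mul0r.
  apply/cvgrPdist_lt => e e0; rewrite ox.
  have := cp x => /cvgrPdist_lt/(_ _ e0); apply: filterS => y.
  rewrite z0 !sub0r !normrN; apply: le_lt_trans.
  by rewrite /odd_ext normrM normr_sg; case: (_ != 0); rewrite ?mul1r// mul0r.
apply: cvgM; last exact: cp.
have key (e : R) : 0 < e -> \forall y \near x,
    Num.sg (cos (pi / (2 * alpha) * y)) = Num.sg (cos (pi / (2 * alpha) * x)).
  move=> _; have [cneg|cpos|/eqP] := ltgtP (cos (pi / (2 * alpha) * x)) 0; last by rewrite (negPf c0).
    have H : \forall y \near x, cos (pi / (2 * alpha) * y) < 0 by exact: (cc x _ (lt_nbhsl cneg)).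
    by apply: filterS H => y hy; rewrite !ltr0_sg.
  have H : \forall y \near x, 0 < cos (pi / (2 * alpha) * y) by exact: (cc x _ (lt_nbhsr cpos)).
  by apply: filterS H => y hy; rewrite !gtr0_sg.
apply/cvgrPdist_lt => e e0; apply: filterS (key e e0) => y ->.
by rewrite subrr normr0.
Qed.

End odd_extension.

(** * Positivity and the theorem *)

Section positivity.
Context (R : realType).
Implicit Types (x y t s : R).

(* The barrier is supported in a ball of radius r moving along the segment from
   (x1, 0) to (x2, t2); A is chosen so that the quadratic form in q arising from
   the parabolic operator is a square. *)
Lemma strict_positivity (a L x1 x2 t2 r0 m : R) (u ut ux uxx beta : R -> R -> R) :
  0 < a -> 0 <= L -> - a < x1 < a -> - a < x2 < a -> 0 < t2 -> 0 < r0 -> 0 < m ->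
  {within `[- a, a] `*` `[0, t2], continuous (fun q : R * R => u q.1 q.2)} ->
  (forall x t, - a <= x <= a -> 0 <= t <= t2 -> 0 <= u x t) ->
  (forall y, - a <= y <= a -> `|y - x1| < r0 -> m <= u y 0) ->
  (forall x t : R, 0 < t -> [/\ is_derive x 1 (u ^~ t) (ux x t),
     is_derive x 1 (ux ^~ t) (uxx x t) & is_derive t 1 (u x) (ut x t)]) ->
  (forall x t, - a < x < a -> 0 < t <= t2 -> `|beta x t| <= 1 /\
     uxx x t - beta x t * ux x t - L * u x t <= ut x t) ->
  0 < u x2 t2.
Proof.
move=> a0 L0 /andP[x1a x1b] /andP[x2a x2b] t20 r00 m0 cu u0 um du pde.
pose s := (x2 - x1) / t2.
(* The moving ball stays in [-a, a] at both ends of the segment, hence by convexity all along it. *)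
pose r := Num.min r0 (Num.min (Num.min (a - x1) (a + x1)) (Num.min (a - x2) (a + x2))).
have rp : 0 < r by rewrite !lt_min r00/=; apply/andP; split; apply/andP; split; lra.
have [rr0 ra1 rb1 ra2 rb2] : [/\ r <= r0, r <= a - x1, r <= a + x1, r <= a - x2 & r <= a + x2].
  by rewrite /r; split; rewrite !ge_min lexx ?orbT.
pose xi t := x1 + s * t.
pose q y t := r ^+ 2 - (y - xi t) ^+ 2.
(* With d = x - xi t and d^2 = r^2 - q, the diffusion term 8 d^2 - 4 q is 8 r^2 - 12 q. The drift
   relative to the moving centre contributes at least - 4 r (1 + |s|) q. *)
pose C := 12 + 4 * r * (1 + `|s|).
(* Then 8 r^2 - C q + (A - L) q^2 = 8 (r - C q / (16 r))^2. *)
pose A := L + C ^+ 2 / (32 * r ^+ 2).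
(* As q <= r^2, this makes the barrier at most m initially. *)
pose k := m / r ^+ 4; have k0 : 0 < k by rewrite divr_gt0// exprn_gt0.
pose psi y t := k * Num.max (q y t) 0 ^+ 2 * expR (- (A * t)).
pose psix y t := k * (2 * q y t * (- 2 * (y - xi t))) * expR (- (A * t)).
pose psixx y t := k * (8 * (y - xi t) ^+ 2 - 4 * q y t) * expR (- (A * t)).
pose psit y t := k * (4 * q y t * (y - xi t) * s - A * q y t ^+ 2) * expR (- (A * t)).
have rn0 : r != 0 by rewrite gt_eqF.
have t2n0 : t2 != 0 by rewrite gt_eqF.
have r4 : 0 < r ^+ 4 by rewrite exprn_gt0.
have xi_itv t : 0 <= t <= t2 -> r <= a - xi t /\ r <= a + xi t.
  move=> /andP[t0 tt]; set w := t / t2.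
  have w0 : 0 <= w by rewrite divr_ge0// ltW.
  have w1 : w <= 1 by rewrite ler_pdivrMr// mul1r.
  have -> : xi t = x1 + w * (x2 - x1) by rewrite /xi /s /w; field.
  by split; nra.
have psiE y t : 0 < q y t -> psi y t = k * q y t ^+ 2 * expR (- (A * t)).
  by move=> q0; rewrite /psi; congr (_ * _ ^+ 2 * _); apply/max_idPl; exact: ltW.
have psi0 y t : q y t <= 0 -> psi y t = 0.
  by move=> q0; rewrite /psi (max_idPr q0) expr0n mulr0 mul0r.
have dqx y t : is_derive y 1 (fun z => q z t) (- 2 * (y - xi t)).
  have d1 := is_derive_sub (is_derive_id y 1) (is_derive_cst (xi t) y 1).
  apply: (is_derive_congr (is_derive_sub (is_derive_cst (r ^+ 2) y 1) (is_derive_mul d1 d1))) => [z|].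
    by rewrite /q expr2.
  by rewrite /cst; ring.
have dqt y t : is_derive t 1 (fun z => q y z) (2 * (y - xi t) * s).
  have d0 := is_derive_add (is_derive_cst x1 t 1) (is_derive_mul (is_derive_cst s t 1) (is_derive_id t 1)).
  have d1 := is_derive_sub (is_derive_cst y t 1) d0.
  apply: (is_derive_congr (is_derive_sub (is_derive_cst (r ^+ 2) t 1) (is_derive_mul d1 d1))) => [z|].
    by rewrite /q /xi expr2.
  by rewrite /cst /xi; ring.
have det t : is_derive t 1 (fun z => expR (- (A * z))) (expR (- (A * t)) * - A).
  have dA : is_derive t 1 (fun z => - (A * z)) (- A).
    apply: (is_derive_congr (is_derive_mul (is_derive_cst (- A) t 1) (is_derive_id t 1))) => [z|].
      by rewrite /cst mulNr.
    by rewrite /cst mul0r add0r mulr1.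
  exact: (is_derive_chain (g := fun z => - (A * z)) (is_derive_expR _) dA).
have qposx y t : 0 < q y t -> \forall z \near y, 0 < q z t.
  move=> q0; have c : (fun z => q z t) @ y --> q y t by exact: (is_derive_continuous (dqx y t)).
  exact: (cvgr_gt _ c _ q0).
have qpost y t : 0 < q y t -> \forall z \near t, 0 < q y z.
  move=> q0; have c : (fun z => q y z) @ t --> q y t by exact: (is_derive_continuous (dqt y t)).
  exact: (cvgr_gt _ c _ q0).
have dpsix y t : 0 < q y t -> is_derive y 1 (psi ^~ t) (psix y t).
  move=> q0.
  have d : is_derive y 1 (fun z => k * (q z t * q z t) * expR (- (A * t))) (psix y t).
    apply: (is_derive_congr (is_derive_mul (is_derive_mul (is_derive_cst k y 1)
      (is_derive_mul (dqx y t) (dqx y t))) (is_derive_cst (expR (- (A * t))) y 1))) => //.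
    by rewrite /cst /psix; ring.
  apply: (near_eq_is_derive _ d); apply: filterS (qposx y t q0) => z qz.
  by rewrite psiE// expr2.
have dpsixx y t : is_derive y 1 (psix ^~ t) (psixx y t).
  have d1 := is_derive_sub (is_derive_id y 1) (is_derive_cst (xi t) y 1).
  apply: (is_derive_congr (is_derive_mul (is_derive_mul (is_derive_cst k y 1)
      (is_derive_mul (is_derive_mul (is_derive_cst (2 : R) y 1) (dqx y t))
        (is_derive_mul (is_derive_cst (- 2 : R) y 1) d1))) (is_derive_cst (expR (- (A * t))) y 1))) => //.
  by rewrite /cst /psixx /=; ring.
have dpsit y t : 0 < q y t -> is_derive t 1 (psi y) (psit y t).
  move=> q0.
  have d : is_derive t 1 (fun z => k * (q y z * q y z) * expR (- (A * z))) (psit y t).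
    apply: (is_derive_congr (is_derive_mul (is_derive_mul (is_derive_cst k t 1)
      (is_derive_mul (dqt y t) (dqt y t))) (det t))) => //.
    by rewrite /cst /psit; ring.
  apply: (near_eq_is_derive _ d); apply: filterS (qpost y t q0) => z qz.
  by rewrite psiE// expr2.
have cpsi : continuous (fun z : R * R => psi z.1 z.2).
  have c1 : continuous (fst : R * R -> R) by case=> z1 z2; exact: cvg_fst.
  have c2 : continuous (snd : R * R -> R) by case=> z1 z2; exact: cvg_snd.
  have cxi : continuous (fun z : R * R => z.1 - xi z.2).
    move=> z; apply: cvgB; first exact: c1.
    by apply: cvgD; [exact: cvg_cst|apply: cvgM; [exact: cvg_cst|exact: c2]].
  have cq : continuous (fun z : R * R => q z.1 z.2).
    by move=> z; apply: cvgB; [exact: cvg_cst|apply: cvg_expn; exact: cxi].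
  have cm : continuous (fun y : R => Num.max y 0).
    apply: (@lipschitz_continuous R _ 1) => y z; rewrite mul1r.
    rewrite ler_norml; apply/andP; split; case: (ger0P (y - z)) => h;
      case: (leP y 0) => h1; case: (leP z 0) => h2; clear -h h1 h2; lra.
  move=> z; apply: cvgM.
    apply: cvgM; first exact: cvg_cst.
    apply: cvg_expn.
    exact: (@cvg_comp _ _ _ (fun z : R * R => q z.1 z.2) (fun y => Num.max y 0) _ _ _ (cq z) (cm _)).
  apply: (@cvg_comp _ _ _ (fun z : R * R => - (A * z.2)) expR); last exact: continuous_expR.
  by apply: cvgN; apply: cvgM; [exact: cvg_cst|exact: c2].
have bdq y t : r <= `|y - xi t| -> q y t <= 0.
  move=> h; rewrite /q subr_le0 -(real_normK (num_real (y - xi t))).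
  by rewrite lerXn2r// nnegrE// ltW.
have key : psi x2 t2 <= u x2 t2.
  (* K = 1 is enough: at a contact point ut - psit >= L (psi - u) >= 0, while u - psi < 0. *)
  apply: (@comparison R a t2 1 u ut ux uxx psi psit psix psixx a0 t20) => //.
  - move=> z; apply: cvgB; first exact: cu.
    exact: (@continuous_subspaceT _ _ (`[- a, a] `*` `[0, t2]) (fun q : R * R => psi q.1 q.2) cpsi).
  - move=> t tt; have [h1 h2] := xi_itv t tt.
    have aa : - a <= - a <= a by apply/andP; split; lra.
    have ab : - a <= a <= a by apply/andP; split; lra.
    split; rewrite psi0 ?u0//; apply: bdq.
    + by rewrite ler_normr; apply/orP; right; lra.
    + by rewrite ler_normr; apply/orP; left; lra.
  - move=> y ya; have [qy|qy] := leP (q y 0) 0.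
      by rewrite psi0// u0// lexx/= ltW.
    have y1 : `|y - x1| < r.
      rewrite ltNge; apply/negP => h; move: qy; rewrite ltNge => /negP; apply.
      by apply: bdq; rewrite /xi mulr0 addr0.
    rewrite psiE// mulr0 oppr0 expR0 mulr1; apply: le_trans (um y ya _); last exact: lt_le_trans rr0.
    have qr : q y 0 <= r ^+ 2 by rewrite /q gerBl sqr_ge0.
    rewrite /k mulrAC ler_pdivrMr// ler_pM2l//.
    by rewrite -[4%N]/(2 * 2)%N exprM lerXn2r// nnegrE ltW// exprn_gt0.
  (* Since u >= 0, the barrier can exceed u only where q > 0, and there it is smooth. *)
  - move=> x t xa tt ult.
    have qx : 0 < q x t.
      rewrite ltNge; apply/negP => qx; move: ult; rewrite psi0//.
      have [x1' x2'] := andP xa; have [t1 t2'] := andP tt.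
      by rewrite ltNge u0// ?(ltW x1') ?(ltW x2') ?(ltW t1).
    split; [|exact: dpsixx|exact: dpsit].
    by apply: filterS (qposx x t qx) => z; exact: dpsix.
  - move=> x t xa tt ult e1 e2 e3.
    have [x1' x2'] := andP xa; have [t1 t2'] := andP tt.
    have ux0 : 0 <= u x t by apply: u0; rewrite ?(ltW x1') ?(ltW x2') ?(ltW t1).
    have qx : 0 < q x t.
      by rewrite ltNge; apply/negP => qx; move: ult; rewrite psi0// ltNge ux0.
    have [bb hpde] := pde x t xa tt.
    set d := x - xi t; set Q := q x t in qx.
    have dE : d ^+ 2 = r ^+ 2 - Q by rewrite /Q /q -/d; ring.
    have dr : `|d| <= r.
      by rewrite -(@ler_pXn2r _ 2) ?nnegrE ?(ltW rp)// real_normK ?num_real// dE gerBl ltW.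
    set e := expR (- (A * t)); have e0 : 0 < e by exact: expR_gt0.
    have psiv : psi x t = k * Q ^+ 2 * e by rewrite psiE.
    set be := beta x t in bb hpde.
    have main : 0 <= psixx x t - be * psix x t - psit x t - L * psi x t.
      rewrite psiv /psixx /psix /psit -/d -/Q -/e.
      have -> : k * (8 * d ^+ 2 - 4 * Q) * e - be * (k * (2 * Q * (-2 * d)) * e) -
        k * (4 * Q * d * s - A * Q ^+ 2) * e - L * (k * Q ^+ 2 * e) =
        k * e * (8 * d ^+ 2 - 4 * Q + 4 * Q * d * (be - s) + (A - L) * Q ^+ 2) by ring.
      rewrite pmulr_rge0; last exact: mulr_gt0.
      rewrite dE.
      have AE : (A - L) * Q ^+ 2 = 8 * (C * Q / (16 * r)) ^+ 2.
        by rewrite /A; field.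
      rewrite AE.
      have hb : `|d * (be - s)| <= r * (1 + `|s|).
        rewrite normrM ler_pM//; apply: (le_trans (ler_normB _ _)); lra.
      have hb2 : - (r * (1 + `|s|)) <= d * (be - s) by move: hb; rewrite ler_norml => /andP[].
      have hQ : - (4 * r * (1 + `|s|)) * Q <= 4 * Q * d * (be - s).
        have := ler_wpM2l (ltW qx) hb2; lra.
      have sq : 8 * (r - C * Q / (16 * r)) ^+ 2 = 8 * r ^+ 2 - C * Q + 8 * (C * Q / (16 * r)) ^+ 2.
        by field.
      have := sqr_ge0 (r - C * Q / (16 * r)).
      have CE : C * Q = 12 * Q + 4 * r * (1 + `|s|) * Q by rewrite /C; ring.
      lra.
    have h1 : be * ux x t = be * psix x t by rewrite e1.
    have h2 : u x t - psi x t < 0 by lra.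
    have h3 := mulr_ge0_le0 L0 (ltW h2).
    move: e2 e3 hpde main h1 h2 h3; clear; move: (psi x t) (psix x t) (psixx x t) (psit x t) => *; lra.
  - by rewrite (ltW x2a) (ltW x2b).
  - by rewrite (ltW t20)/=.
apply: lt_le_trans key.
have qx : q x2 t2 = r ^+ 2.
  have -> : q x2 t2 = r ^+ 2 - (x2 - (x1 + (x2 - x1) / t2 * t2)) ^+ 2 by [].
  by rewrite divfK// (addrC x1) subrK subrr expr0n subr0.
have r2 : 0 < r ^+ 2 by exact: exprn_gt0.
rewrite psiE qx//.
exact: (mulr_gt0 (mulr_gt0 k0 (exprn_gt0 2 r2)) (expR_gt0 _)).
Qed.

End positivity.

Lemma continuous_half_plane (R : realType) (u : R -> R -> R) (A : set (R * R)) :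
  jointly_continuous u ->
  (forall x, u q.1 q.2 @[q --> within [set q | 0 <= q.2] (nbhs ((x, 0) : R * R))] --> u x 0) ->
  A `<=` [set q | 0 <= q.2] -> {within A, continuous (fun q : R * R => u q.1 q.2)}.
Proof.
move=> cu cu0 hA; apply/subspace_continuousP => -[x s] As.
have := hA _ As; rewrite /= le_eqVlt => /orP[/eqP s0|s0].
  rewrite -s0; apply: cvg_trans (cu0 x); apply: cvg_app; exact: within_subset.
by apply: cvg_within_filter; exact: (cu x s s0).
Qed.

Lemma continuous_open_half_plane (R : realType) (D : set R) (v : R -> R -> R) :
  jointly_continuous v -> continuous_on_prod D `]0, +oo[ v.
Proof.
move=> cv; apply/subspace_continuousP => -[x s] [/= _]; rewrite in_itv/= andbT => s0.
by apply: cvg_within_filter; exact: (cv x s s0).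
Qed.

Lemma has_derive_within_is_derive (R : realType) (D : set R) (g : R -> R) (x l : R) :
  is_derive x 1 g l -> has_derive_within D g x l.
Proof. by move=> /is_derive_quot dg; exact: (cvg_within_filter _ dg). Qed.

Theorem theorem3p1 (R : realType) (p lambda : R) (hp : 1 < p) :
  exists2 alpha : R, 0 < alpha &
  exists2 eps : R, 0 < eps &
  forall phi : R -> R,
    C0 alpha phi ->
    (forall x : R, x \in `[- alpha, alpha] -> 0 <= phi x) ->
    (forall x : R, x \in `[- alpha, alpha] -> `|phi x| <= eps) ->
    exists u : R -> R -> R,
      global_classical_solution p lambda alpha phi u /\
      positive_solution alpha phi u.
Proof.
pose L := 2 * p + `|lambda|; have L0 : 0 <= L by rewrite addr_ge0//; lra.
(* [be] is 1 / alpha, and L bounds |f|. At contact with the barrier, diffusion contributes at most -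
   be^2, convection at most be and f at most L; and be^2 = (2 + L) be exceeds be + L. *)
pose be := 2 + L; have be0 : 0 < be by rewrite /be; lra.
pose alpha := be^-1; have a0 : 0 < alpha by rewrite invr_gt0.
have aK : be * alpha = 1 by rewrite divff// gt_eqF.
(* 1/2 is the minimum on [-alpha, alpha] of the barrier 1 - x^2 / (2 alpha^2). *)
exists alpha => //; exists (1 / 2); first by lra.
move=> phi [cphi phiL phiR] phi0 phile.
pose psi := odd_ext alpha phi.
have psiE x : - alpha <= x <= alpha -> psi x = phi x by exact: odd_extE.
have bpsi : bounded_cont (1 / 2) psi.
  split; first exact: continuous_odd_ext.
  move=> x; apply: (odd_ext_le a0) => [|y ya]; first lra.
  by apply: phile; rewrite in_itv.
pose b : R -> R := clamp (-1) 1.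
have N11 : (-1 : R) <= 1 by lra.
have b1 y : `|b y| <= 1 by rewrite ler_norml; exact: clamp_itv.
have bl y z : `|b y - b z| <= `|y - z| by exact: clamp_lipschitz.
have bN y : b (- y) = - b y by exact: clampN.
pose f := nonlin p lambda.
have fL y : `|f y| <= L by exact: nonlin_le.
have fl y z : `|f y - f z| <= L * `|y - z| by exact: nonlin_lipschitz.
have fN y : f (- y) = - f y by exact: nonlinN.
have [u [ux [uxx [[cu cux cuxx] u0 cu0 du uodd]]]] :=
  truncated_solution bpsi b1 bl fL fl bN fN.
pose ut x t := uxx x t + (f (u x t) - b (u x t) * ux x t).
have fu y : `|f y| <= L * `|y| by have := fl y 0; rewrite /f nonlin0 !subr0.
have an : - alpha <= - alpha <= alpha by apply/andP; split; lra.
have ap : - alpha <= alpha <= alpha by apply/andP; split; lra.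
have ubd t : 0 <= t -> u (- alpha) t = 0 /\ u alpha t = 0.
  rewrite le_eqVlt => /orP[/eqP <-|t0]; first by rewrite !u0 !psiE.
  (* Each endpoint is fixed by its own reflection, so u equals - u there. *)
  have h1 := uodd _ (odd_ext_odd1 phi a0) alpha t t0.
  have h2 := uodd _ (odd_ext_odd2 phi a0) (- alpha) t t0.
  have e1 : 2 * alpha - alpha = alpha by ring.
  have e2 : - (2 * alpha) - - alpha = - alpha by ring.
  by rewrite e1 in h1; rewrite e2 in h2; split; lra.
have cuA A : A `<=` [set q | 0 <= q.2] -> {within A, continuous (fun q : R * R => u q.1 q.2)}.
  by apply: continuous_half_plane => // x; rewrite u0; exact: cu0.
have sub T : `[- alpha, alpha] `*` `[0, T] `<=` [set q : R * R | 0 <= q.2].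
  by move=> q [_]; rewrite /= in_itv => /andP[].
have upos x t : - alpha <= x <= alpha -> 0 <= t -> 0 <= u x t.
  move=> xa t0; have T0 : 0 < t + 1 by lra.
  pose z (x t : R) : R := 0.
  (* At a negative minimum ux = 0 and uxx >= 0, so ut >= f(u) >= L u, which contradicts ut <= (L +
     1) u. *)
  apply: (@comparison R alpha (t + 1) (L + 1) u ut ux uxx z z z z a0 T0) => //.
  - by move=> q; apply: cvgB; [exact: (cuA _ (sub _))|exact: cvg_cst].
  - by move=> s /andP[s0 _]; have [-> ->] := ubd s s0.
  - by move=> y ya; rewrite u0 psiE// phi0// in_itv.
  - move=> y s _ _ _; split; [|exact: is_derive_cst|exact: is_derive_cst].
    by apply: filterE => r /=; exact: is_derive_cst.
  - move=> y s _ _; rewrite /z /ut => uy -> h1 h2.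
    have := fu (u y s); rewrite (ltr0_norm uy) ler_norml => /andP[h3 _].
    move: h2; rewrite mulr0 => h2; lra.
  - by rewrite t0/=; lra.
have ule x t : - alpha <= x <= alpha -> 0 <= t -> u x t <= 1.
  move=> xa t0; have T0 : 0 < t + 1 by lra.
  have sq (y : R) : - alpha <= y <= alpha -> (be * y) * (be * y) <= 1.
    move=> /andP[y1 y2].
    have h1 : be * y <= be * alpha by rewrite ler_pM2l.
    have h2 : be * - alpha <= be * y by rewrite ler_pM2l.
    by rewrite mulrN aK in h2; rewrite aK in h1; nra.
  pose w (y s : R) := be * y * (be * y) / 2 - 1.
  pose wx (y s : R) := be * (be * y).
  pose wxx (y s : R) := be * be.
  pose z (y s : R) : R := 0.
  have wu : w x t <= - u x t.
    (* The upper bound is the lower bound of - u by the negated barrier. The barrier does not depend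
       on time and [be] leaves a strict margin, so K = 0 works. *)
    apply: (@comparison R alpha (t + 1) 0 (fun y s => - u y s) (fun y s => - ut y s)
      (fun y s => - ux y s) (fun y s => - uxx y s) w z wx wxx a0 T0) => //.
    + move=> q; apply: cvgB; first by apply: cvgN; exact: (cuA _ (sub _)).
      apply: (@continuous_subspaceT _ _ _ (fun q : R * R => w q.1 q.2)) => -[q1 q2].
      have c1 : be * r.1 @[r --> nbhs ((q1, q2) : R * R)] --> be * q1.
        by apply: cvgM; [exact: cvg_cst|exact: cvg_fst].
      by apply: cvgB; [apply: cvgM; [exact: cvgM|exact: cvg_cst]|exact: cvg_cst].
    + move=> s /andP[s0 _]; have [-> ->] := ubd s s0.
      have h1 := sq _ an; have h2 := sq _ ap; rewrite /w oppr0; split; lra.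
    + move=> y ya; rewrite u0 psiE//.
      have h1 := sq _ ya; have ya' : y \in `[- alpha, alpha] by rewrite in_itv.
      have h2 := phile y ya'; rewrite ger0_norm ?phi0// in h2; rewrite /w; lra.
    + move=> y s s0; have [d1 d2 d3] := du y s s0.
      by split; exact: is_deriveN.
    + move=> y s _ _ _; have dl (r : R) : is_derive r 1 (fun y => be * y) be.
        apply: (is_derive_congr (is_derive_mul (is_derive_cst be r 1) (is_derive_id r 1))) => //.
        by rewrite /cst mul0r add0r mulr1.
      split; [apply: filterE => r /=| |exact: is_derive_cst].
      * apply: (is_derive_congr (is_derive_sub (is_derive_mul (is_derive_mul (dl r) (dl r))
          (is_derive_cst (2^-1 : R) r 1)) (is_derive_cst (1 : R) r 1))) => //.
        by rewrite /cst /wx; field.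
      * apply: (is_derive_congr (is_derive_mul (is_derive_cst be y 1) (dl y))) => //.
        by rewrite /cst /wxx; ring.
    + move=> y s ya _ _; rewrite /wx /wxx /z /ut mul0r => e1 e2 e3.
      have ya' : - alpha <= y <= alpha by case/andP: ya => h1 h2; rewrite !ltW.
      have hx : `|ux y s| <= be.
        rewrite -normrN e1 normrM gtr0_norm// ger_pMr//.
        by rewrite -(@ler_pXn2r _ 2) ?nnegrE// real_normK ?num_real// expr1n expr2 sq.
      have hbx : `|b (u y s) * ux y s| <= be.
        by rewrite normrM; apply: (le_trans _ hx); rewrite ler_piMl.
      move: hbx; rewrite ler_norml => /andP[h1 _].
      have := fL (u y s); rewrite ler_norml => /andP[_ h2].
      have h3 : be * be = be * 2 + be * L by rewrite /be; ring.
      have h4 := mulr_ge0 (ltW be0) L0.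
      have h5 : be = 2 + L by [].
      clear -e2 e3 h1 h2 h3 h4 h5 L0; lra.
    + by rewrite t0/=; lra.
  by move: wu; rewrite /w; have := mulr_ge0 (sqr_ge0 be) (sqr_ge0 x); nra.
have uI x t : - alpha <= x <= alpha -> 0 <= t -> 0 <= u x t <= 1.
  by move=> xa t0; rewrite upos// ule.
have bE x t : - alpha <= x <= alpha -> 0 <= t -> b (u x t) = u x t.
  by move=> xa t0; apply: clamp_id; have /andP[h1 h2] := uI x t xa t0; apply/andP; split; lra.
have cut : jointly_continuous ut.
  have cb : continuous b by apply: (@lipschitz_continuous R _ 1) => y z; rewrite mul1r.
  have cf : continuous f by exact: (@lipschitz_continuous R _ L).
  move=> x s s0; apply: cvgD; first exact: cuxx.
  have cfu := @cvg_comp _ _ _ (fun q : R * R => u q.1 q.2) f _ _ _ (cu x s s0) (cf _).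
  have cbu := @cvg_comp _ _ _ (fun q : R * R => u q.1 q.2) b _ _ _ (cu x s s0) (cb _).
  by apply: cvgB; [exact: cfu|apply: cvgM; [exact: cbu|exact: cux]].
exists u; split; first split.
- by apply: cuA => q [_]; rewrite /= in_itv/= andbT.
- exists ut, ux, uxx; split.
  + split; [|exact: continuous_open_half_plane|exact: continuous_open_half_plane
      |exact: continuous_open_half_plane|exact: continuous_open_half_plane].
    move=> x t _ t0; have [d1 d2 d3] := du x t t0.
    by split => //; exact: has_derive_within_is_derive.
  + move=> x t; rewrite in_itv/= => xa t0.
    rewrite /ut (bE _ _ xa (ltW t0)) /f (nonlinE lambda hp (uI _ _ xa (ltW t0))); ring.
  + by move=> t t0; apply: ubd; exact: ltW.
  + by move=> x; rewrite in_itv/= => xa; rewrite u0 psiE.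
- split; first by move=> x t; rewrite in_itv/=; exact: upos.
move=> [x1]; rewrite in_itv/= => x1a phin x2 t2; rewrite in_itv/= => x2a t20.
have x1p : 0 < phi x1 by rewrite lt_neqAle eq_sym phin phi0// in_itv.
have x1i : - alpha < x1 < alpha.
  have [h1 h2] := andP x1a; rewrite !lt_neqAle h1 h2 !andbT; apply/andP; split.
  - by apply/eqP => e; move: phin; rewrite -e phiL eqxx.
  - by apply/eqP => e; move: phin; rewrite e phiR eqxx.
(* By continuity the datum stays above half its value at x1 on a whole ball, which the initial bump
   needs. *)
pose m := phi x1 / 2; have m0 : 0 < m by rewrite divr_gt0.
have mp : m < psi x1 by rewrite psiE// /m; lra.
have cpsi : psi @ x1 --> psi x1 by case: bpsi => c _; exact: c.
have /nbhs_ballP[r0 /= r00 hr] : \forall y \near x1, m < psi y by exact: (cvgr_gt _ cpsi _ mp).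
(* The drift coefficient is u itself, bounded by 1; the differential inequality follows from f(u) >=
   - L u. *)
apply: (@strict_positivity R alpha L x1 x2 t2 r0 m u ut ux uxx u a0 L0 x1i x2a t20 r00 m0).
- exact: (cuA _ (sub _)).
- by move=> x t xa /andP[t0 _]; exact: upos.
- by move=> y ya yx; rewrite u0; apply: ltW; apply: hr; rewrite /ball/= distrC.
- by move=> x t t0; have [d1 d2 d3] := du x t t0.
move=> x t xa /andP[t0 _].
have xa' : - alpha <= x <= alpha by case/andP: xa => h1 h2; rewrite !ltW.
have /andP[ux0 ux1] := uI x t xa' (ltW t0).
split; first by rewrite ger0_norm.
rewrite /ut (bE _ _ xa' (ltW t0)).
have := fu (u x t); rewrite (ger0_norm ux0) ler_norml => /andP[h1 _].
clear -h1; lra.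
Qed.
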